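(* Under the assumptions of Lemma 4.3, namely: $\Theta\subseteq\mathbb{R}^d$, functions $f_\theta\colon[0,\infty)\times\mathbb{N}_0\to[0,\infty)$, $\theta_0\in\Theta$, constants $\delta>0$, $C<\infty$, $\kappa_1,\kappa_2\ge0$ with $\kappa_1+\kappa_2<1$ such that for all $\theta'\in\Theta$ with $\|\theta'-\theta_0\|\le\delta$ we have $|f_{\theta'}(\lambda,y)-f_{\theta_0}(\lambda,y)|\le C\|\theta'-\theta_0\|(\lambda+y+1)$ and $|f_{\theta'}(\lambda,y)-f_{\theta'}(\tilde\lambda,\tilde y)|\le\kappa_1|\lambda-\tilde\lambda|+\kappa_2|y-\tilde y|$ for all $\lambda,\tilde\lambda\ge0$, $y,\tilde y\in\mathbb{N}_0$; a strictly stationary process $((N_t,\lambda_t))_{t\in\mathbb{Z}}$ with $N_t\mid\sigma(\lambda_s,N_s:s\le t-1)\sim\mathrm{Poisson}(\lambda_t)$ and $\lambda_t=f_{\theta_0}(\lambda_{t-1},N_{t-1})$; estimators $\widehat\theta_n$ with $\widehat\theta_n-\theta_0=O_P(n^{-1/2})$; an arbitrary almost surely finite starting value $\widehat\lambda_1\ge0$ and $\widehat\lambda_t=f_{\widehat\theta_n}(\widehat\lambda_{t-1},N_{t-1})$ for $t=2,\dots,n$ — the statistic $$\widehat T_n=\frac{1}{\sqrt n}\sum_{t=1}^n\big\{(N_t-\widehat\lambda_t)^2-N_t\big\}$$ satisfies $\widehat T_n\xrightarrow{d}\mathcal{N}(0,2E\lambda_1^2)$ as $n\to\infty$.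
   Context: $O_P(a_n)$ means bounded in probability after division by $a_n$. The special case of a single fixed $f_0$ (i.e. $\widehat\theta_n\equiv\theta_0$) covers the statistic with an arbitrary starting value. *)

(* Defs.v *)
From HB Require Import structures.
From mathcomp Require Import all_boot all_order all_algebra.
From mathcomp Require Import all_classical all_reals all_analysis.
Set Implicit Arguments. Unset Strict Implicit. Unset Printing Implicit Defensive.
Import Order.TTheory GRing.Theory Num.Theory.
Import numFieldNormedType.Exports.
Local Open Scope classical_set_scope.
Local Open Scope ring_scope.

Section defs.
Context {R : realType}.

(* Poisson probability mass function p_r(k) = e^{-r} r^k / k!
   (valid also for r = 0, where it is the point mass at 0). *)
Definition pois_pmf (r : R) (k : nat) : R := expR (- r) * r ^+ k / k`!%:R.

Context {d : measure_display} {T : measurableType d} (P : probability T R).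

Definition past_sigma (N : int -> T -> nat) (lam : int -> T -> R) (t : int)
  : set (set T) :=
  <<s [set A | exists s : int, (s <= t)%R /\
        ((exists B : set nat, A = N s @^-1` B) \/
         (exists B : set R, measurable B /\ A = lam s @^-1` B))] >>.

Definition cond_poisson (N : int -> T -> nat) (lam : int -> T -> R) : Prop :=
  forall (t : int) (k : nat) (F : set T), past_sigma N lam (t - 1) F ->
    P (F `&` N t @^-1` [set k]) =
    (\int[P]_(w in F) (pois_pmf (lam t w) k)%:E)%E.

(* Strict stationarity of ((N_t, lambda_t))_{t in Z}: all finite-dimensional
   distributions are shift invariant (tested on measurable rectangles, which
   generate the product sigma-field). *)
Definition strictly_stationary (N : int -> T -> nat) (lam : int -> T -> R)
  : Prop :=
  forall (m : nat) (A : nat -> set nat) (B : nat -> set R),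
    (forall i, measurable (B i)) ->
    forall t h : int,
      P (\bigcap_(i < m) (N (t + i%:Z) @^-1` A i `&` lam (t + i%:Z) @^-1` B i))
      = P (\bigcap_(i < m) (N (t + h + i%:Z) @^-1` A i
                              `&` lam (t + h + i%:Z) @^-1` B i)).

Definition OP_rate (X : nat -> T -> R) (a : nat -> R) : Prop :=
  forall eps : R, 0 < eps -> exists M : R, exists n0 : nat,
    forall n, (n0 <= n)%N ->
      (P [set w | (M < `|X n w| / a n)%R] <= eps%:E)%E.

(* E[g(Z)] for Z ~ N(0, s^2) (s >= 0 the standard deviation;
   s = 0 gives the point mass at 0). *)
Definition normal_expect (s : R) (g : R -> R) : \bar R :=
  if s == 0 then (g 0)%:E
  else (\int[lebesgue_measure]_x (g x * normal_pdf 0 s x)%:E)%E.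

Definition cvg_dist_normal (X : nat -> T -> R) (s : R) : Prop :=
  forall g : R -> R, continuous g -> (exists M : R, forall x, `|g x| <= M) ->
    (fun n => (\int[P]_w (g (X n w))%:E)%E) @ \oo --> normal_expect s g.

End defs.

(* Plug-in intensity recursion: lamhat_seq f th l1 Ns k = hat(lambda)_{k+1},
   where Ns k = N_{k+1}; hat(lambda)_1 = l1 and
   hat(lambda)_{t} = f_th(hat(lambda)_{t-1}, N_{t-1}). *)
Fixpoint lamhat_seq {R : realType} {dim : nat}
  (f : 'rV[R]_dim -> R -> nat -> R) (th : 'rV[R]_dim) (l1 : R)
  (Ns : nat -> nat) (k : nat) : R :=
  match k with
  | 0 => l1
  | k'.+1 => f th (lamhat_seq f th l1 Ns k') (Ns k')
  end.

Definition T_stat {R : realType} {dim : nat}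
  (f : 'rV[R]_dim -> R -> nat -> R) (th : 'rV[R]_dim) (l1 : R)
  (Ns : nat -> nat) (n : nat) : R :=
  (Num.sqrt (n%:R))^-1 *
  \sum_(k < n) (((Ns k)%:R - lamhat_seq f th l1 Ns k) ^+ 2 - (Ns k)%:R).

(* Main.v *)
(* Let S_n = n^(-1/2) sum_(t <= n) ((N_t - lam_t)^2 - N_t) be the statistic with the
   true intensity. Its summands are martingale differences with conditional variance
   2 lam_t^2. The contraction k1 + k2 < 1 yields an exponential moment of lam_t and
   geometrically decaying covariances, hence a law of large numbers for lam_t^2. The
   central limit theorem for S_n follows by Lindeberg's replacement method with the
   heat kernel as test function: each increment of S_n is traded for a decrease of the
   time variable by its conditional variance, so that no characteristic function or
   stopping time is needed.

   The statistic of the theorem minus S_n is n^(-1/2) sum (D_t^2 - 2 D_t e_t), with D_t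
   the plug-in error and e_t = N_t - lam_t. On an event of large probability D_t is of
   order n^(-1/2), so only the cross term matters, and it is not a martingale because
   the estimator sees the whole sample. By contraction D_t depends, up to a
   geometrically small error, on lam_(t-m) and on the last m counts only, through a
   Lipschitz function. Cutting these values into O(n^(1/2)) cells, the cross term is at
   most O(n^(-1)) times the sum over the cells of |sum_(t in cell) e_t|, and the
   orthogonality of the e_t makes this sum O(n^(3/4)).

   The statistic need not be measurable, since f_theta is arbitrary in theta; the
   integrals of bounded functions of it are squeezed between measurable ones. *)
Require Import Defs.
From HB Require Import structures.
From mathcomp Require Import all_boot all_order all_algebra.
From mathcomp Require Import all_classical all_reals all_analysis.
From mathcomp Require Import measurable_realfun.
From mathcomp Require Import ring lra zify.
Set Implicit Arguments. Unset Strict Implicit. Unset Printing Implicit Defensive.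
Import Order.TTheory GRing.Theory Num.Theory.
Import numFieldNormedType.Exports.
Local Open Scope classical_set_scope.
Local Open Scope ring_scope.

(** * Sums against the Poisson weights *)

Section poisson.
Context {R : realType}.
Implicit Types (l x s : R) (k j : nat).

(** Convergence of [E heat (S_n - a) c] for all [a] and [c > 0] says that the density of [S_n] plus
    an independent Gaussian of variance [c] converges pointwise; Scheffe's argument turns this into
    weak convergence, and this is why the heat kernel alone suffices as a test function. The
    quadratic variation is random and may overshoot its limit, so the time variable is capped, and
    the law of large numbers in mean pays for the cap. Stationarity gives no moment in advance. The
    exponential moment comes from restarting the chain on an event where [lam_1] is bounded:
    contraction erases the bound, and the complement is so unlikely that it is harmless after
    truncation. In the cross term the counts are integers, so a bounded block of them takes finitely
    many values and only the intensity has to be cut, with mesh a small multiple of [n^(-1/2)]. That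
    is small against [D_t], yet leaves far fewer cells than [n]. The parameters are fixed in the
    order [m], then the truncation level [L], then [n], with constants free of the estimator, which
    enters only as a Lipschitz map close to the true one. *)

Lemma pois_pmf_ge0 l k : 0 <= l -> 0 <= pois_pmf l k.
Proof. by move=> l0; rewrite /pois_pmf !mulr_ge0 ?expR_ge0 ?exprn_ge0. Qed.

Lemma nneseries_exp x : 0 <= x ->
  (\sum_(k <oo) (x ^+ k / k`!%:R)%:E = (expR x)%:E)%E.
Proof.
move=> x0; rewrite /expR -EFin_lim; last exact: is_cvg_series_exp_coeff.
apply/congr_lim/funext => n /=; rewrite /series/= -sumEFin//.
Qed.

(** Falling factorials have moments in closed form: the first [j] terms vanish and [k!] absorbs the
    falling factorial, so the shift by [j] leaves [l^j e^(-l)] times the exponential series. *)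
Lemma nneseries_pois_ffact l j : 0 <= l ->
  (\sum_(k <oo) (pois_pmf l k * (k ^_ j)%:R)%:E = (l ^+ j)%:E)%E.
Proof.
move=> l0.
have f0 k : (0 <= (pois_pmf l k * (k ^_ j)%:R)%:E)%E.
  by rewrite lee_fin mulr_ge0 ?pois_pmf_ge0.
rewrite (nneseries_split 0 j)//= add0n big_nat big1 ?add0e; last first.
  by move=> k /= kj; rewrite ffact_small ?mulr0.
rewrite -nneseries_addn//.
under eq_eseriesr => k _.
  have -> : pois_pmf l (k + j) * ((k + j) ^_ j)%:R =
            (l ^+ j * expR (- l)) * (l ^+ k / k`!%:R).
    have /negbTE n1 : ((k + j) ^_ j)%:R != 0 :> R.
      by rewrite pnatr_eq0 -lt0n ffact_gt0 leq_addl.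
    have /negbTE n2 : k`!%:R != 0 :> R by rewrite pnatr_eq0 -lt0n fact_gt0.
    rewrite /pois_pmf -(ffact_fact (leq_addl k j)) addnK natrM exprD.
    by field; rewrite n1 n2.
  rewrite EFinM; over.
rewrite nneseriesZl/=; last first.
  by move=> k _; rewrite lee_fin divr_ge0 ?exprn_ge0.
by rewrite nneseries_exp// -EFinM -mulrA -expRD addNr expR0 mulr1.
Qed.

(** The moment generating function: the tilt [e^(s k)] turns the parameter [l] into [l e^s]. *)
Lemma nneseries_pois_expR l s : 0 <= l ->
  (\sum_(k <oo) (pois_pmf l k * expR (s * k%:R))%:E
    = (expR (l * (expR s - 1)))%:E)%E.
Proof.
move=> l0.
under eq_eseriesr => k _.
  have -> : pois_pmf l k * expR (s * k%:R) =
      expR (- l) * ((l * expR s) ^+ k / k`!%:R).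
    by rewrite /pois_pmf exprMn [s * _]mulrC expRM_natl; ring.
  rewrite EFinM; over.
rewrite nneseriesZl/=; last first.
  by move=> k _; rewrite lee_fin divr_ge0 ?exprn_ge0 ?mulr_ge0 ?expR_ge0.
rewrite nneseries_exp ?mulr_ge0 ?expR_ge0// -EFinM -expRD; congr (expR _)%:E.
by ring.
Qed.

(** The expectation of [phi] under the Poisson law of parameter [l], written as a power series so
    that it can be differentiated in [l]. *)
Definition pois_mean (phi : nat -> R) l : R :=
  expR (- l) * limn (pseries (fun k => phi k / k`!%:R) l).

Lemma is_cvg_pseries_fact (phi : nat -> R) (B : R) x :
  (forall k, `|phi k| <= B) -> cvgn (pseries (fun k => phi k / k`!%:R) x).
Proof.
move=> phiB; apply: normed_cvg.
have B0 : 0 <= B by apply: le_trans (phiB 0); exact: normr_ge0.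
apply: (@series_le_cvg _ _ (fun k => B * exp_coeff `|x| k)) => [k|k|k|].
- exact: normr_ge0.
- by rewrite mulr_ge0// exp_coeff_ge0.
- rewrite /exp_coeff/= mulrAC !normrM normfV normrX [`|_%:R|]ger0_norm//.
  by rewrite -mulrA ler_wpM2r ?divr_ge0 ?exprn_ge0.
- exact/is_cvg_seriesZ/is_cvg_series_exp_coeff.
Qed.

Lemma nneseries_pois_mean (phi : nat -> R) (B : R) l : 0 <= l ->
  (forall k, 0 <= phi k <= B) ->
  (\sum_(k <oo) (pois_pmf l k * phi k)%:E = (pois_mean phi l)%:E)%E.
Proof.
move=> l0 phiB.
under eq_eseriesr => k _.
  have -> : pois_pmf l k * phi k = expR (- l) * (phi k / k`!%:R * l ^+ k).
    by rewrite /pois_pmf; ring.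
  rewrite EFinM; over.
rewrite nneseriesZl/=; last first.
  move=> k _; rewrite lee_fin mulr_ge0 ?exprn_ge0 ?divr_ge0//.
  by have /andP[] := phiB k.
rewrite /pois_mean EFinM; congr (_ * _)%E; rewrite -EFin_lim; last first.
  apply: (@is_cvg_pseries_fact _ B) => k.
  by have /andP[? ?] := phiB k; rewrite ger0_norm.
by apply/congr_lim/funext => n /=; rewrite /pseries /series/= -sumEFin.
Qed.

Lemma pseriesB_fact (a b : nat -> R) x :
  pseries (fun k => (a k - b k) / k`!%:R) x =
  pseries (fun k => a k / k`!%:R) x - pseries (fun k => b k / k`!%:R) x.
Proof.
apply/funext => n; transitivity (pseries (fun k => a k / k`!%:R) x n -
  pseries (fun k => b k / k`!%:R) x n) => //.
by rewrite /pseries /series/= -sumrB; apply: eq_bigr => i _; rewrite -mulrBl -mulrBl.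
Qed.

(** Termwise differentiation shifts the index of the series, and the derivative of [e^(-l)]
    subtracts the unshifted series; the outcome is the Poisson mean of the increments of [phi]. *)
Lemma is_derive_pois_mean (phi : nat -> R) (B : R) x : (forall k, `|phi k| <= B) ->
  is_derive x 1 (pois_mean phi) (pois_mean (fun k => phi k.+1 - phi k) x).
Proof.
move=> phiB.
have dfE psi : pseries_diffs (fun k => psi k / k`!%:R) =
    (fun k => psi k.+1 / k`!%:R) :> (nat -> R).
  apply/funext => k; rewrite /pseries_diffs factS natrM.
  have /negbTE n2 : k`!%:R != 0 :> R by rewrite pnatr_eq0 -lt0n fact_gt0.
  have /negbTE n1 : k.+1%:R != 0 :> R by rewrite pnatr_eq0.
  by move: (psi _) (k.+1%:R : R) (k`!%:R : R) n1 n2 => a b c n1 n2; field; rewrite n1 n2.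
have := @pseries_snd_diffs R (fun k => phi k / k`!%:R) (`|x| + 1) x.
rewrite !dfE => /(_ _ _ _ _)[].
- exact: (@is_cvg_pseries_fact _ B).
- by apply: (@is_cvg_pseries_fact _ B) => k.
- by apply: (@is_cvg_pseries_fact _ B) => k.
- by rewrite [ltRHS]ger0_norm ?addr_ge0// ltrDl.
move=> dp Edp.
have dP : is_derive x 1 (fun x => limn (pseries (fun k => phi k / k`!%:R) x))
   (limn (pseries (fun k => phi k.+1 / k`!%:R) x)) by split.
rewrite /pois_mean; apply: is_derive_eq.
rewrite pseriesB_fact limB; [|exact: (@is_cvg_pseries_fact _ B)..].
by rewrite /GRing.scale/=; ring.
Qed.

Lemma pois_meanB (phi psi : nat -> R) (B x : R) :
  (forall k, `|phi k| <= B) -> (forall k, `|psi k| <= B) ->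
  pois_mean phi x - pois_mean psi x = pois_mean (fun k => phi k - psi k) x.
Proof.
move=> phiB psiB; rewrite /pois_mean -mulrBr -limB; [|exact: (@is_cvg_pseries_fact _ B)..].
by rewrite pseriesB_fact.
Qed.

Lemma le_norm_pois_mean (phi : nat -> R) (B x : R) : 0 <= x ->
  (forall k, `|phi k| <= B) -> `|pois_mean phi x| <= B.
Proof.
move=> x0 phiB; rewrite /pois_mean normrM ger0_norm ?expR_ge0//.
rewrite -ler_pdivlMl ?expR_gt0// -expRN opprK.
have cv := @is_cvg_pseries_fact phi B x phiB.
rewrite -lim_norm//; apply: limr_le; first exact: is_cvg_norm.
apply: nearW => n; rewrite /pseries /series/=.
apply: (le_trans (ler_norm_sum _ _ _)).
apply: (@le_trans _ _ (\sum_(0 <= k < n) exp_coeff x k * B)).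
  apply: ler_sum => k _; rewrite /exp_coeff/= !normrM normfV normrX (ger0_norm x0).
  rewrite [`|_%:R|]ger0_norm// [leLHS](_ : _ = x ^+ k / k`!%:R * `|phi k|); last by ring.
  by rewrite ler_wpM2l ?divr_ge0 ?exprn_ge0.
rewrite -mulr_suml ler_wpM2r//; first by apply: le_trans (phiB 0); exact: normr_ge0.
apply: nondecreasing_cvgn_le; last exact: is_cvg_series_exp_coeff.
by apply: nondecreasing_series => k _ _; exact: exp_coeff_ge0.
Qed.

(** By the mean value theorem, the derivative being a Poisson mean of increments. This takes the
    place of a coupling of two Poisson variables. *)
Lemma pois_mean_lipschitz (phi : nat -> R) (B K x y : R) : 0 <= x -> 0 <= y ->
  (forall k, `|phi k| <= B) -> (forall k, `|phi k.+1 - phi k| <= K) ->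
  `|pois_mean phi x - pois_mean phi y| <= K * `|x - y|.
Proof.
move=> x0 y0 phiB phiK; wlog xy : x y x0 y0 / y <= x.
  move=> h; case: (leP y x) => [|/ltW] yx; first exact: h.
  by rewrite distrC [`|x - y|]distrC h.
have dphi (z : R) : is_derive z 1 (pois_mean phi) (pois_mean (fun k => phi k.+1 - phi k) z).
  exact: (@is_derive_pois_mean phi B).
have [|c cxy ->] := @MVT_segment R (pois_mean phi) _ y x xy (fun z _ => dphi z).
  apply: continuous_subspaceT => z.
  by apply: differentiable_continuous; apply/derivable1_diffP; have [] := dphi z.
rewrite normrM ler_wpM2r//; apply: le_norm_pois_mean => //.
by move: cxy; rewrite in_itv/= => /andP[+ _]; exact: le_trans.
Qed.

End poisson.

(** * From conditional probabilities to conditional expectations *)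

Section weighted.
Local Open Scope ereal_scope.
Import HBNNSimple.
Context d (T : measurableType d) (R : realType) (P : {measure set T -> \bar R}).
Variable G : set (set T).
Hypothesis Gm : <<s G>> `<=` measurable.
Local Notation T' := (g_sigma_algebraType G).

Lemma measurable_coarser d' (U : measurableType d') (Y : T -> U) :
  measurable_fun setT (Y : T' -> U) -> measurable_fun setT Y.
Proof.
move=> mY _ B mB; apply: Gm.
by have := mY measurableT B mB.
Qed.

(** Equality on the events of a sub-sigma-algebra extends to nonnegative functions measurable for
    it. [Y] is approximated by simple functions built on the coarser space [T'], so that their level
    sets are among those events. *)
Lemma eq_weighted_integral (q1 q2 : T -> R) (Y : T -> R) :
  measurable_fun setT q1 -> measurable_fun setT q2 ->
  (forall w, 0 <= q1 w)%R -> (forall w, 0 <= q2 w)%R ->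
  (forall A, <<s G>> A -> \int[P]_(w in A) (q1 w)%:E = \int[P]_(w in A) (q2 w)%:E) ->
  measurable_fun setT (Y : T' -> R) -> (forall w, 0 <= Y w)%R ->
  \int[P]_w (Y w * q1 w)%:E = \int[P]_w (Y w * q2 w)%:E.
Proof.
move=> mq1 mq2 q10 q20 q12 mY Y0.
pose Y' := EFin \o (Y : T' -> R).
have mY' : measurable_fun (setT : set T') (Y' : T' -> \bar R) by exact/measurable_EFinP.
have Y'0 : forall w : T', setT w -> 0 <= Y' w by move=> w _; rewrite lee_fin.
pose f_ := nnsfun_approx (measurableT : measurable (setT : set T')) mY'.
have mf n : measurable_fun setT (f_ n : T -> R).
  exact/measurable_coarser/measurable_funPT.
have mfr n r : <<s G>> (f_ n @^-1` [set r]).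
  have : measurable_fun (setT : set T') (f_ n : T' -> R) by exact: measurable_funPT.
  by move=> /(_ measurableT [set r] (measurable_set1 r)); rewrite setTI.
have key (q : T -> R) : measurable_fun setT q -> (forall w, 0 <= q w)%R ->
    \int[P]_w (Y w * q w)%:E =
    limn (fun n => \sum_(r \in range (f_ n)) r%:E * \int[P]_(w in f_ n @^-1` [set r]) (q w)%:E).
  move=> mq q0.
  transitivity (limn (fun n => \int[P]_w (f_ n w * q w)%:E)).
    rewrite -monotone_convergence//.
    - apply: eq_integral => w _; apply/esym/cvg_lim => //.
      under eq_fun do rewrite EFinM.
      rewrite EFinM; apply: cvgeZr => //.
      exact: (cvg_nnsfun_approx measurableT mY' Y'0).
    - by move=> n; apply/measurable_EFinP/measurable_funM.
    - by move=> n w _; rewrite lee_fin mulr_ge0.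
    - move=> w _ m n mn; rewrite lee_fin ler_wpM2r//.
      by have /lefP := nd_nnsfun_approx measurableT mY' mn; exact.
  congr (limn _); apply/funext => n.
  transitivity (\int[P]_w \sum_(r \in range (f_ n)) (r * (\1_(f_ n @^-1` [set r]) w * q w))%:E).
    apply: eq_integral => w _; rewrite fsumEFin//; congr (_%:E).
    rewrite [in LHS]fimfunE mulr_fsuml.
    by apply: eq_fsbigr => r _; rewrite mulrA.
  rewrite ge0_integral_fsum//; last 2 first.
  - move=> r; apply/measurable_EFinP/measurable_funM => //; apply: measurable_funM => //.
    by apply: measurable_indic; exact: Gm.
  - move=> r w _; rewrite lee_fin mulrA mulr_ge0//.
    by have := nnfun_muleindic_ge0 (f_ n) r w; rewrite -EFinM lee_fin.
  apply: eq_fsbigr => r /[!inE] -[w _ fwr].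
  have r0 : (0 <= r)%R by rewrite -fwr.
  under eq_integral do rewrite EFinM.
  rewrite ge0_integralZl//; last 2 first.
  - apply/measurable_EFinP; apply: measurable_funM => //.
    by apply: measurable_indic; exact: Gm.
  - by move=> w' _; rewrite lee_fin mulr_ge0.
  congr (_ * _); rewrite [RHS]integral_mkcond; apply: eq_integral => w' _.
  rewrite patchE indicE; case: (w' \in _) => /=; by rewrite ?mul1r ?mul0r.
rewrite (key q1)// (key q2)//; congr (limn _); apply/funext => n.
by apply: eq_fsbigr => r _; rewrite q12.
Qed.

End weighted.

(** * The Poisson autoregression and its past *)

Lemma measurable_fun_nat_select d (T : measurableType d) (R : realType)
    (n : T -> nat) (Y : nat -> T -> R) :
  (forall k, measurable (n @^-1` [set k])) ->
  (forall k, measurable_fun setT (Y k)) ->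
  measurable_fun setT (fun w => Y (n w) w).
Proof.
move=> mn mY _ B mB; rewrite setTI.
rewrite (_ : _ @^-1` _ = \bigcup_k (n @^-1` [set k] `&` Y k @^-1` B)); last first.
  apply/seteqP; split=> [w Bw|w [k _ [<-]]//].
  by exists (n w).
apply: bigcupT_measurable => k; apply: measurableI => //.
by rewrite -[X in measurable X]setTI; exact: mY.
Qed.

Lemma max0_lipschitz (R : realDomainType) (x y : R) :
  `|Num.max x 0 - Num.max y 0| <= `|x - y|.
Proof.
wlog xy : x y / y <= x.
  move=> h; case: (leP y x) => [|/ltW] ?; first exact: h.
  by rewrite distrC [leRHS]distrC h.
rewrite [leRHS]ger0_norm ?subr_ge0// ger0_norm.
  by rewrite /Num.max; case: ltP => ?; case: ltP => ?; lra.
by rewrite subr_ge0 ge_max !le_max xy lexx orbT.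
Qed.

Section past.
Context {R : realType} {d : measure_display} {T : measurableType d}.
Variables (N : int -> T -> nat) (lam : int -> T -> R).

Definition past_gen (t : int) : set (set T) :=
  [set A | exists s : int, (s <= t)%R /\
        ((exists B : set nat, A = N s @^-1` B) \/
         (exists B : set R, measurable B /\ A = lam s @^-1` B))].

(** [T] is retyped with the sigma-algebra of the past, so that measurability given the past is
    ordinary measurability on another space and has the same closure properties. *)
Definition adapted (t : int) (Y : T -> R) : Prop :=
  measurable_fun (setT : set (g_sigma_algebraType (past_gen t))) Y.

Lemma past_gen_sub s t : s <= t -> past_gen s `<=` past_gen t.
Proof. by move=> st A [u [us uA]]; exists u; split => //; exact: le_trans st. Qed.

Lemma adapted_le s t Y : s <= t -> adapted s Y -> adapted t Y.
Proof.
move=> st aY _ B mB; rewrite setTI; have := aY measurableT B mB; rewrite setTI.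
by apply: sub_sigma_algebra2; exact: past_gen_sub.
Qed.

Lemma adapted_lam s t : s <= t -> adapted t (lam s).
Proof.
move=> st _ B mB; rewrite setTI; apply: sub_gen_smallest.
by exists s; split => //; right; exists B.
Qed.

Lemma past_preimage_N s t (B : set nat) : s <= t -> past_sigma N lam t (N s @^-1` B).
Proof.
by move=> st; apply: sub_gen_smallest; exists s; split => //; left; exists B.
Qed.

Lemma adapted_select s t (Y : nat -> T -> R) : s <= t ->
  (forall k, adapted t (Y k)) -> adapted t (fun w => Y (N s w) w).
Proof.
by move=> st aY; apply: measurable_fun_nat_select => // k; exact: past_preimage_N.
Qed.

Lemma adapted_N s t : s <= t -> adapted t (fun w => (N s w)%:R).
Proof.
move=> st; apply: (@adapted_select s t (fun k _ => k%:R)) => // k.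
exact: measurable_cst.
Qed.

End past.

Section model.
Context {R : realType} {d : measure_display} {T : measurableType d}.

(** Sign and recursion hold at every point here, not almost surely; the final proof reaches this
    form by modifying the process on a null set. *)
Record poisson_autoregression (P : probability T R) (f0 : R -> nat -> R) (k1 k2 : R)
  (N : int -> T -> nat) (lam : int -> T -> R) : Prop := PoissonAutoregression {
  f0_ge0 : forall l y, 0 <= l -> 0 <= f0 l y;
  k1_ge0 : 0 <= k1;
  k2_ge0 : 0 <= k2;
  k12_lt1 : k1 + k2 < 1;
  f0_lipschitz : forall l l' y y', 0 <= l -> 0 <= l' ->
    `|f0 l y - f0 l' y'| <= k1 * `|l - l'| + k2 * `|y%:R - y'%:R :> R|;
  N_measurable : forall t k, measurable (N t @^-1` [set k]);
  lam_measurable : forall t, measurable_fun setT (lam t);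
  lam_ge0 : forall t w, 0 <= lam t w;
  lamS : forall t w, lam (t + 1) w = f0 (lam t w) (N t w);
  model_stationary : strictly_stationary P N lam;
  model_cond_poisson : cond_poisson P N lam }.

Context {P : probability T R} {f0 : R -> nat -> R} {k1 k2 : R}
  {N : int -> T -> nat} {lam : int -> T -> R}.
Hypothesis H : poisson_autoregression P f0 k1 k2 N lam.

Lemma past_sigma_measurable t : past_sigma N lam t `<=` measurable.
Proof.
apply: smallest_sub; first exact: sigma_algebra_measurable.
move=> A [s [_ [[B ->]|[B [mB ->]]]]].
  rewrite (_ : _ @^-1` _ = \bigcup_(k in B) (N s @^-1` [set k])); last first.
    by apply/seteqP; split=> [w Bw|w [k Bk /= ->]//]; exists (N s w).
  by apply: bigcup_measurable => k _; exact: (N_measurable H).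
by rewrite -[X in measurable X]setTI; exact: (lam_measurable H).
Qed.

Lemma adapted_measurable t (Y : T -> R) : adapted N lam t Y -> measurable_fun setT Y.
Proof. by apply: measurable_coarser; exact: past_sigma_measurable. Qed.

Lemma measurable_N t : measurable_fun setT (fun w => (N t w)%:R : R).
Proof. by apply: (@adapted_measurable t); exact: adapted_N. Qed.

(** [f0] is controlled on nonnegative arguments only; composing with [max(., 0)] gives a function on
    the whole line and changes nothing along the process. *)
Lemma f0_continuous k : continuous (fun l : R => f0 (Num.max l 0) k).
Proof.
move=> l; apply/cvgrPdist_lt => e e0; near=> l'.
have m0 (x : R) : 0 <= Num.max x 0 by rewrite le_max lexx orbT.
apply: le_lt_trans (f0_lipschitz H k k (m0 l) (m0 l')) _.
rewrite subrr normr0 mulr0 addr0.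
have := max0_lipschitz l l'.
move=> h; apply: (@le_lt_trans _ _ `|l - l'|).
  have k11 : k1 <= 1 by have := k12_lt1 H; have := k2_ge0 H; lra.
  by apply: le_trans h; rewrite ler_piMl.
by near: l'; exact: cvgr_dist_lt.
Unshelve. all: by end_near. Qed.

(** Predictability: the recursion determines [lam (t + 1)] at time [t]. The map [f0] is continuous
    in the intensity for each of the countably many counts, which gives the joint measurability. *)
Lemma adapted_lamS (t s : int) : s <= t + 1 -> adapted N lam t (lam s).
Proof.
rewrite le_eqVlt => /orP[/eqP ->|]; last by rewrite ltzD1; exact: adapted_lam.
have -> : lam (t + 1) = (fun w => (fun k w => f0 (Num.max (lam t w) 0) k) (N t w) w).
  apply/funext => w; rewrite (lamS H); congr (f0 _ _).
  by apply/esym/max_idPl; exact: (lam_ge0 H).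
apply: (@adapted_select _ _ _ N lam t t (fun k w => f0 (Num.max (lam t w) 0) k)) => // k.
apply: (@measurableT_comp _ _ _ _ _ _ (fun l : R => f0 (Num.max l 0) k)).
  by apply: continuous_measurable_fun; exact: f0_continuous.
exact: adapted_lam.
Qed.

Lemma measurable_pois_pmf k : measurable_fun setT (fun l : R => pois_pmf l k).
Proof.
rewrite /pois_pmf; apply: measurable_funM => //; apply: measurable_funM => //.
by apply: measurableT_comp => //; exact: measurable_oppr.
Qed.

(** Split over the value [k] of the next count; for each [k], the indicator of that value and the
    Poisson weight have equal integrals over past events, which is the conditional law. *)
Lemma integral_cond_poisson t (Y : nat -> T -> R) :
  (forall k w, 0 <= Y k w) -> (forall k, adapted N lam t (Y k)) ->
  (\int[P]_w (Y (N (t + 1) w) w)%:E =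
   \int[P]_w \sum_(k <oo) (pois_pmf (lam (t + 1) w) k * Y k w)%:E)%E.
Proof.
move=> Y0 aY.
have mY k : measurable_fun setT (Y k) := adapted_measurable (aY k).
have mI k : measurable_fun setT (\1_(N (t + 1) @^-1` [set k]) : T -> R).
  by apply: measurable_indic; exact: (N_measurable H).
have mp k : measurable_fun setT (fun w => pois_pmf (lam (t + 1) w) k).
  apply: measurableT_comp (measurable_pois_pmf k) _; exact: (lam_measurable H).
have p0 k w : 0 <= pois_pmf (lam (t + 1) w) k.
  by apply: pois_pmf_ge0; exact: (lam_ge0 H).
transitivity (\int[P]_w \sum_(k <oo) (Y k w * \1_(N (t + 1) @^-1` [set k]) w)%:E)%E.
  apply: eq_integral => w _.
  rewrite (@nneseriesD1 _ _ (N (t + 1) w) xpredT)//; last first.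
    by move=> k _; rewrite lee_fin mulr_ge0.
  rewrite indicE mem_set// mulr1 eseries0 ?adde0// => k _ /andP[_ kN].
  by rewrite indicE memNset ?mulr0// => /= E; rewrite E eqxx in kN.
rewrite integral_nneseries//; last 2 first.
- by move=> k; apply/measurable_EFinP; exact: measurable_funM.
- by move=> k w _; rewrite lee_fin mulr_ge0.
rewrite integral_nneseries//; last 2 first.
- by move=> k; apply/measurable_EFinP; exact: measurable_funM.
- by move=> k w _; rewrite lee_fin mulr_ge0.
apply: eq_eseriesr => k _.
under [RHS]eq_integral do rewrite mulrC.
apply: (@eq_weighted_integral _ _ _ P (past_gen N lam t)) => //.
- exact: past_sigma_measurable.
- move=> A sA; have mA : measurable A := past_sigma_measurable sA.
  rewrite integral_indic//; last exact: (N_measurable H).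
  have condP : cond_poisson P N lam := model_cond_poisson H.
  have := @condP (t + 1) k A; rewrite addrK => /(_ sA) <-.
  by rewrite setIC.
- exact: aY.
Qed.

Lemma integral_cond_series t (Y : T -> R) (phi : nat -> T -> R) (Phi : T -> R) :
  (forall w, 0 <= Y w) -> adapted N lam t Y ->
  (forall k w, 0 <= phi k w) -> (forall k, adapted N lam t (phi k)) ->
  (forall w, \sum_(k <oo) (pois_pmf (lam (t + 1) w) k * phi k w)%:E = (Phi w)%:E)%E ->
  (\int[P]_w (Y w * phi (N (t + 1) w) w)%:E = \int[P]_w (Y w * Phi w)%:E)%E.
Proof.
move=> Y0 aY phi0 aphi phiE.
rewrite (@integral_cond_poisson t (fun k w => Y w * phi k w)); last 2 first.
- by move=> k w; rewrite mulr_ge0.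
- by move=> k; apply: measurable_funM; [exact: aY|exact: aphi].
apply: eq_integral => w _; rewrite EFinM -phiE -nneseriesZl//; last first.
  by move=> k _; rewrite lee_fin mulr_ge0// pois_pmf_ge0// (lam_ge0 H).
by apply: eq_eseriesr => k _; rewrite -EFinM mulrCA.
Qed.

Lemma integral_cond_ffact t j (Y : T -> R) :
  (forall w, 0 <= Y w) -> adapted N lam t Y ->
  (\int[P]_w (Y w * (N (t + 1) w ^_ j)%:R)%:E =
   \int[P]_w (Y w * lam (t + 1) w ^+ j)%:E)%E.
Proof.
move=> Y0 aY.
apply: (integral_cond_series (phi := fun k _ => (k ^_ j)%:R)) => // w; first exact: measurable_cst.
by rewrite nneseries_pois_ffact//; exact: (lam_ge0 H).
Qed.

Lemma integral_cond_expR t s (Y : T -> R) :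
  (forall w, 0 <= Y w) -> adapted N lam t Y ->
  (\int[P]_w (Y w * expR (s * (N (t + 1) w)%:R))%:E =
   \int[P]_w (Y w * expR (lam (t + 1) w * (expR s - 1)))%:E)%E.
Proof.
move=> Y0 aY.
apply: (integral_cond_series (phi := fun k _ => expR (s * k%:R))) => // [k|w].
- exact: measurable_cst.
- by rewrite nneseries_pois_expR//; exact: (lam_ge0 H).
Qed.

Lemma integral_cond_pois_mean t (Y : T -> R) (phi : nat -> T -> R) (B : R) :
  (forall w, 0 <= Y w) -> adapted N lam t Y ->
  (forall k w, 0 <= phi k w <= B) -> (forall k, adapted N lam t (phi k)) ->
  (\int[P]_w (Y w * phi (N (t + 1) w) w)%:E =
   \int[P]_w (Y w * pois_mean (phi ^~ w) (lam (t + 1) w))%:E)%E.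
Proof.
move=> Y0 aY phiB aphi; apply: integral_cond_series => // [k w|w].
  by have /andP[] := phiB k w.
by rewrite (nneseries_pois_mean (B := B))//; exact: (lam_ge0 H).
Qed.

End model.

(** * Families with uniformly bounded moments *)

Lemma exprn_le_fact_expR (R : realType) (p : nat) (x : R) : 0 <= x ->
  x ^+ p <= p`!%:R * expR x.
Proof.
move=> x0; rewrite mulrC -ler_pdivrMr ?ltr0n ?fact_gt0//; case: p => [|p].
  by rewrite expr0 divr1 -[leLHS]expR0 ler_expR.
by apply: le_trans (expR_ge1Dxn p x0); rewrite lerDr.
Qed.

Section bounded_moments.
Context {R : realType} {d : measure_display} {T : measurableType d}
  {P : probability T R}.

Lemma integral_prob_cst (c : R) : (\int[P]_w c%:E = c%:E)%E.
Proof.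
rewrite integral_cst//; transitivity (c%:E * 1)%E; last by rewrite mule1.
by congr (_ * _)%E; exact: probability_setT.
Qed.

(** All moments at once, uniformly in the index: the class is closed under sums, products and
    powers, so no exponent has to be tracked later. *)
Definition bounded_moments (I : Type) (X : I -> T -> R) : Prop :=
  (forall i, measurable_fun setT (X i)) /\
  forall p : nat, exists K : R, forall i,
    (\int[P]_w (`|X i w| ^+ p)%:E <= K%:E)%E.

Lemma bounded_moments_le (I : Type) (X Y : I -> T -> R) :
  (forall i, measurable_fun setT (X i)) ->
  (forall i w, `|X i w| <= `|Y i w|) -> bounded_moments Y -> bounded_moments X.
Proof.
move=> mX XY [mY bY]; split=> // p; have [K hK] := bY p; exists K => i.
apply: le_trans (hK i); apply: ge0_le_integral => //.
- by apply/measurable_EFinP/measurable_funX; exact: measurableT_comp.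
- by apply/measurable_EFinP/measurable_funX; exact: measurableT_comp.
- by move=> w _; rewrite lee_fin lerXn2r ?nnegrE.
Qed.

Lemma bounded_moments_bounded (I : Type) (X : I -> T -> R) (c : R) :
  (forall i, measurable_fun setT (X i)) -> (forall i w, `|X i w| <= c) ->
  bounded_moments X.
Proof.
move=> mX Xc; split=> // p; exists (c ^+ p) => i.
have -> : (c ^+ p)%:E = (\int[P]_w (c ^+ p)%:E)%E.
  by rewrite integral_prob_cst.
apply: ge0_le_integral => //.
- by apply/measurable_EFinP/measurable_funX; exact: measurableT_comp.
- move=> w _; rewrite lee_fin lerXn2r ?nnegrE//.
  exact: le_trans (Xc i w).
Qed.

Lemma bounded_moments_cst (I : Type) (c : R) :
  bounded_moments (fun (_ : I) (_ : T) => c).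
Proof. by apply: (@bounded_moments_bounded _ _ `|c|). Qed.

Lemma bounded_moments_comp (I J : Type) (g : J -> I) (X : I -> T -> R) :
  bounded_moments X -> bounded_moments (fun j => X (g j)).
Proof. by move=> [mX bX]; split=> // p; have [K hK] := bX p; exists K. Qed.

Lemma bounded_momentsD (I : Type) (X Y : I -> T -> R) :
  bounded_moments X -> bounded_moments Y ->
  bounded_moments (fun i w => X i w + Y i w).
Proof.
move=> [mX bX] [mY bY]; split=> [i|p]; first exact: measurable_funD.
have [K hK] := bX p; have [L hL] := bY p.
exists (2 ^+ p * (K + L)) => i.
apply: (@le_trans _ _ (\int[P]_w ((2 ^+ p)%:E * ((`|X i w| ^+ p)%:E + (`|Y i w| ^+ p)%:E)))%E).
  apply: ge0_le_integral => //.
  - by apply/measurable_EFinP/measurable_funX; apply: measurableT_comp => //; exact: measurable_funD.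
  - under eq_fun do rewrite -EFinD -EFinM.
    apply/measurable_EFinP; apply: measurable_funM => //; apply: measurable_funD;
    by apply/measurable_funX; exact: measurableT_comp.
  - move=> w _; rewrite -EFinD -EFinM lee_fin.
    set x := `|X i w|; set y := `|Y i w|.
    have x0 : 0 <= x by exact: normr_ge0.
    have y0 : 0 <= y by exact: normr_ge0.
    apply: (@le_trans _ _ ((x + y) ^+ p)).
      by rewrite lerXn2r ?nnegrE ?addr_ge0// ler_normD.
    wlog xy : x y x0 y0 / x <= y.
      move=> h; case: (leP x y) => [|/ltW] ?; first exact: h.
      by rewrite addrC [_ ^+ p + _]addrC h.
    apply: (@le_trans _ _ ((2 * y) ^+ p)).
      by rewrite lerXn2r ?nnegrE ?addr_ge0 ?mulr_ge0//; lra.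
    by rewrite exprMn ler_wpM2l ?exprn_ge0// lerDr exprn_ge0.
rewrite ge0_integralZl//; last 2 first.
- by apply: emeasurable_funD; apply/measurable_EFinP/measurable_funX; exact: measurableT_comp.
- by move=> w _; rewrite adde_ge0// lee_fin exprn_ge0.
rewrite EFinM lee_pmul2l ?lte_fin ?exprn_gt0// ge0_integralD//.
- by rewrite EFinD leeD.
- by apply/measurable_EFinP/measurable_funX; exact: measurableT_comp.
- by apply/measurable_EFinP/measurable_funX; exact: measurableT_comp.
Qed.

Lemma bounded_momentsM (I : Type) (X Y : I -> T -> R) :
  bounded_moments X -> bounded_moments Y ->
  bounded_moments (fun i w => X i w * Y i w).
Proof.
move=> [mX bX] [mY bY]; split=> [i|p]; first exact: measurable_funM.
have [K hK] := bX (p * 2)%N; have [L hL] := bY (p * 2)%N.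
exists (K + L) => i.
apply: (@le_trans _ _ (\int[P]_w ((`|X i w| ^+ (p * 2))%:E + (`|Y i w| ^+ (p * 2))%:E))%E).
  apply: ge0_le_integral => //.
  - by apply/measurable_EFinP/measurable_funX; apply: measurableT_comp => //; exact: measurable_funM.
  - apply: emeasurable_funD; apply/measurable_EFinP/measurable_funX; exact: measurableT_comp.
  - move=> w _; rewrite -EFinD lee_fin normrM exprMn !exprM.
    set x := `|X i w| ^+ p; set y := `|Y i w| ^+ p.
    by have := sqr_ge0 (x - y); have := sqr_ge0 (x + y); rewrite !expr2; lra.
rewrite ge0_integralD//.
- by rewrite EFinD leeD.
- by apply/measurable_EFinP/measurable_funX; exact: measurableT_comp.
- by apply/measurable_EFinP/measurable_funX; exact: measurableT_comp.
Qed.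

Lemma bounded_momentsN (I : Type) (X : I -> T -> R) :
  bounded_moments X -> bounded_moments (fun i w => - X i w).
Proof.
move=> bX; have [mX _] := bX; apply: bounded_moments_le bX => [i|i w].
  exact: measurableT_comp.
by rewrite normrN.
Qed.

Lemma bounded_momentsB (I : Type) (X Y : I -> T -> R) :
  bounded_moments X -> bounded_moments Y ->
  bounded_moments (fun i w => X i w - Y i w).
Proof. by move=> bX bY; apply: bounded_momentsD => //; exact: bounded_momentsN. Qed.

Lemma bounded_moments_norm (I : Type) (X : I -> T -> R) :
  bounded_moments X -> bounded_moments (fun i w => `|X i w|).
Proof.
move=> bX; have [mX _] := bX; apply: bounded_moments_le bX => [i|i w].
  exact: measurableT_comp.
by rewrite normr_id.
Qed.

Lemma bounded_momentsX (I : Type) (X : I -> T -> R) n :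
  bounded_moments X -> bounded_moments (fun i w => X i w ^+ n).
Proof.
move=> bX; elim: n => [|n ih].
  by under eq_fun do under eq_fun do rewrite expr0; exact: bounded_moments_cst.
by under eq_fun do under eq_fun do rewrite exprS; exact: bounded_momentsM.
Qed.

Lemma bounded_moments_sum (I : Type) (J : Type) (s : seq J) (X : J -> I -> T -> R) :
  (forall j, bounded_moments (X j)) ->
  bounded_moments (fun i w => \sum_(j <- s) X j i w).
Proof.
move=> bX; elim: s => [|j s ih].
  by under eq_fun do under eq_fun do rewrite big_nil; exact: bounded_moments_cst.
by under eq_fun do under eq_fun do rewrite big_cons; exact: bounded_momentsD.
Qed.

Lemma bounded_moments_integrable (I : Type) (X : I -> T -> R) i :
  bounded_moments X -> P.-integrable setT (EFin \o X i).
Proof.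
move=> [mX bX]; apply/integrableP; split; first exact/measurable_EFinP.
have [K hK] := bX 1; apply: le_lt_trans (ltry K); apply: le_trans (hK i).
by under [leRHS]eq_integral do rewrite expr1.
Qed.

Lemma bounded_moments_Rintegral (I : Type) (X : I -> T -> R) :
  bounded_moments X -> exists2 K : R, 0 <= K & forall i, \int[P]_w `|X i w| <= K.
Proof.
move=> bX; have [K hK] := bX.2 1; exists `|K| => // i.
apply: le_trans (ler_norm K).
have iX := bounded_moments_integrable i (bounded_moments_norm bX).
rewrite /Rintegral -lee_fin fineK; last exact: integrable_fin_num iX.
apply: le_trans (hK i).
by under [leRHS]eq_integral do rewrite expr1.
Qed.

(* [x^p <= p! r^-p e^(r x)] turns one exponential moment into all the others. *)
Lemma bounded_moments_expR (I : Type) (X : I -> T -> R) (r K : R) : 0 < r ->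
  (forall i, measurable_fun setT (X i)) -> (forall i w, 0 <= X i w) ->
  (forall i, \int[P]_w (expR (r * X i w))%:E <= K%:E)%E ->
  bounded_moments X.
Proof.
move=> r0 mX X0 hK; split=> // p.
have me i : measurable_fun setT (fun w => expR (r * X i w)).
  by apply: measurableT_comp => //; exact: measurable_funM.
exists (p`!%:R / r ^+ p * K) => i.
apply: (@le_trans _ _ (\int[P]_w ((p`!%:R / r ^+ p)%:E * (expR (r * X i w))%:E))%E).
  apply: ge0_le_integral => //.
  - by apply/measurable_EFinP/measurable_funX; exact: measurableT_comp.
  - by under eq_fun do rewrite -EFinM; apply/measurable_EFinP; exact: measurable_funM.
  - move=> w _; rewrite -EFinM lee_fin (ger0_norm (X0 i w)).
    rewrite mulrAC ler_pdivlMr ?exprn_gt0//.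
    rewrite -exprMn [X i w * r]mulrC; apply: exprn_le_fact_expR.
    by rewrite mulr_ge0// ltW.
rewrite ge0_integralZl//; last 2 first.
- exact/measurable_EFinP.
- by rewrite lee_fin divr_ge0 ?exprn_ge0// ltW.
by rewrite [leRHS]EFinM lee_wpmul2l// lee_fin divr_ge0 ?exprn_ge0// ltW.
Qed.

End bounded_moments.

Lemma expR_le_inv1B (R : realType) (x : R) : x < 1 -> expR x <= (1 - x)^-1.
Proof.
move=> x1; rewrite -[x in leLHS]opprK expRN lef_pV2 ?posrE ?subr_gt0 ?expR_gt0//.
exact: expR_ge1Dx.
Qed.

Lemma tail_probability_small d (T : measurableType d) (R : realType)
    (P : probability T R) (X : T -> R) (e : R) :
  measurable_fun setT X -> 0 < e ->
  exists n : nat, (P [set w | (n%:R < X w)%R] <= e%:E)%E.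
Proof.
move=> mX e0; pose F n := [set w | (n%:R < X w)%R].
have mF n : measurable (F n).
  rewrite (_ : F n = X @^-1` `]n%:R, +oo[%classic); last first.
    by apply/seteqP; split=> w /=; rewrite in_itv/= andbT.
  by rewrite -[X in measurable X]setTI; exact: mX.
have F0 : \bigcap_n F n = set0.
  rewrite -subset0 => w /= Fw; have := Fw (Num.truncn (X w)).+1 I.
  by rewrite /F/= ltNge (ltW (truncnS_gt _)).
have : P (F n) @[n --> \oo] --> P (\bigcap_n F n).
  apply: nonincreasing_cvg_mu => //.
  - by rewrite -ge0_fin_numE// fin_num_measure.
  - exact: bigcapT_measurable.
  - move=> m n mn; apply/subsetPset => w; apply: le_lt_trans.
    by rewrite ler_nat.
rewrite F0 measure0 => /fine_cvgP[_ /cvgrPdist_le/(_ _ e0)] [n _ /(_ n (leqnn n))].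
rewrite /= sub0r normrN ger0_norm ?fine_ge0// => h; exists n.
by rewrite -/(F n) -(fineK (fin_num_measure P _ (mF n))) lee_fin.
Qed.

(** * An exponential moment for the stationary intensity *)

Section exponential_moment.
Context {R : realType} {d : measure_display} {T : measurableType d}
  {P : probability T R} {f0 : R -> nat -> R} {k1 k2 : R}
  {N : int -> T -> nat} {lam : int -> T -> R}.
Hypothesis H : poisson_autoregression P f0 k1 k2 N lam.

Lemma lam_law (t s : int) (B : set R) : measurable B ->
  P (lam t @^-1` B) = P (lam s @^-1` B).
Proof.
move=> mB; have := model_stationary H 1 (fun=> setT) (fun=> mB) t (s - t).
by rewrite !bigcap_mkord !big_ord1 !preimage_setT !setTI/= !addr0 addrC subrK.
Qed.

Lemma ge0_integral_lam (t s : int) (phi : R -> R) :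
  measurable_fun setT phi -> (forall x, 0 <= phi x) ->
  (\int[P]_w (phi (lam t w))%:E = \int[P]_w (phi (lam s w))%:E)%E.
Proof.
move=> mphi phi0.
have E u : (\int[P]_w (phi (lam u w))%:E = \int[pushforward P (lam u)]_x (phi x)%:E)%E.
  rewrite ge0_integral_pushforward//.
  - exact: (lam_measurable H).
  - exact/measurable_EFinP.
  - by move=> x _; rewrite lee_fin.
rewrite (E t) (E s).
pose Mt : {mfun T >-> R} := HB.pack (lam t) (isMeasurableFun.Build _ _ _ _ (lam t) (lam_measurable H t)).
pose Ms : {mfun T >-> R} := HB.pack (lam s) (isMeasurableFun.Build _ _ _ _ (lam s) (lam_measurable H s)).
apply: (@eq_measure_integral _ _ _ setT (pushforward P Ms) (pushforward P Mt)) => B mB _.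
exact: lam_law.
Qed.

Lemma lam_step t w : lam (t + 1) w <= f0 0 0 + k1 * lam t w + k2 * (N t w)%:R.
Proof.
rewrite (lamS H); have := f0_lipschitz H (N t w) 0 (lam_ge0 H t w) (lexx 0).
rewrite !subr0 (ger0_norm (lam_ge0 H t w)) normr_nat => h.
by have := le_trans (ler_norm _) h; lra.
Qed.

(** [rho] is the midpoint of [k1 + k2] and [1]. The gap [rho - (k1 + k2)] equals [2 r], which is
    what absorbs the quadratic part of the exponential for exponents up to [r]. *)
Let a : R := f0 0 0.
Let r : R := (1 - (k1 + k2)) / 4.
Let rho : R := (1 + (k1 + k2)) / 2.

Let r_gt0 : 0 < r. Proof. by rewrite /r; have := k12_lt1 H; lra. Qed.
Let rho_lt1 : rho < 1. Proof. by rewrite /rho; have := k12_lt1 H; lra. Qed.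
Let rho_ge0 : 0 <= rho.
Proof. by rewrite /rho; have := k1_ge0 H; have := k2_ge0 H; lra. Qed.
Let a_ge0 : 0 <= a. Proof. exact: (f0_ge0 H). Qed.

Let exponent_contraction (s : R) : 0 <= s <= r -> k1 * s + (expR (k2 * s) - 1) <= rho * s.
Proof.
move=> /andP[s0 sr].
have k20 := k2_ge0 H; have k10 := k1_ge0 H; have k12 := k12_lt1 H.
have x0 : 0 <= k2 * s by rewrite mulr_ge0.
have x1 : k2 * s <= s by rewrite ler_piMl//; lra.
have s4 : s <= 4^-1 by rewrite (le_trans sr)// /r; lra.
(* With [x = k2 s <= s <= 1/4], [e^x <= 1 / (1 - x) <= 1 + x + 2 x s]. *)
have : expR (k2 * s) <= 1 + k2 * s + 2 * (k2 * s) * s.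
  apply: (le_trans (expR_le_inv1B _)); first lra.
  rewrite -[leLHS]mul1r ler_pdivrMr; last lra.
  nra.
have : 2 * (k2 * s) * s <= (rho - (k1 + k2)) * s.
  rewrite ler_wpM2r//; rewrite /rho; rewrite /r in sr; lra.
by rewrite /rho; lra.
Qed.

(** Going back one step shrinks the exponent from [s] to [rho s] at the cost [e^(s a)]: the
    intensity is at most affine in the previous intensity and count, and the count is integrated
    through its generating function. *)
Let exp_step (t : int) (s : R) (Y : T -> R) : 0 <= s <= r ->
  (forall w, 0 <= Y w) -> adapted N lam t Y ->
  (\int[P]_w (Y w * expR (s * lam (t + 1 + 1) w))%:E <=
   (expR (s * a))%:E * \int[P]_w (Y w * expR (rho * s * lam (t + 1) w))%:E)%E.
Proof.
move=> srange Y0 aY; have /andP[s0 sr] := srange.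
have mY := adapted_measurable H aY.
have mlam u := lam_measurable H u.
have mN u := measurable_N H u.
have alam : adapted N lam t (lam (t + 1)) by exact: (adapted_lamS H).
have aY' : adapted N lam t (fun w => Y w * expR (s * k1 * lam (t + 1) w)).
  by apply: measurable_funM => //; apply: measurableT_comp => //; exact: measurable_funM.
have me (c : R) u : measurable_fun setT (fun w => expR (c * lam u w)).
  by apply: measurableT_comp => //; exact: measurable_funM.
apply: (@le_trans _ _ (\int[P]_w ((expR (s * a))%:E *
   (Y w * expR (s * k1 * lam (t + 1) w) * expR (s * k2 * (N (t + 1) w)%:R))%:E))%E).
  apply: ge0_le_integral => //.
  - by move=> w _; rewrite lee_fin mulr_ge0 ?expR_ge0.
  - by apply/measurable_EFinP; exact: measurable_funM.
  - under eq_fun do rewrite -EFinM; apply/measurable_EFinP.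
    apply: measurable_funM => //; apply: measurable_funM; first exact: measurable_funM.
    by apply: measurableT_comp => //; exact: measurable_funM.
  - move=> w _; rewrite -EFinM lee_fin -mulrA mulrCA -!expRD ler_wpM2l// ler_expR.
    by have := ler_wpM2l s0 (lam_step (t + 1) w); rewrite -/a; lra.
rewrite ge0_integralZl//; last 2 first.
- apply/measurable_EFinP; apply: measurable_funM; first exact: measurable_funM.
  by apply: measurableT_comp => //; exact: measurable_funM.
- by move=> w _; rewrite lee_fin !mulr_ge0 ?expR_ge0.
rewrite lee_wpmul2l ?lee_fin ?expR_ge0//.
rewrite (integral_cond_expR H)//; last by move=> w; rewrite mulr_ge0 ?expR_ge0.
apply: ge0_le_integral => //.
- by move=> w _; rewrite lee_fin !mulr_ge0 ?expR_ge0.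
- apply/measurable_EFinP; apply: measurable_funM; first exact: measurable_funM.
  by apply: measurableT_comp => //; exact: measurable_funM.
- by apply/measurable_EFinP; exact: measurable_funM.
- move=> w _; rewrite lee_fin -mulrA -expRD ler_wpM2l// ler_expR.
  have := ler_wpM2r (lam_ge0 H (t + 1) w) (exponent_contraction srange).
  by rewrite [s * k2]mulrC; lra.
Qed.

(** The successive costs [e^(s a rho^i)] multiply to at most [e^(s a / (1 - rho))], whatever the
    number of steps. *)
Let exp_iter (t : int) m (s : R) (Y : T -> R) : 0 <= s <= r ->
  (forall w, 0 <= Y w) -> adapted N lam t Y ->
  (\int[P]_w (Y w * expR (s * lam (t + 1 + m%:Z) w))%:E <=
   (expR (s * a / (1 - rho)))%:E *
   \int[P]_w (Y w * expR (rho ^+ m * s * lam (t + 1) w))%:E)%E.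
Proof.
elim: m s => [|m ih] s /andP[s0 sr] Y0 aY.
  rewrite expr0 mul1r addr0 lee_pemull//; last 2 first.
  - by apply: integral_ge0 => w _; rewrite lee_fin mulr_ge0 ?expR_ge0.
  - by rewrite lee_fin -[leLHS]expR0 ler_expR divr_ge0 ?mulr_ge0// subr_ge0 ltW.
rewrite (_ : t + 1 + m.+1%:Z = t + m%:Z + 1 + 1); last by lia.
apply: (le_trans (@exp_step (t + m%:Z) s Y _ Y0 _)).
- by rewrite s0.
- by apply: adapted_le aY; lia.
rewrite (_ : t + m%:Z + 1 = t + 1 + m%:Z); last by lia.
have rs : 0 <= rho * s <= r.
  by rewrite mulr_ge0//= (le_trans _ sr)// ler_piMl// ltW.
apply: (le_trans (lee_wpmul2l _ (ih (rho * s) rs Y0 aY))).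
  by rewrite lee_fin expR_ge0.
rewrite muleA -EFinM -expRD exprSr mulrA lee_wpmul2r//.
  by apply: integral_ge0 => w _; rewrite lee_fin mulr_ge0 ?expR_ge0.
rewrite lee_fin ler_expR.
have : 1 - rho != 0 by rewrite subr_eq0 eq_sym lt_eqF.
move=> h; rewrite le_eqVlt; apply/orP; left; apply/eqP; field.
by rewrite h.
Qed.

Let C := expR (r * a / (1 - rho)).

(** The bound must not depend on [B]. Take [K] with [P(lam_1 > K) <= 1/(B+1)], then [m] with
    [rho^m r K <= 1/2], and replace [lam_1] by [lam_(1+m)] by stationarity. Where [lam_1 <= K],
    going back [m] steps leaves at most [C e^(1/2) <= 2 C]; elsewhere the truncated integrand is at
    most [B], which contributes at most [1]. *)
Let exp_trunc (B : nat) :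
  (\int[P]_w (Num.min (expR (r * lam 1 w)) B%:R)%:E <= (2 * C + 1)%:E)%E.
Proof.
have mlam u := lam_measurable H u.
have B0 : 0 < B.+1%:R^-1 :> R by rewrite invr_gt0.
have [K hK] := tail_probability_small P (mlam 1) B0.
have [m hm] : exists m, rho ^+ m * (r * K%:R) <= 2^-1.
  have /cvgr0Pnorm_le cv : rho ^+ n @[n --> \oo] --> (0 : R).
    by apply: cvg_expr; rewrite ger0_norm.
  have e0 : 0 < (2 * (r * K%:R + 1))^-1.
    by rewrite invr_gt0 mulr_gt0// ltr_wpDl// mulr_ge0// ltW.
  have [m _ /(_ m (leqnn m))/=] := cv _ e0.
  rewrite ger0_norm ?exprn_ge0// => hm; exists m.
  have rK : 0 <= r * K%:R by rewrite mulr_ge0// ltW.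
  apply: (le_trans (ler_wpM2r rK hm)).
  rewrite invfM -mulrA ler_piMr//.
  by rewrite mulrC ler_pdivrMr ?mul1r; lra.
have mK : measurable [set w | (lam 1 w <= K%:R)%R].
  rewrite (_ : [set _ | _] = lam 1 @^-1` `]-oo, K%:R]%classic); last first.
    by apply/seteqP; split=> w /=; rewrite in_itv.
  by rewrite -[X in measurable X]setTI; exact: mlam.
have mKc : measurable [set w | (K%:R < lam 1 w)%R].
  rewrite (_ : [set _ | _] = ~` [set w | (lam 1 w <= K%:R)%R]); first exact: measurableC.
  by apply/seteqP; split=> w /=; rewrite ltNge => /negP.
have me (c : R) u : measurable_fun setT (fun w => expR (c * lam u w)).
  by apply: measurableT_comp => //; exact: measurable_funM.
pose Y : T -> R := \1_[set w | (lam 1 w <= K%:R)%R].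
have mY : measurable_fun setT Y by exact: measurable_indic.
have aY : adapted N lam 0 Y.
  apply: measurable_indic; rewrite (_ : [set _ | _] = lam 1 @^-1` `]-oo, K%:R]%classic); last first.
    by apply/seteqP; split=> w /=; rewrite in_itv.
  have al : adapted N lam 0 (lam 1) by exact: (adapted_lamS H).
  by rewrite -[X in measurable X]setTI; exact: al.
rewrite (ge0_integral_lam 1 (0 + 1 + m%:Z) (phi := fun x => Num.min (expR (r * x)) B%:R)); last 2 first.
- apply: measurable_minr => //; apply: measurableT_comp => //; exact: measurable_funM.
- by move=> x; rewrite le_min expR_ge0/=.
apply: (@le_trans _ _ (\int[P]_w ((Y w * expR (r * lam (0 + 1 + m%:Z) w))%:E +
   (B%:R * \1_[set w | (K%:R < lam 1 w)%R] w)%:E))%E).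
  apply: ge0_le_integral => //.
  - by apply/measurable_EFinP; exact: measurable_minr.
  - apply: emeasurable_funD; apply/measurable_EFinP; first exact: measurable_funM.
    by apply: measurable_funM => //; exact: measurable_indic.
  - move=> w _; rewrite -EFinD lee_fin /Y !indicE.
    have [h|h] := leP (lam 1 w) K%:R.
      rewrite mem_set//= mul1r memNset/=; last by apply/negP; rewrite -leNgt.
      by rewrite mulr0 addr0 ge_min lexx.
    rewrite memNset/=; last by apply/negP; rewrite -ltNge.
    by rewrite mem_set//= mul0r !add0r mulr1 ge_min lexx orbT.
rewrite ge0_integralD//; last 3 first.
- by move=> w _; rewrite lee_fin mulr_ge0 ?expR_ge0.
- by apply/measurable_EFinP; exact: measurable_funM.
- by apply/measurable_EFinP; apply: measurable_funM => //; exact: measurable_indic.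
rewrite EFinD; apply: leeD; last first.
  under eq_integral do rewrite EFinM.
  rewrite ge0_integralZl//; last first.
    by apply/measurable_EFinP; exact: measurable_indic.
  rewrite integral_indic// setIT.
  apply: (le_trans (lee_wpmul2l _ hK)); first by rewrite lee_fin.
  by rewrite -EFinM lee_fin ler_pdivrMr// mul1r ler_nat.
apply: (le_trans (@exp_iter 0 m r Y _ _ aY)).
- by rewrite lexx ltW.
- by move=> w; rewrite /Y.
rewrite -/C [2 * C]mulrC EFinM lee_wpmul2l ?lee_fin ?expR_ge0//.
apply: (@le_trans _ _ (\int[P]_w (2 : R)%:E)%E); last by rewrite integral_prob_cst.
apply: ge0_le_integral => //.
- by move=> w _; rewrite lee_fin mulr_ge0 ?expR_ge0.
- by apply/measurable_EFinP; exact: measurable_funM.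
- move=> w _; rewrite lee_fin /Y indicE add0r.
  case: (boolP (w \in _)) => [/set_mem/= h|_]; last by rewrite mul0r.
  rewrite mul1r; apply: (@le_trans _ _ (expR 2^-1)).
    rewrite ler_expR (le_trans _ hm)// -mulrA ler_wpM2l ?exprn_ge0//.
    by rewrite ler_wpM2l// ltW.
  apply: (le_trans (expR_le_inv1B _)); first lra.
  by rewrite -[leRHS]invrK lef_pV2 ?posrE; lra.
Qed.

Let exp_moment t : (\int[P]_w (expR (r * lam t w))%:E <= (2 * C + 1)%:E)%E.
Proof.
have mlam u := lam_measurable H u.
have me : measurable_fun setT (fun x : R => expR (r * x)).
  by apply: measurableT_comp => //; exact: measurable_funM.
have me1 : measurable_fun setT (fun w => expR (r * lam 1 w)).
  exact: (measurableT_comp me).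
rewrite (ge0_integral_lam t 1 (phi := fun x => expR (r * x)))//.
have -> : (\int[P]_w (expR (r * lam 1 w))%:E =
    limn (fun B : nat => \int[P]_w (Num.min (expR (r * lam 1 w)) B%:R)%:E))%E.
  rewrite -monotone_convergence//.
  - apply: eq_integral => w _; apply/esym/lim_near_cst => //.
    near=> B; congr (_%:E); apply/min_idPl.
    near: B; exact: nbhs_infty_ger.
  - by move=> B; apply/measurable_EFinP; exact: measurable_minr.
  - move=> w _ m n mn; rewrite lee_fin le_min ge_min lexx/= ge_min ler_nat mn.
    by rewrite orbT.
apply: lime_le; last by apply: nearW => B; exact: exp_trunc.
apply: ereal_nondecreasing_is_cvgn => m n mn; apply: ge0_le_integral => //.
- by apply/measurable_EFinP; exact: measurable_minr.
- by apply/measurable_EFinP; exact: measurable_minr.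
- move=> w _; rewrite lee_fin le_min ge_min lexx/= ge_min ler_nat mn.
  by rewrite orbT.
Unshelve. all: by end_near. Qed.

Lemma bounded_moments_lam : bounded_moments (P := P) lam.
Proof.
apply: (bounded_moments_expR r_gt0 (K := 2 * C + 1)) => //.
- exact: (lam_measurable H).
- exact: (lam_ge0 H).
Qed.

Lemma bounded_moments_N : bounded_moments (P := P) (fun t w => (N t w)%:R).
Proof.
have mlam u := lam_measurable H u.
(* For [s = r / (1 + r)], [e^s - 1 <= 1 / (1 - s) - 1 = r], so the generating function of the count
   is dominated by the exponential moment of the intensity at [r]. *)
have rr : 0 < r / (1 + r) by rewrite divr_gt0// addr_gt0.
apply: (bounded_moments_expR rr (K := 2 * C + 1)) => //; first exact: (measurable_N H).
move=> t; apply: le_trans (exp_moment t).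
have := @integral_cond_expR _ _ _ _ _ _ _ _ _ H (t - 1) (r / (1 + r)) (fun=> 1) (fun=> ler01)
  (measurable_cst _).
rewrite subrK; under eq_integral do rewrite mul1r.
move=> ->; under eq_integral do rewrite mul1r.
apply: ge0_le_integral => //.
- apply/measurable_EFinP; apply: measurableT_comp => //; exact: measurable_funM.
- apply/measurable_EFinP; apply: measurableT_comp => //; exact: measurable_funM.
- move=> w _; rewrite lee_fin ler_expR mulrC ler_wpM2r//; first exact: (lam_ge0 H).
  rewrite lerBlDr; apply: (le_trans (expR_le_inv1B _)).
    by rewrite ltr_pdivrMr ?addr_gt0// mul1r ltrDr.
  rewrite le_eqVlt; apply/orP; left; apply/eqP.
  by have := r_gt0 => h; field; rewrite !gt_eqF//; lra.
Qed.

End exponential_moment.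

(** * The heat kernel *)

Section taylor.
Context {R : realType}.
Implicit Types (f g df dg : R -> R) (x y h K : R).

Lemma is_derive1_continuous f (df : R) x : is_derive x 1 f df -> {for x, continuous f}.
Proof.
by move=> [fx _]; apply: differentiable_continuous; apply/derivable1_diffP.
Qed.

Lemma MVT_line f df x y : (forall z : R, is_derive z 1 f (df z)) ->
  exists2 z, `|z - x| <= `|y - x| & f y - f x = df z * (y - x).
Proof.
move=> fdf; have cf : continuous f by move=> z; exact: is_derive1_continuous (fdf z).
have [xy|/ltW yx] := leP x y.
  have [|c] := @MVT_segment R f df x y xy (fun z _ => fdf z).
    exact: continuous_subspaceT.
  rewrite in_itv/= => /andP[xc cy] ->; exists c => //.
  by rewrite !ger0_norm; lra.
have [|c] := @MVT_segment R f df y x yx (fun z _ => fdf z).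
  exact: continuous_subspaceT.
rewrite in_itv/= => /andP[yc cx] E; exists c; first by rewrite !ler0_norm; lra.
by rewrite -opprB E; ring.
Qed.

(** The mean value theorem instead of integration: the factor [1 / (k + 1)] is given up, and the
    bound can be iterated. *)
Lemma norm_le_of_derive g dg K k : (forall z : R, is_derive z 1 g (dg z)) -> g 0 = 0 ->
  0 <= K -> (forall z, `|dg z| <= K * `|z| ^+ k) -> forall h, `|g h| <= K * `|h| ^+ k.+1.
Proof.
move=> gdg g0 K0 dgK h; have [z] := MVT_line 0 h gdg.
rewrite g0 !subr0 => zh ->; rewrite normrM exprSr mulrA ler_wpM2r//.
by apply: (le_trans (dgK z)); rewrite ler_wpM2l// lerXn2r ?nnegrE.
Qed.

(** As a function of [h], each Taylor remainder has the remainder of one order less as derivative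
    and vanishes at [0]; three rounds of the previous bound lead from [f3] to [f]. *)
Lemma taylor3 f (f1 f2 f3 : R -> R) K : 0 <= K ->
  (forall z : R, is_derive z 1 f (f1 z)) -> (forall z : R, is_derive z 1 f1 (f2 z)) ->
  (forall z : R, is_derive z 1 f2 (f3 z)) -> (forall z, `|f3 z| <= K) ->
  forall x h, `|f (x + h) - f x - f1 x * h - 2^-1 * f2 x * h ^+ 2| <= K * `|h| ^+ 3.
Proof.
move=> K0 fd f1d f2d f3K x.
have sh g dg : (forall z : R, is_derive z 1 g (dg z)) ->
    forall z : R, is_derive z 1 (fun z => g (x + z)) (dg (x + z)).
  move=> gd z; have gz := gd (x + z).
  have : is_derive z 1 (g \o (fun z => x + z)) (dg (x + z) * (0 + 1)).
    by apply: is_derive1_comp.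
  by rewrite add0r mulr1.
have h2 := @norm_le_of_derive (fun h => f2 (x + h) - f2 x) (fun h => f3 (x + h)) K 0.
have {}h2 h : `|f2 (x + h) - f2 x| <= K * `|h| ^+ 1.
  apply: h2 => //; last by move=> z; rewrite expr0 mulr1.
    by move=> z; have := sh _ _ f2d z => ?; apply: is_derive_eq; rewrite subr0.
  by rewrite addr0 subrr.
have h1 := @norm_le_of_derive (fun h => f1 (x + h) - f1 x - f2 x * h)
  (fun h => f2 (x + h) - f2 x) K 1.
have {}h1 h : `|f1 (x + h) - f1 x - f2 x * h| <= K * `|h| ^+ 2.
  apply: h1 => //.
    move=> z; have := sh _ _ f1d z => ?; apply: is_derive_eq.
    by rewrite /GRing.scale/=; ring.
  by rewrite addr0 mulr0; ring.
apply: (@norm_le_of_derive (fun h => f (x + h) - f x - f1 x * h - 2^-1 * f2 x * h ^+ 2)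
  (fun h => f1 (x + h) - f1 x - f2 x * h) K 2) => //.
  move=> z; have := sh _ _ fd z => ?; apply: is_derive_eq.
  by rewrite /GRing.scale/=; field.
by rewrite addr0 mulr0; ring.
Qed.

End taylor.

Section heat_kernel.
Context {R : realType}.
Implicit Types (x w c t q : R).

(* The heat kernel, up to the factor [1 / sqrt (2 pi)]. *)
Definition heat x w : R := expR (- (x ^+ 2 / (2 * w)) - ln w / 2).
Definition heat_x x w : R := - (x / w) * heat x w.
Definition heat_xx x w : R := (x ^+ 2 / w ^+ 2 - w^-1) * heat x w.
Definition heat_xxx x w : R := (3 * x / w ^+ 2 - x ^+ 3 / w ^+ 3) * heat x w.
Definition heat_ww x w : R :=
  ((x ^+ 2 / (2 * w ^+ 2) - (2 * w)^-1) ^+ 2 + ((2 * w ^+ 2)^-1 - x ^+ 2 / w ^+ 3)) * heat x w.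

Lemma is_derive_heat x w : is_derive x 1 (heat ^~ w) (heat_x x w).
Proof.
rewrite /heat /heat_x; apply: is_derive_eq; rewrite /heat /GRing.scale/=.
(* At [w = 0] the convention [0^-1 = 0] makes [heat] constant in [x] and [heat_x] zero. *)
have [->|w0] := eqVneq w 0; first by rewrite mulr0 invr0; ring.
by field.
Qed.

Lemma is_derive_heat_x x w : is_derive x 1 (heat_x ^~ w) (heat_xx x w).
Proof.
rewrite /heat_x /heat_xx; have := is_derive_heat x w => ?; apply: is_derive_eq.
rewrite /heat_x /GRing.scale/=.
have [->|w0] := eqVneq w 0; first by rewrite expr0n/= invr0; ring.
by field.
Qed.

Lemma is_derive_heat_xx x w : is_derive x 1 (heat_xx ^~ w) (heat_xxx x w).
Proof.
rewrite /heat_xx /heat_xxx; have := is_derive_heat x w => ?; apply: is_derive_eq.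
rewrite /heat_x /GRing.scale/=.
have [->|w0] := eqVneq w 0; first by rewrite !expr0n/= invr0; ring.
by field.
Qed.

Lemma is_derive_heat_w x w : 0 < w -> is_derive w 1 (heat x) (heat_xx x w / 2).
Proof.
move=> w0; have wn0 : w != 0 by rewrite gt_eqF.
have dl := is_derive1_ln w0.
have dv : is_derive w 1 (fun w => (2 * w)^-1) (- (2 * w) ^- 2 * 2).
  have d2 : is_derive w 1 (fun w => 2 * w) 2.
    by apply: is_derive_eq; rewrite /GRing.scale/=; ring.
  have : 2 * w != 0 by rewrite mulf_neq0.
  by move=> n0; have := is_deriveV n0 d2; rewrite /GRing.scale/=.
rewrite /heat; apply: is_derive_eq; rewrite /heat_xx /heat /GRing.scale/=.
by field.
Qed.

Lemma is_derive_heat_xx_w x w : 0 < w ->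
  is_derive w 1 (fun w => heat_xx x w / 2) (heat_ww x w).
Proof.
move=> w0; have wn0 : w != 0 by rewrite gt_eqF.
have dh := is_derive_heat_w x w0.
have dv1 : is_derive w 1 (fun w => w^-1) (- w ^- 2).
  have := is_deriveV wn0 (is_derive_id w 1); rewrite /GRing.scale/= mulr1.
  exact.
have w20 : w ^+ 2 != 0 by rewrite expf_neq0.
have dv2 : is_derive w 1 (fun w => (w ^+ 2)^-1) (- (w ^+ 2) ^- 2 * (2 * w)).
  have d2 : is_derive w 1 (fun w => w ^+ 2) (2 * w).
    by apply: is_derive_eq; rewrite /GRing.scale/=; ring.
  by have := is_deriveV (f := fun w : R => w ^+ 2) w20 d2; rewrite /GRing.scale/=.
rewrite /heat_xx; apply: is_derive_eq; rewrite /heat_ww /heat_xx /GRing.scale/=.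
by field.
Qed.

Lemma exprn_expRN_le q j : 0 <= q -> q ^+ j * expR (- (q / 2)) <= 2 ^+ j * j`!%:R.
Proof.
move=> q0; have := exprn_le_fact_expR j (x := q / 2); rewrite divr_ge0// => /(_ isT).
rewrite expr_div_n ler_pdivrMr ?exprn_gt0// expRN => h.
by rewrite ler_pdivrMr ?expR_gt0//; apply: le_trans h _; rewrite le_eqVlt; apply/orP; left; apply/eqP; ring.
Qed.

Section bounds.
Variable c : R.
Hypothesis c0 : 0 < c.

(* All the bounds come from [q^j e^(-q/2) <= 2^j j!] with [q = x^2 / w]. *)
Lemma heat_poly_bound (a0 a1 a2 : R) : 0 <= a0 -> 0 <= a1 -> 0 <= a2 ->
  exists2 K : R, 0 <= K & forall (p : R) x w, c <= w ->
    `|p| <= a0 + a1 * (x ^+ 2 / w) + a2 * (x ^+ 2 / w) ^+ 2 -> `|p * heat x w| <= K.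
Proof.
move=> a00 a10 a20; exists ((a0 + a1 * 2 + a2 * 8) * expR (- (ln c / 2))).
  by rewrite mulr_ge0 ?expR_ge0 ?addr_ge0 ?mulr_ge0.
move=> p x w cw pb; have w0 : 0 < w := lt_le_trans c0 cw.
set q := x ^+ 2 / w in pb.
have q0 : 0 <= q by rewrite divr_ge0 ?sqr_ge0// ltW.
have -> : heat x w = expR (- (q / 2)) * expR (- (ln w / 2)).
  by rewrite -expRD /heat /q; congr expR; have wn0 : w != 0 by [rewrite gt_eqF]; field.
rewrite mulrA normrM ler_pM//; last first.
  rewrite ger0_norm ?expR_ge0// ler_expR lerN2 ler_pM2r ?invr_gt0//.
  by rewrite ler_ln ?posrE.
rewrite normrM (ger0_norm (expR_ge0 _)).
have e0 := @exprn_expRN_le q 0 q0; have e1 := @exprn_expRN_le q 1 q0.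
have e2 := @exprn_expRN_le q 2 q0.
rewrite expr0 mul1r fact0 mulr1 expr0 in e0.
rewrite -natrX -natrM (_ : 2 ^ 2 * 2`! = 8)%N// in e2.
rewrite !expr1 mulr1 in e1.
apply: le_trans (ler_wpM2r (expR_ge0 _) pb) _.
have := ler_wpM2l a00 e0; have := ler_wpM2l a10 e1; have := ler_wpM2l a20 e2.
lra.
Qed.

Lemma heat_bounds : exists2 K : R, 0 <= K & forall x w, c <= w ->
  [/\ `|heat x w| <= K, `|heat_x x w| <= K, `|heat_xx x w| <= K,
      `|heat_xxx x w| <= K & `|heat_ww x w| <= K].
Proof.
pose C := c^-1; have C0 : 0 <= C by rewrite invr_ge0 ltW.
have [K0 K00 h0] := @heat_poly_bound 1 0 0 ler01 (lexx 0) (lexx 0).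
have [K1 K10 h1] := @heat_poly_bound C 1 0 C0 ler01 (lexx 0).
have [K2 K20 h2] := @heat_poly_bound C C 0 C0 C0 (lexx 0).
have CC : 0 <= C ^+ 2 by rewrite exprn_ge0.
have [K3 K30 h3] := @heat_poly_bound (3 * C ^+ 2) (3 * C + C ^+ 2) C
  (mulr_ge0 (ler0n _ _) CC) (addr_ge0 (mulr_ge0 (ler0n _ _) C0) CC) C0.
have [K4 K40 h4] := @heat_poly_bound _ _ _ CC CC CC.
exists (K0 + K1 + K2 + K3 + K4); first by rewrite !addr_ge0.
move=> x w cw; have w0 : 0 < w := lt_le_trans c0 cw.
have wn0 : w != 0 by rewrite gt_eqF.
pose v := w^-1; have v0 : 0 <= v by rewrite invr_ge0 ltW.
have vC : v <= C by rewrite lef_pV2 ?posrE.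
pose q := x ^+ 2 * v; have q0 : 0 <= q by rewrite mulr_ge0 ?sqr_ge0.
have x1 : `|x| <= 1 + x ^+ 2.
  by rewrite -real_normK ?num_real//; have := sqr_ge0 (`|x| - 1); rewrite !expr2; nra.
have vv : v ^+ 2 <= C ^+ 2 by rewrite lerXn2r ?nnegrE.
have qv : q * v <= q * C by rewrite ler_wpM2l.
have qvv : q * v ^+ 2 <= q * C ^+ 2 by rewrite ler_wpM2l.
have qqv : q ^+ 2 * v <= q ^+ 2 * C by rewrite ler_wpM2l ?exprn_ge0.
have qqvv : q ^+ 2 * v ^+ 2 <= q ^+ 2 * C ^+ 2 by rewrite ler_wpM2l ?exprn_ge0.
split.
- rewrite -[heat x w]mul1r; apply: (@le_trans _ _ K0); last lra.
  by apply: h0 => //; rewrite normr1 !mul0r !addr0.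
- apply: (@le_trans _ _ K1); last lra.
  apply: h1 => //; rewrite -/v normrN normrM (ger0_norm v0) -/q mul0r mul1r.
  by have := ler_wpM2r v0 x1; rewrite mulrDl -/q; lra.
- apply: (@le_trans _ _ K2); last lra.
  apply: h2 => //; rewrite -/v -/q (_ : x ^+ 2 / w ^+ 2 = q * v); last by rewrite /q /v; field.
  apply: (le_trans (ler_normB _ _)).
  by rewrite (ger0_norm v0) (ger0_norm (mulr_ge0 q0 v0)); lra.
- apply: (@le_trans _ _ K3); last lra.
  apply: h3 => //; rewrite -/v -/q.
  rewrite (_ : 3 * x / w ^+ 2 - x ^+ 3 / w ^+ 3 = 3 * (v ^+ 2 * x) - q * v ^+ 2 * x);
    last by rewrite /q /v; field.
  apply: (le_trans (ler_normB _ _)).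
  have v20 := exprn_ge0 2 v0.
  rewrite normrM normr_nat [`|v ^+ 2 * x|]normrM (ger0_norm v20).
  rewrite [`|q * v ^+ 2 * x|]normrM (ger0_norm (mulr_ge0 q0 v20)).
  have := ler_wpM2l (exprn_ge0 2 v0) x1.
  have := ler_wpM2l (mulr_ge0 q0 (exprn_ge0 2 v0)) x1.
  rewrite !mulrDr !mulr1.
  rewrite (_ : q * v ^+ 2 * x ^+ 2 = q ^+ 2 * v); last by rewrite /q; ring.
  rewrite (_ : v ^+ 2 * x ^+ 2 = q * v); last by rewrite /q; ring.
  lra.
- apply: (@le_trans _ _ K4); last lra.
  apply: h4 => //; rewrite -/v -/q.
  set p := (X in `|X|); have -> : p = 4^-1 * (q ^+ 2 * v ^+ 2) - 2^-1 * (q * v ^+ 2) + 4^-1 * v ^+ 2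
      + (2^-1 * v ^+ 2 - q * v ^+ 2) by rewrite /p /q /v; field.
  have : 0 <= q * v ^+ 2 by rewrite mulr_ge0 ?exprn_ge0.
  have : 0 <= q ^+ 2 * v ^+ 2 by rewrite mulr_ge0 ?exprn_ge0.
  have : 0 <= v ^+ 2 by rewrite exprn_ge0.
  have : 0 <= v ^+ 2 * (q - 1) ^+ 2 by rewrite mulr_ge0 ?sqr_ge0 ?exprn_ge0.
  by move=> *; rewrite ler_norml; apply/andP; split; lra.
Qed.

Lemma heat_dist_w : exists2 K : R, 0 <= K &
  forall x w t, c <= w -> c <= t -> `|heat x w - heat x t| <= K * `|w - t|.
Proof.
have [K K0 hK] := heat_bounds; exists K => // x w t.
wlog tw : w t / t <= w.
  move=> h cw ct; have [|/ltW] := leP t w; first by move=> /h; exact.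
  by move=> wt; rewrite distrC [`|w - t|]distrC h.
move=> cw ct.
have dh y : t <= y -> is_derive y 1 (heat x) (heat_xx x y / 2).
  by move=> ty; apply: is_derive_heat_w; apply: lt_le_trans c0 (le_trans ct ty).
have [y||y] := @MVT_segment R (heat x) (fun w => heat_xx x w / 2) t w tw.
- by rewrite in_itv/= => /andP[/ltW/dh].
- apply: continuous_in_subspaceT => y; rewrite inE/= in_itv/= => /andP[/dh + _].
  exact: is_derive1_continuous.
rewrite in_itv/= => /andP[ty _] ->; rewrite normrM ler_wpM2r//.
have [_ _ h _ _] := hK x y (le_trans ct ty).
by rewrite normrM (ger0_norm (_ : 0 <= 2^-1))//; lra.
Qed.

Lemma heat_step_w : exists2 K : R, 0 <= K & forall x w t, c <= w - t -> 0 <= t ->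
  `|heat x (w - t) - heat x w + 2^-1 * t * heat_xx x w| <= K * t ^+ 2.
Proof.
have [K K0 hK] := heat_bounds; exists K => // x w t cwt t0.
have wt : w - t <= w by lra.
have dh y : w - t <= y -> is_derive y 1 (heat x) (heat_xx x y / 2).
  by move=> ty; apply: is_derive_heat_w; apply: lt_le_trans c0 (le_trans cwt ty).
have dh2 y : w - t <= y -> is_derive y 1 (fun w => heat_xx x w / 2) (heat_ww x y).
  by move=> ty; apply: is_derive_heat_xx_w; apply: lt_le_trans c0 (le_trans cwt ty).
have [y||y] := @MVT_segment R (heat x) (fun w => heat_xx x w / 2) (w - t) w wt.
- by rewrite in_itv/= => /andP[/ltW/dh].
- apply: continuous_in_subspaceT => y; rewrite inE/= in_itv/= => /andP[/dh + _].
  exact: is_derive1_continuous.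
rewrite in_itv/= => /andP[wty yw] E.
have [z||z] := @MVT_segment R (fun w => heat_xx x w / 2) (heat_ww x) y w yw.
- by rewrite in_itv/= => /andP[/ltW yz _]; exact: dh2 (le_trans wty yz).
- apply: continuous_in_subspaceT => z; rewrite inE/= in_itv/= => /andP[yz _].
  exact: is_derive1_continuous (dh2 z (le_trans wty yz)).
rewrite in_itv/= => /andP[yz zw] E2.
have -> : heat x (w - t) - heat x w + 2^-1 * t * heat_xx x w = heat_ww x z * (w - y) * t.
  by rewrite -E2; move: E; rewrite (_ : w - (w - t) = t); [lra|ring].
have [_ _ _ _ h] := hK x z (le_trans cwt (le_trans wty yz)).
rewrite normrM (ger0_norm t0) normrM (_ : K * t ^+ 2 = K * t * t); last by ring.
by rewrite ler_wpM2r// ler_pM// ger0_norm; lra.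
Qed.

(* One Lindeberg step: [heat] solves the heat equation, so an increment [X] with
   conditional variance [s2] is compensated by the decrease [t] of the time. *)
Lemma heat_step : exists2 K : R, 0 <= K & forall x X w t s2 : R,
  c <= w - t -> 0 <= t -> t <= s2 ->
  `|heat (x + X) (w - t) - heat x w - heat_x x w * X - 2^-1 * heat_xx x w * (X ^+ 2 - s2)|
    <= K * (`|X| ^+ 3 + t * `|X| + t ^+ 2 + (s2 - t)).
Proof.
have [K1 K10 h1] := heat_bounds; have [K2 K20 h2] := heat_step_w.
exists (K1 + K2); first by rewrite addr_ge0.
move=> x X w t s2 cwt t0 ts2.
have cw : c <= w by lra.
have e1 := h2 (x + X) w t cwt t0.
have e2 := @taylor3 R (heat ^~ w) (heat_x ^~ w) (heat_xx ^~ w) (heat_xxx ^~ w) K1 K10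
  (fun z => is_derive_heat z w) (fun z => is_derive_heat_x z w)
  (fun z => is_derive_heat_xx z w) _ x X.
have {}e2 := e2 (fun z => let: And5 _ _ _ h _ := h1 z w cw in h).
have [z _ E3] := MVT_line x (x + X) (fun z => is_derive_heat_xx z w).
have e3 : `|2^-1 * t * (heat_xx (x + X) w - heat_xx x w)| <= K1 * (t * `|X|).
  rewrite E3 (_ : x + X - x = X); last by ring.
  have [_ _ _ h _] := h1 z w cw.
  have t20 : 0 <= 2^-1 * t by rewrite mulr_ge0.
  rewrite normrM (ger0_norm t20) [`|_ * X|]normrM.
  have := ler_wpM2l t0 (ler_wpM2r (normr_ge0 X) h).
  have := mulr_ge0 t0 (mulr_ge0 (normr_ge0 (heat_xxx z w)) (normr_ge0 X)); lra.
have e4 : `|2^-1 * heat_xx x w * (s2 - t)| <= K1 * (s2 - t).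
  have [_ _ h _ _] := h1 x w cw.
  rewrite normrM [`|2^-1 * _|]normrM (ger0_norm (_ : 0 <= 2^-1))// [`|s2 - t|]ger0_norm ?subr_ge0//.
  by rewrite ler_wpM2r ?subr_ge0//; have := normr_ge0 (heat_xx x w); lra.
set A := (X in `|X| <= _) in e1; set B := (X in `|X| <= _) in e2.
set D := (X in `|X| <= _) in e3; set E := (X in `|X| <= _) in e4.
(* The four terms move the time at the point [x + X], bring [heat_xx] back from [x + X] to [x],
   expand in space at time [w], and replace [t] by [s2]. *)
set F := (X in `|X|); have -> : F = A - D + B + E by rewrite /F /A /B /D /E; ring.
have : `|A - D + B + E| <= `|A| + `|D| + `|B| + `|E|.
  rewrite (le_trans (ler_normD _ _))// lerD2r (le_trans (ler_normD _ _))// lerD2r.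
  exact: ler_normB.
have X3 : 0 <= `|X| ^+ 3 by rewrite exprn_ge0.
have tX : 0 <= t * `|X| by rewrite mulr_ge0.
have tt : 0 <= t ^+ 2 by rewrite exprn_ge0.
have st : 0 <= s2 - t by rewrite subr_ge0.
have := mulr_ge0 K20 X3; have := mulr_ge0 K20 tX; have := mulr_ge0 K10 tt.
have := mulr_ge0 K20 st; rewrite !mulrDr !mulrDl; lra.
Qed.

End bounds.

End heat_kernel.

(** * Weak convergence from heat kernel test functions *)

(** Uniform continuity by compactness of [[-A, A]]. Only [x] is confined to the interval; the nearby
    [y] may leave it. *)
Lemma heine_cantor (R : realType) (g : R -> R) (A e : R) : continuous g -> 0 < e ->
  exists2 eta : R, 0 < eta &
    forall x y, `|x| <= A -> `|y - x| <= eta -> `|g y - g x| <= e.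
Proof.
move=> cg e0.
have /compact_near_coveringP cA : compact `[- A, A]%classic by exact: segment_compact.
have := cA _ (0%R^'+) (fun eta x => forall y, `|y - x| <= eta -> `|g y - g x| <= e) _.
case/(_ _ _)/Wrap.
- move=> x0 _; have e2 : 0 < e / 2 by rewrite divr_gt0.
  have /cvgrPdist_le/(_ _ e2)/nbhs_ballP[del /= del0 hdel] := cg x0.
  exists (ball x0 (del / 2), [set eta | eta < del / 2]).
    split; first by apply: nbhsx_ballx; rewrite divr_gt0.
    by apply: nbhs_right_lt; rewrite divr_gt0.
  move=> [x eta] [/= x0x etad] y yx.
  have hx : `|g x0 - g x| <= e / 2.
    by apply: hdel; apply: le_ball x0x; rewrite ler_pdivrMr// ler_peMr// ?ler1n// ltW.
  have hy : `|g x0 - g y| <= e / 2.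
    apply: hdel; move: x0x; rewrite /ball/= => x0x.
    have := ler_distD x x0 y; rewrite [`|x - y|]distrC; lra.
  by have := ler_distD (g x0) (g y) (g x); rewrite [`|g y - g x0|]distrC; lra.
move=> /= hnear.
near (0 : R)^'+ => eta; exists eta => // x y xA yx.
have : `[- A, A]%classic `<=` (fun x => forall y, `|y - x| <= eta -> `|g y - g x| <= e).
  by near: eta; exact: hnear.
by apply => //=; rewrite in_itv/= -ler_norml.
Unshelve. all: by end_near. Qed.

(** * Convergence of densities and Gaussian smoothing *)

Section scheffe.
Context d (T : measurableType d) (R : realType) (mu : {measure set T -> \bar R}).

Lemma integrable_density (p : T -> R) : measurable_fun setT p -> (forall x, 0 <= p x) ->
  (\int[mu]_x (p x)%:E = 1)%E -> mu.-integrable setT (EFin \o p).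
Proof.
move=> mp p0 p1; apply/integrableP; split; first exact/measurable_EFinP.
under eq_integral do rewrite /= ger0_norm//.
by rewrite p1 ltry.
Qed.

Lemma integrable_bounded_density (g p : T -> R) (M : R) : measurable_fun setT g ->
  (forall x, `|g x| <= M) -> mu.-integrable setT (EFin \o p) ->
  mu.-integrable setT (EFin \o (fun x => g x * p x)).
Proof.
move=> mg gM ip; have mp : measurable_fun setT p.
  by apply/measurable_EFinP; exact: measurable_int ip.
apply: (le_integrable _ _ _ (integrableZl measurableT M ip)) => //.
  by apply/measurable_EFinP; exact: measurable_funM.
move=> x _ /=; rewrite lee_fin !normrM ler_wpM2r//.
exact: le_trans (gM x) (ler_norm _).
Qed.

(** The positive part [q] of [p - p_n] is dominated by [p], so its integral tends to [0]. Since
    [|p_n - p| = 2 q + (p_n - p)] and the last term integrates to [0], the densities converge in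
    [L^1]. *)
Lemma scheffe (p_ : nat -> T -> R) (p g : T -> R) (M : R) :
  (forall n, measurable_fun setT (p_ n)) -> (forall n x, 0 <= p_ n x) ->
  (forall n, \int[mu]_x (p_ n x)%:E = 1)%E ->
  measurable_fun setT p -> (forall x, 0 <= p x) -> (\int[mu]_x (p x)%:E = 1)%E ->
  (forall x, p_ n x @[n --> \oo] --> p x) ->
  measurable_fun setT g -> 0 <= M -> (forall x, `|g x| <= M) ->
  \int[mu]_x (g x * p_ n x) @[n --> \oo] --> \int[mu]_x (g x * p x).
Proof.
move=> mp_ p_0 p_1 mp p0 p1 pp mg M0 gM.
have ip_ n := integrable_density (mp_ n) (p_0 n) (p_1 n).
have ip := integrable_density mp p0 p1.
pose q n x := Num.max (p x - p_ n x) 0.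
have mq n : measurable_fun setT (q n).
  by apply: measurable_maxr => //; exact: measurable_funB.
have q0 n x : 0 <= q n x by rewrite le_max lexx orbT.
have qp n x : q n x <= p x by rewrite ge_max p0 andbT lerBlDr lerDl.
have iq n : mu.-integrable setT (EFin \o q n).
  apply: (le_integrable _ _ _ ip) => //; first exact/measurable_EFinP.
  by move=> x _ /=; rewrite lee_fin !ger0_norm.
have q_cvg : \int[mu]_x q n x @[n --> \oo] --> (0 : R).
  have [//|//||//||_ _ /=] := @dominated_convergence _ _ _ mu setT measurableT
    (fun n x => (q n x)%:E) (fun=> 0%E) (EFin \o p).
  - by move=> n; exact/measurable_EFinP.
  - apply: aeW => x _; apply/cvg_EFin; first exact: nearW.
    have /cvgrPdist_le hpp := pp x.
    apply/cvgrPdist_le => e e0; have {}hpp := hpp _ e0.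
    near=> n; rewrite sub0r normrN /= ger0_norm//.
    rewrite ge_max (ltW e0) andbT (le_trans (ler_norm _))//.
    by near: n; exact: hpp.
  - by apply: aeW => x n _; rewrite gee0_abs ?lee_fin.
  by rewrite integral0 => /fine_cvg.
have ig_ n := integrable_bounded_density mg gM (ip_ n).
have ig := integrable_bounded_density mg gM ip.
have R_1 n : \int[mu]_x p_ n x = 1 by rewrite /Rintegral p_1.
have R1 : \int[mu]_x p x = 1 by rewrite /Rintegral p1.
have bound n : `|\int[mu]_x (g x * p x) - \int[mu]_x (g x * p_ n x)| <=
    M * (2 * \int[mu]_x q n x).
  rewrite -RintegralB//; apply: (le_trans (le_normr_Rintegral _ _)) => //.
    by have := integrableB measurableT ig (ig_ n); apply: eq_integrable.
  have -> : M * (2 * \int[mu]_x q n x) =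
      \int[mu]_x (M * (2 * q n x + (p_ n x - p x))).
    have i2q : mu.-integrable setT (EFin \o (fun x => 2 * q n x)).
      exact: (integrableZl measurableT 2 (iq n)).
    have ipp : mu.-integrable setT (EFin \o (fun x => p_ n x - p x)).
      exact: (integrableB measurableT (ip_ n) ip).
    rewrite RintegralZl//; last exact: (integrableD measurableT i2q ipp).
    by rewrite RintegralD// RintegralB// RintegralZl// R_1 R1 subrr addr0.
  apply: le_Rintegral => //.
  - apply: integrable_norm.
    by have := integrableB measurableT ig (ig_ n); apply: eq_integrable.
  - have := integrableZl measurableT M (integrableD measurableT
      (integrableZl measurableT 2 (iq n)) (integrableB measurableT (ip_ n) ip)).
    exact: eq_integrable.
  - move=> x _; rewrite -mulrBr normrM ler_pM//.
    by rewrite /q /Num.max; case: ltP => ?; [rewrite ler0_norm|rewrite ger0_norm]; lra.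
apply/cvgrPdist_le => e e0.
have e1 : 0 < e / (2 * M + 1) by rewrite divr_gt0// ltr_wpDl// mulr_ge0.
have /cvgrPdist_le/(_ _ e1) hq := q_cvg.
near=> n; apply: (le_trans (bound n)).
have : `|0 - \int[mu]_x q n x| <= e / (2 * M + 1).
  by near: n; exact: hq.
rewrite sub0r normrN ger0_norm ?Rintegral_ge0// ler_pdivlMr ?ltr_wpDl ?mulr_ge0//.
have : 0 <= \int[mu]_x q n x by apply: Rintegral_ge0 => x _; exact: q0.
lra.
Unshelve. all: by end_near. Qed.

End scheffe.

Section gaussian_smoothing.
Context {R : realType}.
Notation mu := (@lebesgue_measure R).
Implicit Types (x y a s m e M eta w : R) (g : R -> R).

Definition gauss_cst : R := (Num.sqrt (pi *+ 2))^-1.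

Lemma heatN x w : heat (- x) w = heat x w.
Proof. by rewrite /heat sqrrN. Qed.

Lemma normal_peakE s : 0 < s -> normal_peak s = s^-1 * gauss_cst.
Proof.
move=> s0; rewrite /normal_peak /gauss_cst -mulrnAr sqrtrM ?sqr_ge0// sqrtr_sqr.
by rewrite (gtr0_norm s0) invfM.
Qed.

Lemma normal_pdf_heat m s x : 0 < s -> normal_pdf m s x = gauss_cst * heat (x - m) (s ^+ 2).
Proof.
move=> s0; rewrite normal_pdfE ?gt_eqF// normal_peakE// /normal_fun /heat expRD lnXn//.
rewrite (_ : ln s *+ 2 / 2 = ln s); last by rewrite -[ln s *+ 2]mulr_natr mulfK.
rewrite [expR (- ln s)]expRN lnK ?posrE// (_ : s ^+ 2 *+ 2 = 2 * s ^+ 2); last by rewrite mulr_natl.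
by rewrite mulNr; ring.
Qed.

(** Far from the centre the density is compared with the one of doubled deviation, whose total mass
    is [1]; this bounds Gaussian tails without computing a moment. The ratio is [2 e^(-z)] with
    [z >= 3 eta^2 / (8 s^2)], and [e^(-z) <= 1/z] gives the constant [16/3 <= 6]. *)
Lemma normal_pdf_tail s eta x a : 0 < s -> 0 < eta -> eta <= `|a - x| ->
  normal_pdf x s a <= 6 * s ^+ 2 / eta ^+ 2 * normal_pdf x (2 * s) a.
Proof.
move=> s0 eta0 ax; have s20 : 0 < 2 * s by rewrite mulr_gt0.
rewrite !normal_pdfE ?gt_eqF// !normal_peakE// /normal_fun.
have k0 : 0 <= gauss_cst by rewrite invr_ge0.
set k := gauss_cst in k0 *.
set u := a - x; have u2 : eta ^+ 2 <= u ^+ 2.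
  by rewrite -(@real_normK _ u) ?num_real// lerXn2r ?nnegrE// ltW.
have sn0 : s != 0 by rewrite gt_eqF.
pose z := 3 / 8 * (u ^+ 2 / s ^+ 2).
have zeta : 3 / 8 * (eta ^+ 2 / s ^+ 2) <= z.
  by rewrite ler_wpM2l// ler_wpM2r// invr_ge0 exprn_ge0// ltW.
have z0 : 0 < 3 / 8 * (eta ^+ 2 / s ^+ 2) by rewrite mulr_gt0// divr_gt0 ?exprn_gt0.
have -> : - u ^+ 2 / (s ^+ 2 *+ 2) = - u ^+ 2 / ((2 * s) ^+ 2 *+ 2) - z.
  by rewrite /z; field.
rewrite expRD.
have : expR (- z) <= 8 / 3 * (s ^+ 2 / eta ^+ 2).
  rewrite expRN (_ : 8 / 3 * _ = (3 / 8 * (eta ^+ 2 / s ^+ 2))^-1); last first.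
    by have : eta != 0; [rewrite gt_eqF|move=> ?; field; rewrite sn0].
  rewrite lef_pV2 ?posrE ?expR_gt0//; apply: le_trans zeta _.
  by apply: le_trans (expR_ge1Dx z); rewrite lerDr.
set E := expR (- u ^+ 2 / _) => ze.
have E0 : 0 <= E := expR_ge0 _.
have p0 : 0 <= s^-1 * k by rewrite mulr_ge0// invr_ge0 ltW.
rewrite [(2 * s)^-1]invfM.
have := ler_wpM2l (mulr_ge0 p0 E0) ze.
have : 0 <= s^-1 * k * E * (s ^+ 2 / eta ^+ 2).
  by rewrite mulr_ge0 ?mulr_ge0 ?invr_ge0 ?exprn_ge0// ltW.
lra.
Qed.

Definition smooth (s : R) (g : R -> R) (x : R) : R := \int[mu]_a (g a * normal_pdf x s a).

Lemma Rintegral_normal_pdf m s : \int[mu]_a normal_pdf m s a = 1.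
Proof. by rewrite /Rintegral integral_normal_pdf. Qed.

(** Within [eta] of [x] the oscillation is at most [e]; beyond, it is at most [2 M], and the tail
    comparison contributes [6 s^2 / eta^2]. *)
Lemma smooth_dist s eta e M g x : 0 < s -> 0 < eta -> 0 <= e -> 0 <= M ->
  measurable_fun setT g -> (forall y, `|g y| <= M) ->
  (forall y, `|y - x| <= eta -> `|g y - g x| <= e) ->
  `|smooth s g x - g x| <= e + 12 * M * s ^+ 2 / eta ^+ 2.
Proof.
move=> s0 eta0 e0 M0 mg gM ge.
have ip := @integrable_normal_pdf R x s.
have ip2 := @integrable_normal_pdf R x (2 * s).
have ig := @integrable_bounded_density _ (measurableTypeR R) R mu g _ M mg gM ip.
have mgx : measurable_fun setT (fun a => g a - g x) by exact: measurable_funB.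
have gxM a : `|g a - g x| <= M + M.
  by rewrite (le_trans (ler_normB _ _))// lerD.
have igx := @integrable_bounded_density _ (measurableTypeR R) R mu _ _ _ mgx gxM ip.
have -> : smooth s g x - g x = \int[mu]_a ((g a - g x) * normal_pdf x s a).
  rewrite -[X in _ - X]mulr1 -(Rintegral_normal_pdf x s) -RintegralZl//.
  have igc := integrableZl measurableT (g x) ip.
  by rewrite /smooth -RintegralB//; apply: eq_Rintegral => a _; rewrite mulrBl.
apply: (le_trans (le_normr_Rintegral _ igx)) => //.
have -> : e + 12 * M * s ^+ 2 / eta ^+ 2 =
  \int[mu]_a (e * normal_pdf x s a + 12 * M * s ^+ 2 / eta ^+ 2 * normal_pdf x (2 * s) a).
  rewrite RintegralD//; last 2 first.
  - exact: (integrableZl measurableT e ip).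
  - exact: (integrableZl measurableT _ ip2).
  by rewrite !RintegralZl// !Rintegral_normal_pdf !mulr1.
apply: le_Rintegral => //.
- exact: integrable_norm.
- have := integrableD measurableT (integrableZl measurableT e ip)
    (integrableZl measurableT (12 * M * s ^+ 2 / eta ^+ 2) ip2).
  exact: eq_integrable.
- move=> a _; rewrite normrM (ger0_norm (normal_pdf_ge0 _ _ _)).
  have p0 := normal_pdf_ge0 x s a; have p20 := normal_pdf_ge0 x (2 * s) a.
  have c0 : 0 <= 12 * M * s ^+ 2 / eta ^+ 2.
    by rewrite !mulr_ge0 ?invr_ge0 ?exprn_ge0// ltW.
  have [ax|ax] := leP `|a - x| eta.
    apply: (@le_trans _ _ (e * normal_pdf x s a)); first by rewrite ler_wpM2r// ge.
    by rewrite lerDl mulr_ge0.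
  apply: (@le_trans _ _ (2 * M * normal_pdf x s a)).
    by rewrite ler_wpM2r// (le_trans (gxM a))//; lra.
  have := ler_wpM2l (mulr_ge0 (ler0n R 2) M0) (normal_pdf_tail s0 eta0 (ltW ax)).
  by have := mulr_ge0 e0 p0; lra.
Qed.

End gaussian_smoothing.

Section weak_convergence.
Context {R : realType} {d : measure_display} {T : measurableType d} (P : probability T R).
Notation mu := (@lebesgue_measure R).
Variables (X : nat -> T -> R) (s : R).
Hypothesis mX : forall n, measurable_fun setT (X n).
Hypothesis s0 : 0 <= s.
Variable K : R.
Hypothesis X2 : forall n, P.-integrable setT (EFin \o (fun w => X n w ^+ 2)) /\
  \int[P]_w (X n w ^+ 2) <= K.
Hypothesis heat_cvg : forall c a : R, 0 < c ->
  \int[P]_w heat (X n w - a) c @[n --> \oo] --> heat a (c + s ^+ 2).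

Local Notation TR := (T * measurableTypeR R)%type.

(** The density at [a] of [X n] plus an independent centred Gaussian of standard deviation [t]. *)
Let p_ (t : R) n (a : R) := \int[P]_w normal_pdf (X n w) t a.

Let measurable_pdf (t : R) n : 0 < t ->
  measurable_fun setT (fun z : TR => normal_pdf (X n z.1) t z.2).
Proof.
move=> t0; rewrite (_ : (fun z : TR => _) =
    fun z : TR => normal_peak t * normal_fun (X n z.1) t z.2); last first.
  by apply/funext => z; rewrite normal_pdfE// gt_eqF.
apply: measurable_funM => //; rewrite /normal_fun; apply: measurableT_comp => //.
apply: measurable_funM => //; apply: measurableT_comp => //.
apply: measurable_funX; apply: measurable_funB; first exact: measurable_snd.
by apply: measurableT_comp => //; exact: mX.
Qed.

Let measurable_pdf_w (t : R) n a : 0 < t ->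
  measurable_fun setT (fun w => normal_pdf (X n w) t a).
Proof.
move=> t0; have mp := measurable_pdf n t0.
exact: (measurableT_comp mp (measurable_pair2 (a : measurableTypeR R))).
Qed.

Let integrable_pdf (t : R) n a : 0 < t ->
  P.-integrable setT (EFin \o (fun w => normal_pdf (X n w) t a)).
Proof.
move=> t0; apply: (@bounded_moments_integrable _ _ _ _ unit
  (fun _ w => normal_pdf (X n w) t a) tt).
apply: (@bounded_moments_bounded _ _ _ _ _ _ (normal_peak t)) => [_|_ w].
  exact: measurable_pdf_w.
by rewrite ger0_norm ?normal_pdf_ge0// normal_pdf_ub// gt_eqF.
Qed.

Let measurable_p (t : R) n : 0 < t -> measurable_fun setT (p_ t n).
Proof.
move=> t0; apply: (@measurableT_comp _ _ _ _ _ _ (@fine R)) => //.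
apply: (@measurable_fun_fubini_tonelli_G _ _ T (measurableTypeR R) R P
  (fun z => (normal_pdf (X n z.1) t z.2)%:E)) => //.
  by apply/measurable_EFinP; exact: measurable_pdf.
by move=> z; rewrite lee_fin normal_pdf_ge0.
Qed.

Let p_ge0 (t : R) n a : 0 <= p_ t n a.
Proof. by apply: Rintegral_ge0 => w _; exact: normal_pdf_ge0. Qed.

Let EFin_p (t : R) n a : 0 < t ->
  ((p_ t n a)%:E = \int[P]_w (normal_pdf (X n w) t a)%:E)%E.
Proof.
by move=> t0; rewrite /p_ /Rintegral fineK//; apply: integrable_fin_num => //; exact: integrable_pdf.
Qed.

Let integral_p (t : R) n : 0 < t -> (\int[mu]_a (p_ t n a)%:E = 1)%E.
Proof.
move=> t0; under eq_integral do rewrite EFin_p//.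
rewrite -(@fubini_tonelli _ _ T (measurableTypeR R) R P mu
  (fun z => (normal_pdf (X n z.1) t z.2)%:E))/=; last 2 first.
- by apply/measurable_EFinP; exact: measurable_pdf.
- by move=> z; rewrite lee_fin normal_pdf_ge0.
by under eq_integral do rewrite integral_normal_pdf; rewrite integral_prob_cst.
Qed.

Let smooth_integrand (t : R) n (g : R -> R) (z : TR) : \bar R :=
  (g z.2 * normal_pdf (X n z.1) t z.2)%:E.

Let integrable_section (t : R) n (g : R -> R) (M : R) w : measurable_fun setT g ->
  (forall y, `|g y| <= M) -> mu.-integrable setT (fun a => smooth_integrand t n g (w, a)).
Proof.
move=> mg gM; have ip := @integrable_normal_pdf R (X n w) t.
exact: (@integrable_bounded_density _ (measurableTypeR R) R mu _ _ _ mg gM ip).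
Qed.

Let integrable_smooth_integrand (t : R) n (g : R -> R) (M : R) : 0 < t ->
  measurable_fun setT g -> 0 <= M -> (forall y, `|g y| <= M) ->
  (P \x mu)%E.-integrable setT (smooth_integrand t n g).
Proof.
move=> t0 mg M0 gM; set F := smooth_integrand t n g.
have mF : measurable_fun setT F.
  apply/measurable_EFinP; apply: measurable_funM; last exact: measurable_pdf.
  by apply: (measurableT_comp (f := g)) => //; exact: measurable_snd.
apply/integrable12ltyP => //.
apply: (@le_lt_trans _ _ (\int[P]_w M%:E)%E); last by rewrite integral_prob_cst ltry.
apply: ge0_le_integral => //.
- by move=> w _; apply: integral_ge0.
- apply: (@measurable_fun_fubini_tonelli_F _ _ _ _ _ _ (abse \o F)) => //=.
  exact: measurableT_comp.
move=> w _; rewrite -[leRHS]mule1 -(@integral_normal_pdf R (X n w) t) -integralZl//; last first.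
  exact: integrable_normal_pdf.
apply: ge0_le_integral => //.
- by apply: measurableT_comp => //; exact: measurable_int (integrable_section _ _ w mg gM).
- apply/measurable_EFinP; apply: measurable_funM => //; exact: measurable_normal_pdf.
- move=> a _; rewrite -EFinM lee_fin normrM (ger0_norm (normal_pdf_ge0 _ _ _)).
  by rewrite ler_wpM2r ?normal_pdf_ge0.
Qed.

Let EFin_smooth (t : R) n (g : R -> R) (M : R) w : measurable_fun setT g ->
  (forall y, `|g y| <= M) ->
  ((smooth t g (X n w))%:E = \int[mu]_a smooth_integrand t n g (w, a))%E.
Proof.
move=> mg gM; rewrite /smooth /Rintegral fineK//.
exact: integrable_fin_num (integrable_section t n w mg gM).
Qed.

Let integrable_smooth (t : R) n (g : R -> R) (M : R) : 0 < t ->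
  measurable_fun setT g -> 0 <= M -> (forall y, `|g y| <= M) ->
  P.-integrable setT (EFin \o (fun w => smooth t g (X n w))).
Proof.
move=> t0 mg M0 gM.
have := @integrable_fubini_F _ _ _ _ _ _ _ _ (integrable_smooth_integrand n t0 mg M0 gM).
by apply: eq_integrable => // w _; rewrite /= (EFin_smooth _ _ _ mg gM).
Qed.

Let fubini_smooth (t : R) n (g : R -> R) (M : R) : 0 < t -> measurable_fun setT g ->
  0 <= M -> (forall y, `|g y| <= M) ->
  \int[P]_w smooth t g (X n w) = \int[mu]_a (g a * p_ t n a).
Proof.
move=> t0 mg M0 gM; rewrite /Rintegral; congr fine.
under eq_integral do rewrite (EFin_smooth _ _ _ mg gM).
rewrite Fubini//; last exact: (integrable_smooth_integrand n t0 mg M0 gM).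
apply: eq_integral => a _.
by rewrite EFinM EFin_p// -integralZl//; exact: integrable_pdf.
Qed.

Let limit_sd (t : R) := Num.sqrt (t ^+ 2 + s ^+ 2).

Let limit_sd_gt0 (t : R) : 0 < t -> 0 < limit_sd t.
Proof. by move=> t0; rewrite sqrtr_gt0 ltr_pwDl ?exprn_gt0 ?sqr_ge0. Qed.

Let limit_sdK (t : R) : limit_sd t ^+ 2 = t ^+ 2 + s ^+ 2.
Proof. by rewrite sqr_sqrtr// addr_ge0 ?sqr_ge0. Qed.

(** The hypothesis [heat_cvg] at time [t^2], by symmetry of the kernel; the variances [t^2] and
    [s^2] add. *)
Let p_cvg (t : R) a : 0 < t -> p_ t n a @[n --> \oo] --> normal_pdf 0 (limit_sd t) a.
Proof.
move=> t0; rewrite normal_pdf_heat ?limit_sd_gt0// limit_sdK subr0.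
have -> : p_ t ^~ a = fun n => gauss_cst * \int[P]_w heat (X n w - a) (t ^+ 2).
  apply/funext => n; have := integrable_pdf n a t0 => ip.
  have g0 : gauss_cst != 0 :> R by rewrite invr_neq0// gt_eqF// sqrtr_gt0 mulrn_wgt0// pi_gt0.
  have ih : P.-integrable setT (EFin \o (fun w => heat (X n w - a) (t ^+ 2))).
    have := integrableZl measurableT (gauss_cst^-1) ip; apply: eq_integrable => // w _.
    by rewrite /= -EFinM normal_pdf_heat// mulKf// -[in LHS]heatN opprB.
  rewrite -RintegralZl//; apply: eq_Rintegral => w _.
  by rewrite normal_pdf_heat// -[in LHS]heatN opprB.
by apply: cvgMr; apply: heat_cvg; rewrite exprn_gt0.
Qed.

Let smooth_cvg (t : R) (g : R -> R) (M : R) : 0 < t -> measurable_fun setT g ->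
  0 <= M -> (forall y, `|g y| <= M) ->
  \int[P]_w smooth t g (X n w) @[n --> \oo] --> \int[mu]_a (g a * normal_pdf 0 (limit_sd t) a).
Proof.
move=> t0 mg M0 gM; under eq_fun do rewrite (fubini_smooth _ t0 mg M0 gM).
apply: (@scheffe _ (measurableTypeR R) R mu (p_ t) _ g M) => //.
- by move=> n; exact: measurable_p.
- by move=> n; exact: integral_p.
- exact: measurable_normal_pdf.
- by move=> a; exact: normal_pdf_ge0.
- exact: integral_normal_pdf.
- by move=> a; exact: p_cvg.
Qed.

(** The smoothing error is uniform in [n] because the second moments are: where [|X n| <= A] it is
    small by uniform continuity, elsewhere it is bounded and Chebyshev's inequality applies. *)
Let smooth_approx (g : R -> R) (M e : R) : continuous g -> 0 <= M ->
  (forall y, `|g y| <= M) -> 0 < e ->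
  exists2 t0 : R, 0 < t0 & forall t, 0 < t -> t <= t0 ->
    (forall n, `|\int[P]_w smooth t g (X n w) - \int[P]_w g (X n w)| <= e) /\
    `|smooth t g 0 - g 0| <= e.
Proof.
move=> cg M0 gM e0; have mg : measurable_fun setT g by exact: continuous_measurable_fun.
have K0 : 0 <= K.
  by apply: le_trans (X2 0%N).2; apply: Rintegral_ge0 => w _; exact: sqr_ge0.
have e3 : 0 < e / 3 by rewrite divr_gt0.
(* [A >= 1] and [A >= 6 M K / e] give [A^2 >= 6 M K / e], so the tail part [2 M K / A^2] is at most
   [e / 3]. *)
pose A := 1 + 6 * M * K / e.
have MK0 : 0 <= 6 * M * K / e by rewrite !mulr_ge0 ?invr_ge0// ltW.
have A1 : 1 <= A by rewrite lerDl.
have A2 : 6 * M * K / e <= A ^+ 2.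
  by rewrite expr2; apply: (@le_trans _ _ A); [rewrite lerDr|rewrite ler_peMr// (le_trans ler01)].
have [eta eta0 hg] := heine_cantor A cg e3.
have M121 : 0 < 12 * M + 1 by rewrite ltr_wpDl// mulr_ge0.
exists (Num.min 1 (e / 3 * eta ^+ 2 / (12 * M + 1))).
  by rewrite lt_min ltr01/= divr_gt0// mulr_gt0 ?exprn_gt0.
move=> t t0; rewrite le_min => /andP[t1 te].
have te' : 12 * M * t ^+ 2 / eta ^+ 2 <= e / 3.
  rewrite ler_pdivrMr ?exprn_gt0//; apply: (@le_trans _ _ ((12 * M + 1) * t)).
    have : t ^+ 2 <= t by rewrite expr2 ler_piMr// ltW.
    by move=> /(ler_wpM2l M0); lra.
  by rewrite mulrC -ler_pdivlMr.
have loc x : `|x| <= A -> `|smooth t g x - g x| <= e / 3 + e / 3.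
  move=> xA; have := smooth_dist t0 eta0 (ltW e3) M0 mg gM (x := x) (fun y => hg x y xA).
  by lra.
have A20 : 0 < A ^+ 2 by rewrite exprn_gt0// (lt_le_trans ltr01).
have MA0 : 0 <= 2 * M / A ^+ 2 := divr_ge0 (mulr_ge0 (ler0n R 2) M0) (ltW A20).
have glob x : `|smooth t g x - g x| <= 2 * (e / 3) + 2 * M / A ^+ 2 * x ^+ 2.
  have [xA|xA] := leP `|x| A.
    have := loc _ xA; have : 0 <= 2 * M / A ^+ 2 * x ^+ 2.
      by rewrite mulr_ge0 ?sqr_ge0.
    by lra.
  have x2 : 1 <= x ^+ 2 / A ^+ 2.
    rewrite ler_pdivlMr// mul1r -(@real_normK _ x) ?num_real// lerXn2r ?nnegrE ?(ltW xA)//.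
    exact: le_trans ler01 A1.
  have := @smooth_dist R t eta (2 * M) M g x t0 eta0 (mulr_ge0 (ler0n _ 2) M0) M0 mg gM.
  have g2 y : `|y - x| <= eta -> `|g y - g x| <= 2 * M.
    by move=> _; rewrite (le_trans (ler_normB _ _))//; have := gM x; have := gM y; lra.
  move=> /(_ g2); have := ler_wpM2l (mulr_ge0 (ler0n R 2) M0) x2.
  by lra.
split=> [n|]; last first.
  by have := loc 0; rewrite normr0 => /(_ (le_trans ler01 A1)); lra.
have is_ := integrable_smooth n t0 mg M0 gM.
have ig : P.-integrable setT (EFin \o (fun w => g (X n w))).
  apply: (@bounded_moments_integrable _ _ _ _ unit (fun _ w => g (X n w)) tt).
  apply: (@bounded_moments_bounded _ _ _ _ _ _ M) => // _.
  exact: (measurableT_comp mg).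
have [iX2 X2K] := X2 n.
have ib : P.-integrable setT (EFin \o (fun w => 2 * (e / 3) + 2 * M / A ^+ 2 * X n w ^+ 2)).
  have := integrableD measurableT (finite_measure_integrable_cst P (2 * (e / 3)) measurableT)
    (integrableZl measurableT (2 * M / A ^+ 2) iX2).
  exact: eq_integrable.
rewrite -RintegralB//; apply: (le_trans (le_normr_Rintegral _ _)) => //.
  by have := integrableB measurableT is_ ig; apply: eq_integrable.
apply: (@le_trans _ _ (\int[P]_w (2 * (e / 3) + 2 * M / A ^+ 2 * X n w ^+ 2))).
  apply: le_Rintegral => //.
  by apply: integrable_norm; have := integrableB measurableT is_ ig; apply: eq_integrable.
rewrite RintegralD//; last 2 first.
- exact: finite_measure_integrable_cst.
- exact: (integrableZl measurableT _ iX2).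
rewrite [X in X + _](_ : _ = 2 * (e / 3)); last by rewrite /Rintegral integral_prob_cst.
rewrite RintegralZl//.
have : 2 * M / A ^+ 2 * \int[P]_w X n w ^+ 2 <= e / 3.
  apply: (@le_trans _ _ (2 * M / A ^+ 2 * K)).
    by rewrite ler_wpM2l.
  rewrite mulrAC ler_pdivrMr//; move: A2; rewrite ler_pdivrMr//; lra.
by lra.
Qed.

Let limit_value (g : R -> R) : R := if s == 0 then g 0 else \int[mu]_a (g a * normal_pdf 0 s a).

(** For [s = 0] the integral is the smoothing of [g] at the point [0], already shown close to [g 0].
    For [s > 0] the densities converge pointwise, since [heat] is Lipschitz in time above [s^2], and
    Scheffe's argument applies. *)
Let smooth_limit (g : R -> R) (M : R) : continuous g -> 0 <= M -> (forall y, `|g y| <= M) ->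
  \int[mu]_a (g a * normal_pdf 0 (limit_sd k.+1%:R^-1) a) @[k --> \oo] --> limit_value g.
Proof.
move=> cg M0 gM; have mg : measurable_fun setT g by exact: continuous_measurable_fun.
have inv_cvg : k.+1%:R^-1 @[k --> \oo] --> (0 : R) by exact: cvg_harmonic.
have kpos k : 0 < k.+1%:R^-1 :> R by rewrite invr_gt0.
rewrite /limit_value; case: eqVneq => [s00|sn0].
  apply/cvgrPdist_le => e e0.
  have [t0 t00 ht] := smooth_approx cg M0 gM e0.
  have /cvgrPdist_le/(_ _ t00) hk := inv_cvg.
  near=> k; rewrite distrC.
  have -> : limit_sd k.+1%:R^-1 = k.+1%:R^-1.
    by rewrite /limit_sd s00 expr0n addr0 sqrtr_sqr ger0_norm// ltW.
  apply: (ht _ (kpos k) _).2.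
  have : `|0 - k.+1%:R^-1| <= t0 by near: k; exact: hk.
  by rewrite sub0r normrN ger0_norm// ltW.
have s_gt0 : 0 < s by rewrite lt_neqAle eq_sym sn0.
apply: (@scheffe _ (measurableTypeR R) R mu (fun k => normal_pdf 0 (limit_sd k.+1%:R^-1)) _ g M) => //.
- by move=> k; exact: measurable_normal_pdf.
- by move=> k a; exact: normal_pdf_ge0.
- by move=> k; exact: integral_normal_pdf.
- exact: measurable_normal_pdf.
- by move=> a; exact: normal_pdf_ge0.
- exact: integral_normal_pdf.
move=> a; under eq_fun do rewrite normal_pdf_heat ?limit_sd_gt0// limit_sdK.
rewrite normal_pdf_heat//; apply: cvgMr.
have s20 : 0 < s ^+ 2 by rewrite exprn_gt0.
have [B B0 hB] := heat_dist_w s20.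
apply/cvgrPdist_le => e e0.
have eB : 0 < e / (B + 1) by rewrite divr_gt0// ltr_wpDl.
have /cvgrPdist_le/(_ _ eB) hk := inv_cvg.
near=> k; rewrite distrC; apply: (le_trans (hB _ _ _ _ _)) => //.
  by rewrite lerDr exprn_ge0// ltW.
have k0 : 0 <= k.+1%:R^-1 :> R := ltW (kpos k).
rewrite addrK ger0_norm ?exprn_ge0//.
have : `|0 - k.+1%:R^-1| <= e / (B + 1) by near: k; exact: hk.
rewrite sub0r normrN ger0_norm// ler_pdivlMr ?ltr_wpDl// => h.
have k1 : k.+1%:R^-1 ^+ 2 <= k.+1%:R^-1 :> R.
  by rewrite expr2 ler_piMr// invf_le1 ?ler1n.
by move: (k.+1%:R^-1 : R) k0 h k1 => v v0 h k1; have := ler_wpM2l B0 k1; lra.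
Unshelve. all: by end_near. Qed.

(** The width of the smoothing is fixed before [n], which is possible because the smoothing error is
    uniform in [n]; for a fixed width the convergence is that of the densities [p_]. *)
Lemma cvg_dist_normal_heat : cvg_dist_normal P X s.
Proof.
move=> g cg [M0 gM0]; pose M : R := `|M0|.
have M_ge0 : 0 <= M := normr_ge0 _.
have gM y : `|g y| <= M := le_trans (gM0 y) (ler_norm _).
have mg : measurable_fun setT g by exact: continuous_measurable_fun.
have ig n : P.-integrable setT (EFin \o (fun w => g (X n w))).
  apply: (@bounded_moments_integrable _ _ _ _ unit (fun _ w => g (X n w)) tt).
  apply: (@bounded_moments_bounded _ _ _ _ _ _ M) => // _.
  exact: (measurableT_comp mg).
have -> : normal_expect s g = (limit_value g)%:E.
  rewrite /normal_expect /limit_value; case: ifP => // _.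
  rewrite /Rintegral fineK//; apply: integrable_fin_num => //.
  exact: (@integrable_bounded_density _ (measurableTypeR R) R mu _ _ _ mg gM
    (@integrable_normal_pdf R 0 s)).
have -> : (fun n => \int[P]_w (g (X n w))%:E)%E = EFin \o (fun n => \int[P]_w g (X n w)).
  by apply/funext => n; rewrite /= /Rintegral fineK//; exact: integrable_fin_num (ig n).
apply: cvg_EFin; first exact: nearW.
apply/cvgrPdist_le => e e0; have e3 : 0 < e / 3 by rewrite divr_gt0.
have [t0 t00 ht] := smooth_approx cg M_ge0 gM e3.
have /cvgrPdist_le/(_ _ e3) hlim := smooth_limit cg M_ge0 gM.
have inv_cvg : k.+1%:R^-1 @[k --> \oo] --> (0 : R) by exact: cvg_harmonic.
have /cvgrPdist_le/(_ _ t00) hk := inv_cvg.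
near \oo => k; have kpos : 0 < k.+1%:R^-1 :> R by rewrite invr_gt0.
have kt0 : k.+1%:R^-1 <= t0.
  have : `|0 - k.+1%:R^-1| <= t0 by near: k; exact: hk.
  by rewrite sub0r normrN ger0_norm// ltW.
have h2 : `|limit_value g - \int[mu]_a (g a * normal_pdf 0 (limit_sd k.+1%:R^-1) a)| <= e / 3.
  by near: k; exact: hlim.
have /cvgrPdist_le/(_ _ e3) hsm := smooth_cvg kpos mg M_ge0 gM.
near=> n; have h1 := (ht _ kpos kt0).1 n.
have h3 : `|\int[mu]_a (g a * normal_pdf 0 (limit_sd k.+1%:R^-1) a) -
   \int[P]_w smooth k.+1%:R^-1 g (X n w)| <= e / 3.
  by near: n; exact: hsm.
set a := limit_value g in h2 *; set b := (\int[mu]_a _) in h2 h3 *.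
set c := \int[P]_w smooth _ _ _ in h1 h3 *; set z := \int[P]_w _ in h1 *.
have := ler_distD b a z; have := ler_distD c b z; lra.
Unshelve. all: by end_near. Qed.

End weak_convergence.

(** * Moments given the past *)

Section expectation.
Context {R : realType} {d : measure_display} {T : measurableType d}
  {P : probability T R}.

Definition all_moments (X : T -> R) := bounded_moments (P := P) (fun _ : unit => X).

Lemma bounded_moments_at (I : Type) (X : I -> T -> R) i :
  bounded_moments (P := P) X -> all_moments (X i).
Proof. exact: (bounded_moments_comp (fun _ : unit => i)). Qed.

Lemma all_moments_cst (c : R) : all_moments (fun=> c).
Proof. exact: bounded_moments_cst. Qed.

Lemma all_momentsD X Y : all_moments X -> all_moments Y ->
  all_moments (fun w => X w + Y w).
Proof. exact: bounded_momentsD. Qed.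

Lemma all_momentsB X Y : all_moments X -> all_moments Y ->
  all_moments (fun w => X w - Y w).
Proof. exact: bounded_momentsB. Qed.

Lemma all_momentsM X Y : all_moments X -> all_moments Y ->
  all_moments (fun w => X w * Y w).
Proof. exact: bounded_momentsM. Qed.

Lemma all_momentsN X : all_moments X -> all_moments (fun w => - X w).
Proof. exact: bounded_momentsN. Qed.

Lemma all_momentsX X n : all_moments X -> all_moments (fun w => X w ^+ n).
Proof. exact: bounded_momentsX. Qed.

Lemma all_moments_norm X : all_moments X -> all_moments (fun w => `|X w|).
Proof. exact: bounded_moments_norm. Qed.

Lemma all_momentsZ (c : R) X : all_moments X -> all_moments (fun w => c * X w).
Proof. by apply: all_momentsM; exact: all_moments_cst. Qed.

Lemma all_moments_integrable X : all_moments X -> P.-integrable setT (EFin \o X).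
Proof. exact: (bounded_moments_integrable (X := fun _ : unit => X) tt). Qed.

Lemma RintegralD_moments X Y : all_moments X -> all_moments Y ->
  \int[P]_w (X w + Y w) = \int[P]_w X w + \int[P]_w Y w.
Proof. by move=> /all_moments_integrable iX /all_moments_integrable iY; exact: RintegralD. Qed.

Lemma RintegralB_moments X Y : all_moments X -> all_moments Y ->
  \int[P]_w (X w - Y w) = \int[P]_w X w - \int[P]_w Y w.
Proof. by move=> /all_moments_integrable iX /all_moments_integrable iY; exact: RintegralB. Qed.

Lemma RintegralZ_moments X (c : R) : all_moments X ->
  \int[P]_w (c * X w) = c * \int[P]_w X w.
Proof. by move=> /all_moments_integrable iX; exact: RintegralZl. Qed.

Lemma le_Rintegral_moments X Y : all_moments X -> all_moments Y ->
  (forall w, X w <= Y w) -> \int[P]_w X w <= \int[P]_w Y w.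
Proof.
by move=> /all_moments_integrable iX /all_moments_integrable iY XY; exact: le_Rintegral.
Qed.

Lemma norm_Rintegral_moments X : all_moments X ->
  `|\int[P]_w X w| <= \int[P]_w `|X w|.
Proof. by move=> /all_moments_integrable iX; exact: le_normr_Rintegral. Qed.

Lemma Rintegral_prob_cst (c : R) : \int[P]_w c = c.
Proof. by rewrite /Rintegral integral_prob_cst. Qed.

Lemma Rintegral_sum_moments n (X : nat -> T -> R) : (forall k, all_moments (X k)) ->
  \int[P]_w (\sum_(k < n) X k w) = \sum_(k < n) \int[P]_w X k w.
Proof.
move=> mX; elim: n => [|n ih].
  under eq_Rintegral do rewrite big_ord0.
  by rewrite big_ord0 Rintegral_prob_cst.
under eq_Rintegral do rewrite big_ord_recr/=.
rewrite big_ord_recr/= RintegralD_moments ?ih//.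
exact: (@bounded_moments_sum _ _ _ P unit 'I_n _ (fun k _ => X k) (fun k => mX k)).
Qed.

Lemma all_moments_sum (J : Type) (s : seq J) (X : J -> T -> R) :
  (forall j, all_moments (X j)) -> all_moments (fun w => \sum_(j <- s) X j w).
Proof. move=> mX; exact: (@bounded_moments_sum _ _ _ P unit J _ (fun k _ => X k) mX). Qed.

(** From [|x| <= e + x^2 / e]. It plays the part of the Cauchy-Schwarz inequality, with [e] left
    free so that sums of such bounds can be balanced. *)
Lemma Rintegral_norm_le_sqr X (e : R) : all_moments X -> 0 < e ->
  \int[P]_w `|X w| <= e + (\int[P]_w X w ^+ 2) / e.
Proof.
move=> mX e0; have mX2 : all_moments (fun w => X w ^+ 2) by exact: all_momentsX.
have mc (c : R) : all_moments (fun=> c) by exact: all_moments_cst.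
have me : all_moments (fun w => e^-1 * X w ^+ 2) by exact: all_momentsZ.
rewrite mulrC -RintegralZ_moments// -[X in X + _]Rintegral_prob_cst -RintegralD_moments//.
apply: le_Rintegral_moments.
- exact: all_moments_norm.
- exact: all_momentsD.
- move=> w; have [h|/ltW h] := leP `|X w| e.
    by rewrite (le_trans h)// lerDl mulr_ge0 ?sqr_ge0// invr_ge0 ltW.
  rewrite (@le_trans _ _ (e^-1 * X w ^+ 2))//; last by rewrite lerDr ltW.
  by rewrite mulrC ler_pdivlMr// -[X w ^+ 2]real_normK ?num_real// expr2 ler_wpM2l.
Qed.

End expectation.

Lemma natr_ffactS (R : pzRingType) (n j : nat) :
  (n ^_ j.+1)%:R = (n ^_ j)%:R * (n%:R - j%:R) :> R.
Proof.
rewrite ffactnSr natrM; have [jn|nj] := leqP j n; first by rewrite natrB.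
by rewrite ffact_small// !mul0r.
Qed.

Section conditional_moments.
Context {R : realType} {d : measure_display} {T : measurableType d}
  {P : probability T R} {f0 : R -> nat -> R} {k1 k2 : R}
  {N : int -> T -> nat} {lam : int -> T -> R}.
Hypothesis H : poisson_autoregression P f0 k1 k2 N lam.
Local Notation all_moments := (all_moments (P := P)).

Lemma all_moments_lam t : all_moments (lam t).
Proof. exact: (bounded_moments_at t (bounded_moments_lam H)). Qed.

Lemma all_moments_N t : all_moments (fun w => (N t w)%:R).
Proof. exact: (bounded_moments_at t (bounded_moments_N H)). Qed.

Lemma all_moments_ffact t j : all_moments (fun w => (N t w ^_ j)%:R).
Proof.
elim: j => [|j ih]; first exact: all_moments_cst.
under eq_fun do rewrite natr_ffactS.
apply: all_momentsM => //; apply: all_momentsB; first exact: all_moments_N.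
exact: all_moments_cst.
Qed.

Lemma Rintegral_cond_ffact t j (Y : T -> R) : adapted N lam t Y -> all_moments Y ->
  \int[P]_w (Y w * (N (t + 1) w ^_ j)%:R) = \int[P]_w (Y w * lam (t + 1) w ^+ j).
Proof.
move=> aY mY.
have pos (Z : T -> R) : adapted N lam t Z -> all_moments Z -> (forall w, 0 <= Z w) ->
    \int[P]_w (Z w * (N (t + 1) w ^_ j)%:R) = \int[P]_w (Z w * lam (t + 1) w ^+ j).
  by move=> aZ mZ Z0; rewrite /Rintegral (integral_cond_ffact H).
have ac (c : R) : adapted N lam t (fun=> c) by exact: measurable_cst.
have aN : adapted N lam t (fun w => - Y w) by exact: measurableT_comp.
have part (Z : T -> R) : adapted N lam t Z -> all_moments Z ->
   adapted N lam t (fun w => Num.max (Z w) 0) /\ all_moments (fun w => Num.max (Z w) 0).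
  move=> aZ mZ; have aM : adapted N lam t (fun w => Num.max (Z w) 0) by exact: measurable_maxr.
  split=> //; apply: bounded_moments_le mZ => [_|_ w]; first exact: (adapted_measurable H aM).
  by rewrite ger0_norm ?le_max ?lexx ?orbT// ge_max ler_norm normr_ge0.
have [ap mp] := part Y aY mY.
have [an mn] := part _ aN (all_momentsN mY).
have YE w : Y w = Num.max (Y w) 0 - Num.max (- Y w) 0.
  by rewrite /Num.max; case: ltP => ?; case: ltP => ?; lra.
have mM (Z V : T -> R) : all_moments Z -> all_moments V -> all_moments (fun w => Z w * V w).
  exact: all_momentsM.
have mf := all_moments_ffact (t + 1) j.
have ml : all_moments (fun w => lam (t + 1) w ^+ j).
  by apply: all_momentsX; exact: all_moments_lam.
under eq_Rintegral do rewrite YE mulrBl.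
under [RHS]eq_Rintegral do rewrite YE mulrBl.
rewrite !RintegralB_moments ?pos//; try exact: mM.
- by move=> w; rewrite le_max lexx orbT.
- by move=> w; rewrite le_max lexx orbT.
Qed.

Lemma Rintegral_cond_poly t m (Y : nat -> T -> R) :
  (forall j, adapted N lam t (Y j)) -> (forall j, all_moments (Y j)) ->
  \int[P]_w (\sum_(j < m) Y j w * (N (t + 1) w ^_ j)%:R) =
  \int[P]_w (\sum_(j < m) Y j w * lam (t + 1) w ^+ j).
Proof.
move=> aY mY.
rewrite (@Rintegral_sum_moments _ _ _ _ m (fun j w => Y j w * (N (t + 1) w ^_ j)%:R)); last first.
  by move=> j; apply: all_momentsM => //; exact: all_moments_ffact.
rewrite (@Rintegral_sum_moments _ _ _ _ m (fun j w => Y j w * lam (t + 1) w ^+ j)); last first.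
  by move=> j; apply: all_momentsM => //; apply: all_momentsX; exact: all_moments_lam.
by apply: eq_bigr => j _; rewrite Rintegral_cond_ffact.
Qed.

Definition innov t w : R := (N t w)%:R - lam t w.
Definition xi t w : R := innov t w ^+ 2 - (N t w)%:R.

Lemma bounded_moments_innov : bounded_moments (P := P) innov.
Proof. by apply: bounded_momentsB; [exact: bounded_moments_N H|exact: bounded_moments_lam H]. Qed.

Lemma bounded_moments_xi : bounded_moments (P := P) xi.
Proof.
apply: bounded_momentsB; last exact: bounded_moments_N H.
by apply: bounded_momentsX; exact: bounded_moments_innov.
Qed.

Section with_past.
Variables (t : int) (Y : T -> R).
Hypotheses (aY : adapted N lam t Y) (mY : all_moments Y).
Let al : adapted N lam t (lam (t + 1)) := adapted_lamS H (lexx _).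
Let ml := all_moments_lam (t + 1).

(** A polynomial in the next count and intensity is encoded by lists: the [j]-th list holds the
    coefficients, in powers of [lam (t + 1)], of the falling factorial of order [j]. Conditioning
    turns that factorial into [lam (t + 1)^j], so each conditional moment becomes a polynomial
    identity. *)
Let coef (s : seq (seq R)) (j : nat) (w : T) : R :=
  Y w * foldr (fun c acc => c + lam (t + 1) w * acc) 0 (nth [::] s j).

Let adapted_coef s j : adapted N lam t (coef s j).
Proof.
apply: measurable_funM => //; elim: (nth _ _ _) => [|c l ih] /=; first exact: measurable_cst.
by apply: measurable_funD => //; exact: measurable_funM.
Qed.

Let moments_coef s j : all_moments (coef s j).
Proof.
apply: all_momentsM => //; elim: (nth _ _ _) => [|c l ih] /=; first exact: all_moments_cst.
by apply: all_momentsD; [exact: all_moments_cst|exact: all_momentsM].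
Qed.

Let ffactE (n : nat) : ((n ^_ 0)%:R = 1 :> R) * ((n ^_ 1)%:R = n%:R :> R) *
  ((n ^_ 2)%:R = n%:R * (n%:R - 1) :> R) *
  ((n ^_ 3)%:R = n%:R * (n%:R - 1) * (n%:R - 2) :> R) *
  ((n ^_ 4)%:R = n%:R * (n%:R - 1) * (n%:R - 2) * (n%:R - 3) :> R).
Proof. by rewrite !natr_ffactS ffactn0 mul1r subr0. Qed.

Let cond_poly s (Z V : T -> R) :
  (forall w, Y w * Z w = \sum_(j < size s) coef s j w * (N (t + 1) w ^_ j)%:R) ->
  (forall w, Y w * V w = \sum_(j < size s) coef s j w * lam (t + 1) w ^+ j) ->
  \int[P]_w (Y w * Z w) = \int[P]_w (Y w * V w).
Proof.
move=> ZE VE; under eq_Rintegral do rewrite ZE.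
by rewrite Rintegral_cond_poly//; under eq_Rintegral do rewrite -VE.
Qed.

Lemma Rintegral_innov : \int[P]_w (Y w * innov (t + 1) w) = 0.
Proof.
rewrite (@cond_poly [:: [:: 0; -1]; [:: 1]] _ (fun=> 0)).
- by under eq_Rintegral do rewrite mulr0; rewrite Rintegral_prob_cst.
- by move=> w; rewrite !big_ord_recr big_ord0 /coef/= !ffactE /innov; ring.
- by move=> w; rewrite !big_ord_recr big_ord0 /coef/=; ring.
Qed.

Lemma Rintegral_innov2 :
  \int[P]_w (Y w * innov (t + 1) w ^+ 2) = \int[P]_w (Y w * lam (t + 1) w).
Proof.
apply: (@cond_poly [:: [:: 0; 0; 1]; [:: 1; -2]; [:: 1]]) => w;
by rewrite !big_ord_recr big_ord0 /coef/= ?ffactE /innov; ring.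
Qed.

Lemma Rintegral_xi : \int[P]_w (Y w * xi (t + 1) w) = 0.
Proof.
rewrite (@cond_poly [:: [:: 0; 0; 1]; [:: 0; -2]; [:: 1]] _ (fun=> 0)).
- by under eq_Rintegral do rewrite mulr0; rewrite Rintegral_prob_cst.
- by move=> w; rewrite !big_ord_recr big_ord0 /coef/= !ffactE /xi /innov; ring.
- by move=> w; rewrite !big_ord_recr big_ord0 /coef/=; ring.
Qed.

Lemma Rintegral_xi2 :
  \int[P]_w (Y w * xi (t + 1) w ^+ 2) = \int[P]_w (Y w * (2 * lam (t + 1) w ^+ 2)).
Proof.
(* These lists expand [xi^2] in falling factorials of the count; once these become powers of the
   intensity, only [2 lam^2] survives. *)
apply: (@cond_poly [:: [:: 0; 0; 0; 0; 1]; [:: 0; 0; 4; -4]; [:: 2; -8; 6]; [:: 4; -4]; [:: 1]]) => w;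
by rewrite !big_ord_recr big_ord0 /coef/= ?ffactE /xi /innov; ring.
Qed.

End with_past.
End conditional_moments.

(** * Law of large numbers *)

Lemma sum_geometric_le (R : realFieldType) (x : R) n : 0 <= x -> x < 1 ->
  \sum_(k < n) x ^+ (n - k) <= x / (1 - x).
Proof.
move=> x0 x1; have x1' : 0 < 1 - x by rewrite subr_gt0.
elim: n => [|n ih]; first by rewrite big_ord0 divr_ge0// ltW.
rewrite big_ord_recr/= subSnn expr1.
under eq_bigr => k _ do rewrite subSn ?(ltnW (ltn_ord k))// exprS.
rewrite -mulr_sumr; apply: (@le_trans _ _ (x * (x / (1 - x)) + x)).
  by rewrite lerD2r ler_wpM2l.
rewrite le_eqVlt; apply/orP; left; apply/eqP; field.
by rewrite gt_eqF.
Qed.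

Lemma lipschitz_continuous (R : realType) (K : R) (h : R -> R) :
  (forall x y, `|h x - h y| <= K * `|x - y|) -> continuous h.
Proof.
move=> hK x; apply/cvgrPdist_le => e e0; near=> y.
have K1 : 0 < `|K| + 1 by rewrite ltr_wpDl.
apply: (le_trans (hK x y)).
have : `|x - y| <= e / (`|K| + 1).
  by near: y; apply: cvgr_dist_le; [exact: cvg_id|rewrite divr_gt0].
rewrite ler_pdivlMr//; have := ler_norm K; have := normr_ge0 (x - y); nra.
Unshelve. all: by end_near. Qed.

Section law_of_large_numbers.
Context {R : realType} {d : measure_display} {T : measurableType d}
  {P : probability T R} {f0 : R -> nat -> R} {k1 k2 : R}
  {N : int -> T -> nat} {lam : int -> T -> R}.
Hypothesis H : poisson_autoregression P f0 k1 k2 N lam.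
Local Notation all_moments := (all_moments (P := P)).

(* The transition operator of the Markov chain [lam], extended to the whole line. *)
Definition transition (h : R -> R) (l : R) : R :=
  pois_mean (fun k => h (f0 (Num.max l 0) k)) (Num.max l 0).

Let max0 (x : R) : 0 <= Num.max x 0. Proof. by rewrite le_max lexx orbT. Qed.
Let k10 := k1_ge0 H.
Let k20 := k2_ge0 H.
Let k12 := k12_lt1 H.

Lemma transition_range (h : R -> R) (B : R) : (forall x, 0 <= h x <= B) ->
  forall l, 0 <= transition h l <= B.
Proof.
move=> hB l; apply/andP; split.
  rewrite -lee_fin /transition -(nneseries_pois_mean (B := B))//.
  apply: nneseries_ge0 => k _ _; rewrite lee_fin mulr_ge0 ?pois_pmf_ge0//.
  by have /andP[] := hB (f0 (Num.max l 0) k).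
apply: le_trans (ler_norm _) _; apply: le_norm_pois_mean => // k.
by have /andP[? ?] := hB (f0 (Num.max l 0) k); rewrite ger0_norm.
Qed.

(** Changing the state inside [f0] costs [k1]. Changing the Poisson parameter costs the Lipschitz
    constant of [f0] in the count, [k2]. *)
Lemma transition_lipschitz (h : R -> R) (B K : R) : (forall x, 0 <= h x <= B) -> 0 <= K ->
  (forall x y, `|h x - h y| <= K * `|x - y|) ->
  forall x y, `|transition h x - transition h y| <= (k1 + k2) * K * `|x - y|.
Proof.
move=> hB K0 hK x y; rewrite /transition.
set a := Num.max x 0; set b := Num.max y 0.
have a0 : 0 <= a := max0 x; have b0 : 0 <= b := max0 y.
have hB' u k : `|h (f0 u k)| <= B.
  by have /andP[? ?] := hB (f0 u k); rewrite ger0_norm.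
apply: (@le_trans _ _ ((k1 + k2) * K * `|a - b|)); last first.
  by rewrite ler_wpM2l ?mulr_ge0 ?addr_ge0//; exact: max0_lipschitz.
apply: (le_trans (ler_distD (pois_mean (fun k => h (f0 b k)) a) _ _)).
rewrite !mulrDl; apply: lerD.
  rewrite (pois_meanB a (hB' a) (hB' b)); apply: le_norm_pois_mean => // k.
  apply: (le_trans (hK _ _)).
  rewrite (_ : k1 * K * _ = K * (k1 * `|a - b|)); last by ring.
  rewrite ler_wpM2l//.
  by have := f0_lipschitz H k k a0 b0; rewrite subrr normr0 mulr0 addr0.
apply: (pois_mean_lipschitz a0 b0 (hB' b)) => k.
apply: (le_trans (hK _ _)); rewrite mulrC ler_wpM2r//.
have := f0_lipschitz H k.+1 k b0 b0.
by rewrite subrr normr0 mulr0 add0r -natr1 [_ + 1 - _]addrAC subrr add0r normr1 mulr1.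
Qed.

Lemma iter_transition_range (h : R -> R) (B : R) m : (forall x, 0 <= h x <= B) ->
  forall l, 0 <= iter m transition h l <= B.
Proof. by elim: m => // m ih hB; apply: transition_range; exact: ih. Qed.

Lemma iter_transition_lipschitz (h : R -> R) (B K : R) m : (forall x, 0 <= h x <= B) -> 0 <= K ->
  (forall x y, `|h x - h y| <= K * `|x - y|) ->
  forall x y, `|iter m transition h x - iter m transition h y|
    <= (k1 + k2) ^+ m * K * `|x - y|.
Proof.
move=> hB K0 hK; elim: m => [|m ih] x y; first by rewrite expr0 mul1r.
rewrite !iterS exprS -[_ * _ * K]mulrA; apply: (@transition_lipschitz _ B) => //.
- exact: iter_transition_range.
- by rewrite mulr_ge0// exprn_ge0// addr_ge0.
Qed.

Let integral_transition1 t (Y : T -> R) (h : R -> R) (B K : R) :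
  (forall w, 0 <= Y w) -> adapted N lam t Y ->
  (forall x, 0 <= h x <= B) -> (forall x y, `|h x - h y| <= K * `|x - y|) ->
  (\int[P]_w (Y w * h (lam (t + 1 + 1) w))%:E =
   \int[P]_w (Y w * transition h (lam (t + 1) w))%:E)%E.
Proof.
move=> Y0 aY hB hK.
have lamE w : Num.max (lam (t + 1) w) 0 = lam (t + 1) w.
  by apply/max_idPl; exact: (lam_ge0 H).
under [RHS]eq_integral do rewrite /transition lamE.
under [LHS]eq_integral do rewrite (lamS H).
apply: (@integral_cond_pois_mean _ _ _ _ _ _ _ _ _ H t Y
  (fun k w => h (f0 (lam (t + 1) w) k)) B Y0 aY (fun k w => hB _)) => k.
under eq_fun do rewrite -lamE.
apply: (measurableT_comp (f := h)).
  by apply: continuous_measurable_fun; exact: lipschitz_continuous hK.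
apply: (measurableT_comp (f := fun l : R => f0 (Num.max l 0) k)).
  by apply: continuous_measurable_fun; exact: (f0_continuous H).
exact: (adapted_lamS H).
Qed.

Let integral_iter t m (Y : T -> R) (h : R -> R) (B K : R) :
  (forall w, 0 <= Y w) -> adapted N lam t Y -> 0 <= K ->
  (forall x, 0 <= h x <= B) -> (forall x y, `|h x - h y| <= K * `|x - y|) ->
  (\int[P]_w (Y w * h (lam (t + 1 + m%:Z) w))%:E =
   \int[P]_w (Y w * iter m transition h (lam (t + 1) w))%:E)%E.
Proof.
move=> Y0 aY; elim: m h K => [|m ih] h K K0 hB hK; first by rewrite addr0.
rewrite (_ : t + 1 + m.+1%:Z = t + m%:Z + 1 + 1); last by lia.
have aY' : adapted N lam (t + m%:Z) Y by apply: adapted_le aY; lia.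
rewrite (@integral_transition1 (t + m%:Z) Y h B K Y0 aY' hB hK).
rewrite (_ : t + m%:Z + 1 = t + 1 + m%:Z); last by lia.
rewrite (ih _ ((k1 + k2) * K)) ?iterSr//.
- by rewrite mulr_ge0 ?addr_ge0.
- exact: transition_range.
- exact: (@transition_lipschitz _ B).
Qed.

Section bounded_lipschitz.
Variables (h : R -> R) (B K : R).
Hypotheses (hB : forall x, 0 <= h x <= B) (K0 : 0 <= K)
  (hK : forall x y, `|h x - h y| <= K * `|x - y|).
Let mean := \int[P]_w h (lam 1 w).

Let B0 : 0 <= B. Proof. by have /andP[h0 hb] := hB 0; exact: le_trans hb. Qed.
Let mh : measurable_fun setT h.
Proof. by apply: continuous_measurable_fun; exact: lipschitz_continuous hK. Qed.

Let moments_bounded (g : R -> R) s : measurable_fun setT g -> (forall x, 0 <= g x <= B) ->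
  all_moments (fun w => g (lam s w)).
Proof.
move=> mg gB; apply: (@bounded_moments_bounded _ _ _ _ _ _ B) => [_|_ w].
  by apply: measurableT_comp => //; exact: (lam_measurable H).
by have /andP[? ?] := gB (lam s w); rewrite ger0_norm.
Qed.

Let meanE s : \int[P]_w h (lam s w) = mean.
Proof.
rewrite /mean /Rintegral (ge0_integral_lam H s 1 (phi := h))// => x.
by have /andP[] := hB x.
Qed.

(** Conditioning on the past up to [s] replaces [h (lam (s + m))] by [g (lam s)], where [g] is the
    [m]-fold transition of [h]. By contraction [g] is nearly constant: it differs from its mean by
    at most [(k1 + k2)^m K (lam s + L)], where [L] bounds the mean intensity. *)
Lemma covariance_decay : exists2 C : R, 0 <= C & forall s m,
  `|\int[P]_w ((h (lam s w) - mean) * (h (lam (s + m%:Z) w) - mean))|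
    <= C * (k1 + k2) ^+ m.
Proof.
have [L L0 hL] := bounded_moments_Rintegral (bounded_moments_lam H).
exists (B * (2 * K * L)) => [|s m]; first by rewrite !mulr_ge0.
pose g := iter m transition h.
have gB : forall x, 0 <= g x <= B by exact: iter_transition_range.
have gK := @iter_transition_lipschitz h B K m hB K0 hK.
have mg : measurable_fun setT g.
  by apply: continuous_measurable_fun; exact: lipschitz_continuous gK.
have Mh u := moments_bounded u mh hB.
have Mg := moments_bounded s mg gB.
have Mc (c : R) := @all_moments_cst _ _ _ P c.
have iterE (Y : T -> R) : adapted N lam (s - 1) Y -> (forall w, 0 <= Y w) ->
   \int[P]_w (Y w * h (lam (s + m%:Z) w)) = \int[P]_w (Y w * g (lam s w)).
  move=> aY Y0; rewrite /Rintegral; congr fine.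
  by have := @integral_iter (s - 1) m Y h B K Y0 aY K0 hB hK; rewrite subrK.
have Eg : \int[P]_w g (lam s w) = mean.
  have := iterE (fun=> 1) (measurable_cst _) (fun=> ler01).
  under eq_Rintegral do rewrite mul1r.
  by under [RHS]eq_Rintegral do rewrite mul1r; rewrite meanE.
have Ehh : \int[P]_w (h (lam s w) * h (lam (s + m%:Z) w)) =
    \int[P]_w (h (lam s w) * g (lam s w)).
  apply: iterE => [|w]; last by have /andP[] := hB (lam s w).
  by apply: (measurableT_comp mh); apply: (adapted_lamS H); rewrite subrK.
have -> : \int[P]_w ((h (lam s w) - mean) * (h (lam (s + m%:Z) w) - mean)) =
    \int[P]_w (h (lam s w) * (g (lam s w) - mean)).
  transitivity (\int[P]_w (h (lam s w) * h (lam (s + m%:Z) w) -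
      (mean * h (lam s w) + mean * h (lam (s + m%:Z) w) - mean * mean))).
    by apply: eq_Rintegral => w _; ring.
  transitivity (\int[P]_w (h (lam s w) * g (lam s w) - mean * h (lam s w))); last first.
    by apply: eq_Rintegral => w _; ring.
  have M1 := all_momentsM (Mh s) (Mh (s + m%:Z)).
  have M2 := all_momentsZ mean (Mh s).
  have M3 := all_momentsZ mean (Mh (s + m%:Z)).
  rewrite !RintegralB_moments//; last 3 first.
  - exact: all_momentsM.
  - exact: all_momentsD.
  - by apply: all_momentsB => //; exact: all_momentsD.
  rewrite RintegralD_moments// Ehh !RintegralZ_moments// !meanE Rintegral_prob_cst.
  by ring.
have Ml u := all_moments_lam H u.
have dev x : 0 <= x -> `|g x - mean| <= (k1 + k2) ^+ m * K * (x + L).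
  move=> x0; have Mx : all_moments (fun w => g x - g (lam s w)) by exact: all_momentsB.
  have -> : g x - mean = \int[P]_w (g x - g (lam s w)).
    by rewrite RintegralB_moments// Rintegral_prob_cst Eg.
  apply: (le_trans (norm_Rintegral_moments Mx)).
  have c0 : 0 <= (k1 + k2) ^+ m * K by rewrite mulr_ge0// exprn_ge0// addr_ge0.
  apply: (@le_trans _ _ (\int[P]_w ((k1 + k2) ^+ m * K * (x + `|lam s w|)))).
    apply: le_Rintegral_moments.
    - exact: all_moments_norm.
    - by apply: all_momentsZ; apply: all_momentsD => //; exact: all_moments_norm.
    - move=> w; apply: (le_trans (gK _ _)); rewrite ler_wpM2l//.
      by rewrite (le_trans (ler_normB _ _))// ger0_norm.
  rewrite RintegralZ_moments; last by apply: all_momentsD => //; exact: all_moments_norm.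
  rewrite ler_wpM2l// RintegralD_moments//; last exact: all_moments_norm.
  by rewrite Rintegral_prob_cst lerD2l.
have Mhg : all_moments (fun w => h (lam s w) * (g (lam s w) - mean)).
  by apply: all_momentsM => //; exact: all_momentsB.
apply: (le_trans (norm_Rintegral_moments Mhg)).
have c0 : 0 <= B * ((k1 + k2) ^+ m * K) by rewrite !mulr_ge0// exprn_ge0// addr_ge0.
apply: (@le_trans _ _ (\int[P]_w (B * ((k1 + k2) ^+ m * K) * (`|lam s w| + L)))).
  apply: le_Rintegral_moments.
  - exact: all_moments_norm.
  - by apply: all_momentsZ; apply: all_momentsD => //; exact: all_moments_norm.
  - move=> w; rewrite normrM -mulrA ler_pM//.
      by have /andP[? ?] := hB (lam s w); rewrite ger0_norm.
    by rewrite (ger0_norm (lam_ge0 H s w)); apply: dev; exact: (lam_ge0 H).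
rewrite RintegralZ_moments; last by apply: all_momentsD => //; exact: all_moments_norm.
rewrite RintegralD_moments//; last exact: all_moments_norm.
rewrite Rintegral_prob_cst.
rewrite (_ : B * (2 * K * L) * _ = B * ((k1 + k2) ^+ m * K) * (L + L)); last by ring.
by rewrite ler_wpM2l// lerD2r.
Qed.

(** A new summand adds its variance and twice its covariances with all earlier ones, which are
    bounded by a geometric series. *)
Lemma variance_linear : exists2 C : R, 0 <= C & forall n : nat,
  \int[P]_w (\sum_(k < n) (h (lam k.+1%:Z w) - mean)) ^+ 2 <= C * n%:R.
Proof.
have [C C0 hC] := covariance_decay.
have kap0 : 0 <= k1 + k2 by rewrite addr_ge0.
have D0 : 0 <= (k1 + k2) / (1 - (k1 + k2)) by rewrite divr_ge0// subr_ge0 ltW.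
exists (C + 2 * (C * ((k1 + k2) / (1 - (k1 + k2))))).
  exact: addr_ge0 C0 (mulr_ge0 (ler0n R 2) (mulr_ge0 C0 D0)).
pose Z k w := h (lam k.+1%:Z w) - mean.
have MZ k : all_moments (Z k).
  by apply: all_momentsB; [exact: moments_bounded|exact: all_moments_cst].
have MS n : all_moments (fun w => \sum_(k < n) Z k w).
  exact: (@all_moments_sum _ _ _ P 'I_n _ (fun k => Z k) (fun k => MZ k)).
elim=> [|n ih].
  under eq_Rintegral do rewrite big_ord0 expr0n.
  by rewrite Rintegral_prob_cst mulr0.
have -> : \int[P]_w (\sum_(k < n.+1) Z k w) ^+ 2 =
   \int[P]_w (\sum_(k < n) Z k w) ^+ 2 + (2 * (\sum_(k < n) \int[P]_w (Z k w * Z n w)) +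
     \int[P]_w (Z n w * Z n w)).
  rewrite -(@Rintegral_sum_moments _ _ _ P n (fun k w => Z k w * Z n w)); last first.
    by move=> k; exact: all_momentsM.
  have M1 := all_momentsX 2 (MS n).
  have M2 : all_moments (fun w => \sum_(k < n) Z k w * Z n w).
    by apply: (@all_moments_sum _ _ _ P 'I_n _ (fun k w => Z k w * Z n w)) => k; exact: all_momentsM.
  have M3 := all_momentsM (MZ n) (MZ n).
  rewrite -RintegralZ_moments// -RintegralD_moments//; last exact: all_momentsZ.
  rewrite -RintegralD_moments//; last by apply: all_momentsD => //; exact: all_momentsZ.
  apply: eq_Rintegral => w _; rewrite big_ord_recr/= -mulr_suml.
  by ring.
rewrite (_ : n.+1%:R = n%:R + 1 :> R); last by rewrite natr1.
rewrite mulrDr mulr1; apply: lerD; first exact: ih.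
rewrite addrC; apply: lerD.
  by have := hC n.+1%:Z 0%N; rewrite addr0 expr0 mulr1; apply: le_trans; exact: ler_norm.
rewrite ler_wpM2l//; apply: (@le_trans _ _ (\sum_(k < n) C * (k1 + k2) ^+ (n - k))).
  apply: ler_sum => k _; have := hC k.+1%:Z (n - k)%N.
  rewrite (_ : k.+1%:Z + (n - k)%N%:Z = n.+1%:Z); last by rewrite -PoszD addSn subnKC// ltnW.
  by apply: le_trans; exact: ler_norm.
by rewrite -mulr_sumr ler_wpM2l//; exact: sum_geometric_le.
Qed.

End bounded_lipschitz.

Lemma mean_lam_sqr t : \int[P]_w (lam t w ^+ 2) = \int[P]_w (lam 1 w ^+ 2).
Proof.
rewrite /Rintegral (ge0_integral_lam H t 1 (phi := fun x => x ^+ 2))// => x.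
exact: sqr_ge0.
Qed.

(** The square is neither bounded nor Lipschitz, so it is truncated: [h] is the square of the
    intensity clipped to [[0, L]], with Lipschitz constant [2 L]. The error of the truncation is at
    most the third moment divided by [L], uniformly in time. *)
Lemma lln_lam_sqr : \int[P]_w `|n%:R^-1 * \sum_(k < n) lam k.+1%:Z w ^+ 2 -
  \int[P]_w (lam 1 w ^+ 2)| @[n --> \oo] --> (0 : R).
Proof.
set v := \int[P]_w (lam 1 w ^+ 2).
have bl := bounded_moments_lam H.
have [K3 K30 hK3] := bounded_moments_Rintegral (bounded_momentsX 3 bl).
have Ml t := all_moments_lam H t.
have Mc (c : R) := @all_moments_cst _ _ _ P c.
apply/cvgrPdist_le => e e0; have e4 : 0 < e / 4 by rewrite divr_gt0.
pose L := 1 + K3 / (e / 4).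
have KL : K3 / (e / 4) <= L by rewrite lerDr.
have L0 : 0 < L by rewrite ltr_pwDl// divr_ge0// ltW.
have K3L : K3 / L <= e / 4 by rewrite ler_pdivrMr// mulrC -ler_pdivrMr.
pose c (x : R) : R := Num.min (Num.max x 0) L.
have c0 x : 0 <= c x by rewrite /c le_min (ltW L0) le_max lexx orbT.
have cL x : c x <= L by rewrite /c ge_min lexx orbT.
have c_lip x y : `|c x - c y| <= `|x - y|.
  apply: le_trans (max0_lipschitz x y).
  rewrite /c; move: (Num.max x 0) (Num.max y 0) => a b.
  wlog ab : a b / b <= a.
    move=> h; case: (leP b a) => [|/ltW] ?; first exact: h.
    by rewrite distrC [leRHS]distrC h.
  rewrite [leRHS]ger0_norm ?subr_ge0// ger0_norm.
    by rewrite /Num.min; case: ltP => ?; case: ltP => ?; lra.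
  by rewrite subr_ge0 le_min !ge_min ab lexx orbT.
pose h (x : R) := c x ^+ 2.
have hB x : 0 <= h x <= L ^+ 2 by rewrite /h sqr_ge0/= lerXn2r ?nnegrE// ltW.
have L20 : 0 <= 2 * L by rewrite mulr_ge0// ltW.
have hK x y : `|h x - h y| <= 2 * L * `|x - y|.
  rewrite /h subr_sqr normrM mulrC ler_pM// ger0_norm ?addr_ge0//.
  by have := cL x; have := cL y; lra.
have [C C0 hC] := variance_linear hB L20 hK.
set mean := \int[P]_w h (lam 1 w) in hC.
have mh : measurable_fun setT h by apply: continuous_measurable_fun; exact: lipschitz_continuous hK.
have Mh t : all_moments (fun w => h (lam t w)).
  apply: (@bounded_moments_bounded _ _ _ _ _ _ (L ^+ 2)) => [_|_ w].
    by apply: measurableT_comp => //; exact: (lam_measurable H).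
  by have /andP[? ?] := hB (lam t w); rewrite ger0_norm.
have Ml2 t : all_moments (fun w => lam t w ^+ 2) by exact: all_momentsX.
have Mdiff t : all_moments (fun w => `|lam t w ^+ 2 - h (lam t w)|).
  by apply: all_moments_norm; exact: all_momentsB.
have trunc t : \int[P]_w `|lam t w ^+ 2 - h (lam t w)| <= e / 4.
  apply: le_trans K3L; rewrite mulrC.
  apply: (@le_trans _ _ (L^-1 * \int[P]_w `|lam t w ^+ 3|)); last first.
    by rewrite ler_wpM2l// invr_ge0 ltW.
  have M3 : all_moments (fun w => `|lam t w ^+ 3|).
    by apply: all_moments_norm; exact: all_momentsX.
  rewrite -RintegralZ_moments//; apply: le_Rintegral_moments => //.
    exact: all_momentsZ.
  move=> w; have l0 := lam_ge0 H t w.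
  rewrite [`|_ ^+ 3|]ger0_norm ?exprn_ge0// /h /c (max_idPl l0).
  have [lL|Ll] := leP (lam t w) L.
    by rewrite subrr normr0 mulr_ge0 ?exprn_ge0// invr_ge0 ltW.
  have LL : L ^+ 2 <= lam t w ^+ 2 by rewrite lerXn2r ?nnegrE// ltW.
  rewrite ger0_norm ?subr_ge0//; apply: (@le_trans _ _ (lam t w ^+ 2)).
    by rewrite lerBlDr lerDl sqr_ge0.
  rewrite mulrC ler_pdivlMr// [leRHS]exprSr ler_wpM2l ?sqr_ge0//.
  exact: ltW.
have vmean : `|mean - v| <= e / 4.
  rewrite /mean /v -RintegralB_moments//.
  apply: (le_trans (norm_Rintegral_moments (all_momentsB (Mh 1) (Ml2 1)))).
  by under eq_Rintegral do rewrite distrC; exact: trunc.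
have Mdev : forall n, all_moments (fun w => \sum_(k < n) (h (lam k.+1%:Z w) - mean)).
  move=> n; apply: (@all_moments_sum _ _ _ P 'I_n _ (fun k w => h (lam k.+1%:Z w) - mean)) => k.
  exact: all_momentsB.
near=> n.
have n0 : (0 < n)%N by near: n; exact: nbhs_infty_gt.
have nR : 0 < n%:R :> R by rewrite ltr0n.
have nV : 0 <= n%:R^-1 :> R by rewrite invr_ge0.
have nC : C / (e / 4) / (e / 4) <= n%:R.
  by near: n; exact: nbhs_infty_ger.
rewrite sub0r normrN ger0_norm ?Rintegral_ge0//.
pose A w := n%:R^-1 * \sum_(k < n) `|lam k.+1%:Z w ^+ 2 - h (lam k.+1%:Z w)|.
pose D w := n%:R^-1 * \sum_(k < n) (h (lam k.+1%:Z w) - mean).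
have MA : all_moments A.
  apply: all_momentsZ.
  exact: (@all_moments_sum _ _ _ P 'I_n _ (fun k w => `|lam k.+1%:Z w ^+ 2 - h (lam k.+1%:Z w)|)).
have MD : all_moments D by exact: all_momentsZ.
have MDn : all_moments (fun w => `|D w|) by exact: all_moments_norm.
apply: (@le_trans _ _ (\int[P]_w (A w + `|D w| + `|mean - v|))).
  apply: le_Rintegral_moments.
  - apply: all_moments_norm; apply: all_momentsB => //; apply: all_momentsZ.
    exact: (@all_moments_sum _ _ _ P 'I_n _ (fun k w => lam k.+1%:Z w ^+ 2)).
  - by apply: all_momentsD => //; exact: all_momentsD.
  - move=> w.
    have -> : n%:R^-1 * (\sum_(k < n) lam k.+1%:Z w ^+ 2) - v =
       n%:R^-1 * (\sum_(k < n) (lam k.+1%:Z w ^+ 2 - h (lam k.+1%:Z w))) + D w + (mean - v).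
      rewrite /D -mulrDr -big_split/=.
      under [in RHS]eq_bigr do rewrite addrA subrK.
      rewrite sumrB sumr_const card_ord mulrBr -[mean *+ n]mulr_natl mulKf ?gt_eqF//.
      by ring.
    rewrite (le_trans (ler_normD _ _))// lerD2r (le_trans (ler_normD _ _))// lerD2r.
    by rewrite normrM (ger0_norm nV) ler_wpM2l// ler_norm_sum.
rewrite RintegralD_moments//; last exact: all_momentsD.
rewrite RintegralD_moments// Rintegral_prob_cst.
have EA : \int[P]_w A w <= e / 4.
  rewrite /A RintegralZ_moments; last first.
    exact: (@all_moments_sum _ _ _ P 'I_n _ (fun k w => `|lam k.+1%:Z w ^+ 2 - h (lam k.+1%:Z w)|)).
  rewrite (@Rintegral_sum_moments _ _ _ P n (fun k w => `|lam k.+1%:Z w ^+ 2 - h (lam k.+1%:Z w)|))//.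
  rewrite mulrC ler_pdivrMr//.
  apply: (@le_trans _ _ (\sum_(k < n) e / 4)).
    by apply: ler_sum => k _; exact: trunc.
  by rewrite sumr_const card_ord mulr_natr.
have ED : \int[P]_w `|D w| <= e / 4 + e / 4.
  apply: (le_trans (Rintegral_norm_le_sqr MD e4)); rewrite lerD2l.
  rewrite ler_pdivrMr// /D; under eq_Rintegral do rewrite exprMn.
  rewrite RintegralZ_moments; last exact: all_momentsX.
  apply: (@le_trans _ _ (n%:R^-1 ^+ 2 * (C * n%:R))).
    by rewrite ler_wpM2l ?exprn_ge0//; exact: hC.
  rewrite expr2 (_ : _ * _ * _ = C / n%:R * (n%:R / n%:R)); last by ring.
  rewrite divff ?gt_eqF// mulr1 ler_pdivrMr//.
  by move: nC; rewrite ler_pdivrMr// ler_pdivrMr// -mulrA [leRHS]mulrC.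
by lra.
Unshelve. all: by end_near. Qed.

End law_of_large_numbers.

(** * Central limit theorem with the true intensity *)

Lemma cvg_inv_sqrt (R : realType) : (Num.sqrt n%:R)^-1 @[n --> \oo] --> (0 : R).
Proof.
apply/cvgrPdist_le => e e0; near=> n.
rewrite sub0r normrN ger0_norm ?invr_ge0 ?sqrtr_ge0//.
have en : e^-1 ^+ 2 <= n%:R by near: n; exact: nbhs_infty_ger.
have ne : e^-1 <= Num.sqrt n%:R.
  have := ler_wsqrtr en; rewrite sqrtr_sqr ger0_norm// invr_ge0; exact: ltW.
rewrite -[leRHS]invrK lef_pV2 ?posrE ?invr_gt0//.
by apply: lt_le_trans ne; rewrite invr_gt0.
Unshelve. all: by end_near. Qed.

Section measurable_heat.
Context {R : realType} {d : measure_display} {T : measurableType d}.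
Variables (X W : T -> R).
Hypotheses (mX : measurable_fun setT X) (mW : measurable_fun setT W).
Hypothesis W0 : forall w, 0 < W w.

Let mV : measurable_fun setT (fun w => (W w)^-1).
Proof.
rewrite (_ : (fun _ => _) = fun w => expR (- ln (W w))); last first.
  by apply/funext => w; rewrite expRN lnK// posrE.
apply: measurableT_comp => //; apply: measurableT_comp => //.
exact: measurableT_comp.
Qed.

Lemma measurable_heat : measurable_fun setT (fun w => heat (X w) (W w)).
Proof.
apply: measurableT_comp => //; apply: measurable_funB.
  apply: measurableT_comp => //.
  under eq_fun do rewrite invfM; apply: measurable_funM; first exact: measurable_funX.
  exact: measurable_funM.
by apply: measurable_funM => //; exact: measurableT_comp.
Qed.

Lemma measurable_heat_x : measurable_fun setT (fun w => heat_x (X w) (W w)).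
Proof.
apply: measurable_funM; last exact: measurable_heat.
by apply: measurableT_comp => //; exact: measurable_funM.
Qed.

Lemma measurable_heat_xx : measurable_fun setT (fun w => heat_xx (X w) (W w)).
Proof.
apply: measurable_funM; last exact: measurable_heat.
apply: measurable_funB => //; apply: measurable_funM; first exact: measurable_funX.
under eq_fun do rewrite -exprVn.
exact: measurable_funX.
Qed.

End measurable_heat.

Section lindeberg.
Context {R : realType} {d : measure_display} {T : measurableType d}
  {P : probability T R} {f0 : R -> nat -> R} {k1 k2 : R}
  {N : int -> T -> nat} {lam : int -> T -> R}.
Hypothesis H : poisson_autoregression P f0 k1 k2 N lam.
Local Notation all_moments := (all_moments (P := P)).
Local Notation xi := (xi (N := N) (lam := lam)).
Local Notation innov := (innov (N := N) (lam := lam)).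

(** The error of one step of the replacement for the increment [u xi] and the conditional variance
    [2 u^2 lam^2], divided by [u^3]; the last term has a spare factor [u <= 1], which is dropped. *)
Definition lindeberg_term (k : nat) (w : T) : R := `|xi k.+1%:Z w| ^+ 3 +
  2 * lam k.+1%:Z w ^+ 2 * `|xi k.+1%:Z w| + 4 * lam k.+1%:Z w ^+ 4.
Local Notation Q := lindeberg_term.

Lemma bounded_moments_lindeberg_term : bounded_moments (P := P) lindeberg_term.
Proof.
have bx : bounded_moments (P := P) (fun k w => `|xi k.+1%:Z w|).
  exact: bounded_moments_norm (bounded_moments_comp (fun k : nat => k.+1%:Z) (bounded_moments_xi H)).
have bl : bounded_moments (P := P) (fun (k : nat) w => lam k.+1%:Z w).
  exact: (bounded_moments_comp (fun k : nat => k.+1%:Z) (bounded_moments_lam H)).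
have bc (a : R) : bounded_moments (P := P) (fun (_ : nat) _ => a) by exact: bounded_moments_cst.
apply: bounded_momentsD; first apply: bounded_momentsD.
- exact: bounded_momentsX.
- by apply: bounded_momentsM => //; apply: bounded_momentsM => //; exact: bounded_momentsX.
- by apply: bounded_momentsM => //; exact: bounded_momentsX.
Qed.

Section scaled.
Variables (u c s2 a : R).
Hypotheses (u0 : 0 <= u) (u1 : u <= 1) (c0 : 0 < c).

(** The scale [u] is free here and becomes [1 / sqrt n] at the end; [scaled_var] is the predictable
    quadratic variation of [scaled_sum]. *)
Definition scaled_sum (k : nat) (w : T) : R := u * \sum_(j < k) xi j.+1%:Z w.
Definition scaled_var (k : nat) (w : T) : R :=
  u ^+ 2 * \sum_(j < k) (2 * lam j.+1%:Z w ^+ 2).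
Local Notation S := scaled_sum.
Local Notation V := scaled_var.
(* [heat] is evaluated at time [c + s2] minus the quadratic variation so far, capped
   at [s2] to keep the time above [c]. *)
Definition time_left (k : nat) (w : T) : R := c + s2 - Num.min (V k w) s2.
Local Notation W := time_left.

Lemma adapted_innov (s t : int) : s <= t -> adapted N lam t (innov s).
Proof. by move=> st; apply: measurable_funB; [exact: adapted_N|exact: adapted_lam]. Qed.

Lemma adapted_xi (s t : int) : s <= t -> adapted N lam t (xi s).
Proof.
move=> st; apply: measurable_funB; last exact: adapted_N.
by apply: measurable_funX; exact: adapted_innov.
Qed.

Lemma adapted_scaled_sum k : adapted N lam k%:Z (S k).
Proof.
apply: measurable_funM; first exact: measurable_cst.
apply: measurable_sum => j; apply: adapted_xi; rewrite lez_nat; exact: ltn_ord.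
Qed.

Let aV k : adapted N lam k%:Z (V k).
Proof.
apply: measurable_funM; first exact: measurable_cst.
apply: measurable_sum => j; apply: measurable_funM; first exact: measurable_cst.
apply: measurable_funX; apply: adapted_lam; rewrite lez_nat; exact: ltn_ord.
Qed.

Let aW k : adapted N lam k%:Z (W k).
Proof.
apply: measurable_funB; first exact: measurable_cst.
apply: (@measurable_minr _ (g_sigma_algebraType (past_gen N lam k%:Z)) _ setT (V k) (fun=> s2)).
  exact: aV.
exact: measurable_cst.
Qed.

Let cW k w : c <= W k w.
Proof. by rewrite /W -addrA lerDl subr_ge0 ge_min lexx orbT. Qed.

Let W0 k w : 0 < W k w. Proof. exact: lt_le_trans c0 (cW k w). Qed.

Let moments_of_adapted k (Y : T -> R) (K : R) : adapted N lam k%:Z Y ->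
  (forall w, `|Y w| <= K) -> all_moments Y.
Proof.
move=> aY YK; apply: (@bounded_moments_bounded _ _ _ _ _ _ K) => [_|_ w] //.
exact: (adapted_measurable H aY).
Qed.

Let moments_xi t : all_moments (xi t).
Proof. exact: (bounded_moments_at t (bounded_moments_xi H)). Qed.

Lemma all_moments_scaled_sum k : all_moments (S k).
Proof.
apply: all_momentsZ.
exact: (@all_moments_sum _ _ _ P 'I_k _ (fun j => xi j.+1%:Z)).
Qed.

Let moments_V k : all_moments (V k).
Proof.
apply: all_momentsZ.
apply: (@all_moments_sum _ _ _ P 'I_k _ (fun j w => 2 * lam j.+1%:Z w ^+ 2)) => j.
by apply: all_momentsZ; apply: all_momentsX; exact: (all_moments_lam H).
Qed.

Let VS k w : V k.+1 w = V k w + u ^+ 2 * (2 * lam k.+1%:Z w ^+ 2).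
Proof. by rewrite /V big_ord_recr/= mulrDr. Qed.

Let SS k w : S k.+1 w = S k w + u * xi k.+1%:Z w.
Proof. by rewrite /S big_ord_recr/= mulrDr. Qed.

(** The time decreases by the increment [t] of the capped variation, at most the conditional
    variance [x2]. The shortfall [x2 - t] is the increment of [V - min(V, s2)], so it telescopes
    over the steps. *)
Let step (K : R) : (forall x X w t s2 : R, c <= w - t -> 0 <= t -> t <= s2 ->
  `|heat (x + X) (w - t) - heat x w - heat_x x w * X - 2^-1 * heat_xx x w * (X ^+ 2 - s2)|
    <= K * (`|X| ^+ 3 + t * `|X| + t ^+ 2 + (s2 - t))) -> 0 <= K ->
  forall k w, `|heat (S k.+1 w - a) (W k.+1 w) - heat (S k w - a) (W k w) -
    u * (heat_x (S k w - a) (W k w) * xi k.+1%:Z w) -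
    2^-1 * u ^+ 2 * (heat_xx (S k w - a) (W k w) * xi k.+1%:Z w ^+ 2 -
      heat_xx (S k w - a) (W k w) * (2 * lam k.+1%:Z w ^+ 2))|
   <= K * (u ^+ 3 * Q k w + (V k.+1 w - Num.min (V k.+1 w) s2) - (V k w - Num.min (V k w) s2)).
Proof.
move=> hK K0 k w.
set x2 := u ^+ 2 * (2 * lam k.+1%:Z w ^+ 2).
have x20 : 0 <= x2 by rewrite mulr_ge0 ?sqr_ge0// mulr_ge0 ?sqr_ge0.
pose t := Num.min (V k.+1 w) s2 - Num.min (V k w) s2.
have t0 : 0 <= t.
  rewrite subr_ge0 le_min !ge_min lexx orbT andbT VS.
  by rewrite lerDl x20.
have tx : t <= x2.
  by rewrite /t VS -/x2 /Num.min; case: ltP => ?; case: ltP => ?; lra.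
have WE : W k.+1 w = W k w - t by rewrite /W /t; ring.
have SE : S k.+1 w - a = S k w - a + u * xi k.+1%:Z w by rewrite SS; ring.
have := hK (S k w - a) (u * xi k.+1%:Z w) (W k w) t x2; rewrite -WE cW -SE => /(_ isT t0 tx).
set A := (X in `|X| <= _); set B := (X in _ -> `|X| <= _).
have -> : A = B by rewrite /A /B /x2; ring.
move=> h; apply: (le_trans h); rewrite ler_wpM2l//.
rewrite [leRHS](_ : _ = u ^+ 3 * Q k w + (x2 - t)); last first.
  by rewrite /t VS -/x2; ring.
rewrite lerD2r normrM (ger0_norm u0) /Q !mulrDr; apply: lerD; first apply: lerD.
- by rewrite exprMn.
- apply: (@le_trans _ _ (x2 * (u * `|xi k.+1%:Z w|))).
    by rewrite ler_wpM2r// mulr_ge0.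
  by rewrite /x2 le_eqVlt; apply/orP; left; apply/eqP; ring.
- apply: (@le_trans _ _ (x2 ^+ 2)); first by rewrite lerXn2r ?nnegrE.
  rewrite (_ : x2 ^+ 2 = u * (u ^+ 3 * (4 * lam k.+1%:Z w ^+ 4))); last by rewrite /x2; ring.
  by rewrite ler_piMl// mulr_ge0 ?exprn_ge0// mulr_ge0 ?exprn_ge0// (lam_ge0 H).
Qed.

Hypothesis s20 : 0 <= s2.

Let heat_bounded := heat_bounds c0.

Let moments_heat k : all_moments (fun w => heat (S k w - a) (W k w)).
Proof.
have [K _ hK] := heat_bounded.
apply: (@moments_of_adapted k _ K) => [|w]; last by have [] := hK (S k w - a) _ (cW k w).
apply: measurable_heat => //; first exact: measurable_funB (@adapted_scaled_sum k) (measurable_cst _).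
exact: aW.
Qed.

Let adapted_heat_x k : adapted N lam k%:Z (fun w => heat_x (S k w - a) (W k w)).
Proof.
apply: measurable_heat_x => //; first exact: measurable_funB (@adapted_scaled_sum k) (measurable_cst _).
exact: aW.
Qed.

Let adapted_heat_xx k : adapted N lam k%:Z (fun w => heat_xx (S k w - a) (W k w)).
Proof.
apply: measurable_heat_xx => //; first exact: measurable_funB (@adapted_scaled_sum k) (measurable_cst _).
exact: aW.
Qed.

Let moments_heat_x k : all_moments (fun w => heat_x (S k w - a) (W k w)).
Proof.
have [K _ hK] := heat_bounded.
by apply: (@moments_of_adapted k _ K) => // w; have [] := hK (S k w - a) _ (cW k w).
Qed.

Let moments_heat_xx k : all_moments (fun w => heat_xx (S k w - a) (W k w)).
Proof.
have [K _ hK] := heat_bounded.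
by apply: (@moments_of_adapted k _ K) => // w; have [] := hK (S k w - a) _ (cW k w).
Qed.

Let moments_Q k : all_moments (Q k).
Proof. exact: (bounded_moments_at k bounded_moments_lindeberg_term). Qed.

Let moments_minV k : all_moments (fun w => Num.min (V k w) s2).
Proof.
have V0 w : 0 <= V k w.
  by rewrite mulr_ge0 ?sqr_ge0// sumr_ge0// => j _; rewrite mulr_ge0 ?sqr_ge0.
apply: bounded_moments_le (moments_V k) => [_|_ w].
  by apply: measurable_minr => //; exact: (adapted_measurable H (@aV k)).
by rewrite !ger0_norm ?le_min ?V0// ge_min lexx.
Qed.

(** In mean, the first-order term vanishes because [xi] is a martingale difference, and the
    second-order term because [xi^2] and [2 lam^2] have the same conditional mean; only the errors
    of the steps add up. The sum starts at [0] with the full time [c + s2]. *)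
Lemma heat_expansion (K : R) : (forall x X w t s2 : R, c <= w - t -> 0 <= t -> t <= s2 ->
  `|heat (x + X) (w - t) - heat x w - heat_x x w * X - 2^-1 * heat_xx x w * (X ^+ 2 - s2)|
    <= K * (`|X| ^+ 3 + t * `|X| + t ^+ 2 + (s2 - t))) -> 0 <= K ->
  forall k, `|\int[P]_w heat (S k w - a) (W k w) - heat (- a) (c + s2)| <=
    K * \int[P]_w (u ^+ 3 * (\sum_(j < k) Q j w) + (V k w - Num.min (V k w) s2)).
Proof.
move=> hK K0.
have MSQ k : all_moments (fun w => u ^+ 3 * \sum_(j < k) Q j w).
  by apply: all_momentsZ; exact: (@all_moments_sum _ _ _ P 'I_k _ (fun j => Q j)).
have MVm k : all_moments (fun w => V k w - Num.min (V k w) s2) by exact: all_momentsB.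
elim=> [|k ih].
  have S0 w : S 0 w = 0 by rewrite /S big_ord0 mulr0.
  have V0 w : V 0 w = 0 by rewrite /V big_ord0 mulr0.
  under eq_Rintegral do rewrite /W V0 S0 sub0r (min_idPl s20) subr0.
  rewrite Rintegral_prob_cst subrr normr0.
  under eq_Rintegral do rewrite V0 big_ord0 mulr0 (min_idPl s20) subrr addr0.
  by rewrite Rintegral_prob_cst mulr0.
set h := fun k w => heat (S k w - a) (W k w).
set hx := fun w => heat_x (S k w - a) (W k w).
set hxx := fun w => heat_xx (S k w - a) (W k w).
have Mx : all_moments (fun w => hx w * xi k.+1%:Z w).
  exact: (all_momentsM (@moments_heat_x k) (moments_xi _)).
have Mxx : all_moments (fun w => hxx w * xi k.+1%:Z w ^+ 2).
  exact: (all_momentsM (@moments_heat_xx k) (all_momentsX 2 (moments_xi _))).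
have Mxl : all_moments (fun w => hxx w * (2 * lam k.+1%:Z w ^+ 2)).
  apply: (all_momentsM (@moments_heat_xx k)); apply: all_momentsZ; apply: all_momentsX.
  exact: (all_moments_lam H).
have k1E : k.+1%:Z = k%:Z + 1 by lia.
have Ex : \int[P]_w (hx w * xi k.+1%:Z w) = 0.
  by rewrite k1E; exact: (Rintegral_xi H (@adapted_heat_x k) (@moments_heat_x k)).
have Exx : \int[P]_w (hxx w * xi k.+1%:Z w ^+ 2) = \int[P]_w (hxx w * (2 * lam k.+1%:Z w ^+ 2)).
  by rewrite k1E; exact: (Rintegral_xi2 H (@adapted_heat_xx k) (@moments_heat_xx k)).
set rest := fun w => u ^+ 3 * Q k w + (V k.+1 w - Num.min (V k.+1 w) s2) -
   (V k w - Num.min (V k w) s2).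
have MQ3 : all_moments (fun w => u ^+ 3 * Q k w) by exact: all_momentsZ.
have Mrest : all_moments rest by apply: all_momentsB => //; exact: all_momentsD.
have M2 : all_moments (fun w => hxx w * xi k.+1%:Z w ^+ 2 - hxx w * (2 * lam k.+1%:Z w ^+ 2)).
  exact: all_momentsB.
have Mh : all_moments (fun w => h k.+1 w - h k w).
  by apply: all_momentsB; exact: moments_heat.
have E1 : \int[P]_w h k.+1 w - \int[P]_w h k w = \int[P]_w (h k.+1 w - h k w -
    u * (hx w * xi k.+1%:Z w) -
    2^-1 * u ^+ 2 * (hxx w * xi k.+1%:Z w ^+ 2 - hxx w * (2 * lam k.+1%:Z w ^+ 2))).
  rewrite RintegralB_moments; last 2 first.
  - by apply: all_momentsB => //; exact: all_momentsZ.
  - exact: all_momentsZ.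
  rewrite RintegralB_moments//; last exact: all_momentsZ.
  rewrite RintegralB_moments//; try exact: moments_heat.
  rewrite RintegralZ_moments// RintegralZ_moments// RintegralB_moments// Ex Exx.
  by rewrite subrr !mulr0 !subr0.
have E2 : `|\int[P]_w h k.+1 w - \int[P]_w h k w| <= K * \int[P]_w rest w.
  rewrite E1 -RintegralZ_moments//.
  have MD : all_moments (fun w => h k.+1 w - h k w - u * (hx w * xi k.+1%:Z w) -
    2^-1 * u ^+ 2 * (hxx w * xi k.+1%:Z w ^+ 2 - hxx w * (2 * lam k.+1%:Z w ^+ 2))).
    apply: all_momentsB; last exact: all_momentsZ.
    by apply: all_momentsB => //; exact: all_momentsZ.
  apply: (le_trans (norm_Rintegral_moments MD)); apply: le_Rintegral_moments.
  - exact: all_moments_norm.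
  - exact: all_momentsZ.
  - by move=> w; exact: step.
rewrite (_ : \int[P]_w _ - _ = (\int[P]_w h k.+1 w - \int[P]_w h k w) +
   (\int[P]_w h k w - heat (- a) (c + s2))); last by rewrite addrA subrK.
apply: (le_trans (ler_normD _ _)); apply: (le_trans (lerD E2 ih)).
rewrite -mulrDr ler_wpM2l// -RintegralD_moments//; last exact: all_momentsD.
rewrite le_eqVlt; apply/orP; left; apply/eqP; apply: eq_Rintegral => w _.
have -> : \sum_(j < k.+1) Q j w = \sum_(j < k) Q j w + Q k w by rewrite big_ord_recr.
by rewrite /rest; ring.
Qed.

End scaled.

(** After the last step the time left is [c + s2 - min(V, s2)], not [c]. The Lipschitz bound of the
    kernel in time replaces it by [c], and both this error and the overshoot of the cap are at most
    [|V - s2|]. *)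
Lemma heat_scaled_sum (c s2 a : R) : 0 < c -> 0 <= s2 ->
  exists2 K : R, 0 <= K & forall (u : R) n, 0 <= u -> u <= 1 ->
    `|\int[P]_w heat (scaled_sum u n w - a) c - heat (- a) (c + s2)| <=
    K * (u ^+ 3 * n%:R + \int[P]_w `|scaled_var u n w - s2|).
Proof.
move=> c0 s20; have [K1 K10 hK1] := heat_step c0.
have [K2 K20 hK2] := heat_dist_w c0.

have [B B0 hB] := bounded_moments_Rintegral bounded_moments_lindeberg_term.
exists (K1 * B + K1 + K2); first by rewrite !addr_ge0 ?mulr_ge0.
move=> u n u0 u1.
have Mx j : all_moments (xi j) by exact: (bounded_moments_at j (bounded_moments_xi H)).
have Ml j : all_moments (fun w => 2 * lam j w ^+ 2).
  by apply: all_momentsZ; apply: all_momentsX; exact: (all_moments_lam H).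
have MS : all_moments (scaled_sum u n).
  apply: all_momentsZ; exact: (@all_moments_sum _ _ _ P 'I_n _ (fun j => xi j.+1%:Z)).
have MV : all_moments (scaled_var u n).
  apply: all_momentsZ.
  exact: (@all_moments_sum _ _ _ P 'I_n _ (fun j w => 2 * lam j.+1%:Z w ^+ 2)).
have MVs : all_moments (fun w => `|scaled_var u n w - s2|).
  by apply: all_moments_norm; apply: all_momentsB => //; exact: all_moments_cst.
set EV := \int[P]_w `|scaled_var u n w - s2|.
have EV0 : 0 <= EV by exact: Rintegral_ge0.
have minE w : `|scaled_var u n w - Num.min (scaled_var u n w) s2| <= `|scaled_var u n w - s2|.
  rewrite /Num.min; case: ltP => [_|_]; last by [].
  by rewrite subrr normr0.
have [K3 K30 hK3] := heat_bounds c0.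
have cW w : c <= time_left u c s2 n w by rewrite /time_left -addrA lerDl subr_ge0 ge_min lexx orbT.
have mMin : measurable_fun setT (fun w => Num.min (scaled_var u n w) s2).
  by apply: measurable_minr => //; exact: MV.1 tt.
have mW : measurable_fun setT (time_left u c s2 n) by exact: measurable_funB.
have mS : measurable_fun setT (fun w => scaled_sum u n w - a).
  by apply: measurable_funB => //; exact: MS.1 tt.
have M1 : all_moments (fun w => heat (scaled_sum u n w - a) (time_left u c s2 n w)).
  apply: (@bounded_moments_bounded _ _ _ _ _ _ K3) => [_|_ w].
    by apply: measurable_heat => // w; exact: lt_le_trans c0 (cW w).
  by have [] := hK3 (scaled_sum u n w - a) _ (cW w).
have M2 : all_moments (fun w => heat (scaled_sum u n w - a) c).
  apply: (@bounded_moments_bounded _ _ _ _ _ _ K3) => [_|_ w].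
    exact: measurable_heat.
  by have [] := hK3 (scaled_sum u n w - a) _ (lexx c).
have MQ j : all_moments (lindeberg_term j).
  exact: (bounded_moments_at j bounded_moments_lindeberg_term).
have MsQ : all_moments (fun w => \sum_(j < n) lindeberg_term j w).
  exact: (@all_moments_sum _ _ _ P 'I_n _ (fun j => lindeberg_term j)).
have := heat_expansion a u0 u1 c0 s20 hK1 K10 n.
have Mmin : all_moments (fun w => scaled_var u n w - Num.min (scaled_var u n w) s2).
  apply: bounded_moments_le MVs => [_|_ w]; first by apply: measurable_funB => //; exact: MV.1 tt.
  by rewrite normr_id.
rewrite RintegralD_moments//; last exact: all_momentsZ.
rewrite RintegralZ_moments// (@Rintegral_sum_moments _ _ _ P n lindeberg_term)// => E1.
have E2 : `|\int[P]_w heat (scaled_sum u n w - a) c -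
   \int[P]_w heat (scaled_sum u n w - a) (time_left u c s2 n w)| <= K2 * EV.
  rewrite -RintegralB_moments// /EV -RintegralZ_moments//.
  apply: (le_trans (norm_Rintegral_moments (all_momentsB M2 M1))).
  apply: le_Rintegral_moments.
  - by apply: all_moments_norm; exact: all_momentsB.
  - exact: all_momentsZ.
  - move=> w; apply: (le_trans (hK2 _ _ _ (lexx c) (cW w))); rewrite ler_wpM2l//.
    rewrite (_ : c - time_left u c s2 n w = Num.min (scaled_var u n w) s2 - s2); last first.
      by rewrite /time_left; ring.
    by rewrite /Num.min; case: ltP => [_|_]; rewrite ?lexx// subrr normr0.
have E3 : \int[P]_w (scaled_var u n w - Num.min (scaled_var u n w) s2) <= EV.
  apply: le_Rintegral_moments => // w; apply: le_trans (minE w); exact: ler_norm.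
have E4 : u ^+ 3 * \sum_(k < n) \int[P]_w lindeberg_term k w <= u ^+ 3 * n%:R * B.
  rewrite -mulrA ler_wpM2l ?exprn_ge0//.
  apply: (@le_trans _ _ (\sum_(k < n) B)); last by rewrite sumr_const card_ord mulr_natl.
  apply: ler_sum => k _; apply: le_trans (hB k).
  apply: le_Rintegral_moments => //; first exact: all_moments_norm.
  by move=> w; exact: ler_norm.
rewrite (_ : \int[P]_w _ - _ = (\int[P]_w heat (scaled_sum u n w - a) c -
   \int[P]_w heat (scaled_sum u n w - a) (time_left u c s2 n w)) +
   (\int[P]_w heat (scaled_sum u n w - a) (time_left u c s2 n w) - heat (- a) (c + s2)));
  last by rewrite addrA subrK.
apply: (le_trans (ler_normD _ _)); apply: (le_trans (lerD E2 E1)).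
have := ler_wpM2l K10 (lerD E4 E3).
have u3 : 0 <= u ^+ 3 * n%:R by rewrite mulr_ge0// exprn_ge0.
have := mulr_ge0 K10 u3; have := mulr_ge0 K20 u3; have := mulr_ge0 (mulr_ge0 K10 B0) EV0.
rewrite !mulrDr !mulrDl; lra.
Qed.

Lemma Rintegral_scaled_sum_sqr (u : R) n : \int[P]_w (scaled_sum u n w ^+ 2) =
  u ^+ 2 * n%:R * (2 * \int[P]_w (lam 1 w ^+ 2)).
Proof.
have MS k : all_moments (scaled_sum u k) by exact: all_moments_scaled_sum.
have Mx j : all_moments (xi j) by exact: (bounded_moments_at j (bounded_moments_xi H)).
elim: n => [|n ih].
  under eq_Rintegral do rewrite /scaled_sum big_ord0 mulr0 expr0n.
  by rewrite Rintegral_prob_cst mulr0 mul0r.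
have nE : n.+1%:Z = n%:Z + 1 by lia.
have E1 : \int[P]_w (scaled_sum u n w * xi n.+1%:Z w) = 0.
  by rewrite nE; exact: (Rintegral_xi H (@adapted_scaled_sum u n) (MS n)).
have M1 : all_moments (fun _ : T => 1 : R) by exact: all_moments_cst.
have E2 : \int[P]_w (xi n.+1%:Z w ^+ 2) = 2 * \int[P]_w (lam 1 w ^+ 2).
  have := Rintegral_xi2 H (t := n%:Z) (@measurable_cst _ _ _ _ _ (1 : R)) M1.
  rewrite -nE; under eq_Rintegral do rewrite mul1r.
  move=> ->; under eq_Rintegral do rewrite mul1r.
  rewrite RintegralZ_moments; last by apply: all_momentsX; exact: (all_moments_lam H).
  by rewrite (mean_lam_sqr H).
transitivity (\int[P]_w (scaled_sum u n w ^+ 2 +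
   (2 * u * (scaled_sum u n w * xi n.+1%:Z w) + u ^+ 2 * xi n.+1%:Z w ^+ 2))).
  apply: eq_Rintegral => w _; rewrite {1}/scaled_sum big_ord_recr/= mulrDr -/(scaled_sum u n w).
  by ring.
have M2 : all_moments (fun w => scaled_sum u n w ^+ 2) by exact: all_momentsX.
have M3 : all_moments (fun w => scaled_sum u n w * xi n.+1%:Z w) by exact: all_momentsM.
have M4 : all_moments (fun w => xi n.+1%:Z w ^+ 2) by exact: all_momentsX.
have M5 : all_moments (fun w => 2 * u * (scaled_sum u n w * xi n.+1%:Z w)) by exact: all_momentsZ.
have M6 : all_moments (fun w => u ^+ 2 * xi n.+1%:Z w ^+ 2) by exact: all_momentsZ.
rewrite RintegralD_moments//; last exact: all_momentsD.
rewrite RintegralD_moments// !RintegralZ_moments// ih E1 E2 mulr0 add0r.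
by rewrite -[n.+1%:R]natr1; ring.
Qed.

Lemma cvg_dist_normal_scaled_sum :
  cvg_dist_normal P (fun n => scaled_sum (Num.sqrt n%:R)^-1 n)
    (Num.sqrt (2 * \int[P]_w (lam 1 w ^+ 2))).
Proof.
set v := \int[P]_w (lam 1 w ^+ 2).
have v0 : 0 <= v by apply: Rintegral_ge0 => w _; exact: sqr_ge0.
have u0 n : 0 <= (Num.sqrt n%:R)^-1 :> R by rewrite invr_ge0 sqrtr_ge0.
have un n : (0 < n)%N -> (Num.sqrt n%:R)^-1 ^+ 2 = n%:R^-1 :> R.
  by move=> n0; rewrite exprVn sqr_sqrtr.
have u1 n : (Num.sqrt n%:R)^-1 <= 1 :> R.
  case: n => [|n]; first by rewrite sqrtr0 invr0.
  by rewrite invf_le1 ?sqrtr_gt0// -[leLHS]sqrtr1 ler_sqrt// ler1n.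
have MS n : all_moments (scaled_sum (Num.sqrt n%:R)^-1 n) by exact: all_moments_scaled_sum.
apply: (@cvg_dist_normal_heat _ _ _ _ _ _ _ _ (2 * v)) => //.
- by move=> n; exact: (MS n).1 tt.
- move=> n; split; first exact: (all_moments_integrable (all_momentsX 2 (MS n))).
  rewrite Rintegral_scaled_sum_sqr -/v; case: n => [|n].
    by rewrite mulr0 mul0r mulr_ge0.
  by rewrite un// mulVf ?mul1r// pnatr_eq0.
move=> c a c0; rewrite sqr_sqrtr ?mulr_ge0//.
have [K K0 hK] := @heat_scaled_sum c (2 * v) a c0 (mulr_ge0 (ler0n R 2) v0).
have cu := @cvg_inv_sqrt R.
have cv := lln_lam_sqr H.
have bound : K * ((Num.sqrt n%:R)^-1 + 2 * \int[P]_w `|n%:R^-1 * \sum_(k < n) lam k.+1%:Z w ^+ 2 - v|)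
   @[n --> \oo] --> (0 : R).
  rewrite [X in _ --> X](_ : 0 = K * (0 + 2 * 0)); last by ring.
  by apply: cvgMr; apply: cvgD => //; exact: cvgMr.
apply/cvgrPdist_le => e e0.
have /cvgrPdist_le/(_ _ e0) hb := bound.
near=> n; have n0 : (0 < n)%N by near: n; exact: nbhs_infty_gt.
have nn0 : n%:R != 0 :> R by rewrite pnatr_eq0 -lt0n.
rewrite distrC -heatN; apply: (le_trans (hK _ n (u0 n) (u1 n))).
have : `|0 - K * ((Num.sqrt n%:R)^-1 + 2 * \int[P]_w `|n%:R^-1 * \sum_(k < n) lam k.+1%:Z w ^+ 2 - v|)| <= e.
  by near: n.
rewrite sub0r normrN => h; apply: le_trans h; apply: le_trans (ler_norm _).
(* For [u = 1 / sqrt n], [u^3 n = u]. *)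
rewrite ler_wpM2l// exprS -mulrA un// mulVf// mulr1 lerD2l.
rewrite -[leRHS]RintegralZ_moments; last first.
  apply: all_moments_norm; apply: all_momentsB; last exact: all_moments_cst.
  apply: all_momentsZ; apply: (@all_moments_sum _ _ _ P 'I_n _ (fun j w => lam j.+1%:Z w ^+ 2)) => j.
  by apply: all_momentsX; exact: (all_moments_lam H).
rewrite le_eqVlt; apply/orP; left; apply/eqP; apply: eq_Rintegral => w _.
rewrite /scaled_var un// -mulr_sumr mulrCA -mulrBr normrM ger0_norm//.
Unshelve. all: by end_near. Qed.

End lindeberg.

(** * The plug-in recursion *)

Section plug_in_recursion.
Context {R : realType}.
Implicit Types (g : R -> nat -> R) (y : nat -> nat) (q l : nat -> R) (r : R).

(** The plug-in recursion for one map [g] in place of a parameter: the bounds below are pathwise and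
    uniform over admissible maps, so [g] may depend on the whole sample. *)
Fixpoint plug g (x : R) y k : R :=
  if k is k'.+1 then g (plug g x y k') (y k') else x.

(** The sum of [r^(k - 1 - i) q_i] over [i < k]. *)
Fixpoint discount_sum (r : R) q k : R :=
  if k is k'.+1 then r * discount_sum r q k' + q k' else 0.

Lemma plugD g x y j k :
  plug g x y (j + k) = plug g (plug g x y j) (fun i => y (j + i)%N) k.
Proof. by elim: k => [|k ih]; rewrite ?addn0// addnS/= ih. Qed.

Lemma discount_sum_ge0 r q k : 0 <= r -> (forall i, 0 <= q i) -> 0 <= discount_sum r q k.
Proof. by move=> r0 q0; elim: k => //= k ih; rewrite addr_ge0// mulr_ge0. Qed.

Lemma discount_sum_shift_le r q j k : 0 <= r -> (forall i, 0 <= q i) ->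
  discount_sum r (fun i => q (j + i)%N) k <= discount_sum r q (j + k).
Proof.
move=> r0 q0; elim: k => [|k ih]; first by rewrite /= addn0 discount_sum_ge0.
by rewrite addnS/= lerD2r ler_wpM2l.
Qed.

Variables (f0 g : R -> nat -> R) (r b : R) (l : nat -> R) (y : nat -> nat).
Hypotheses (r0 : 0 <= r) (r1 : r < 1) (b0 : 0 <= b).
Hypothesis f0_ge0 : forall (x : R) k, 0 <= x -> 0 <= f0 x k.
Hypothesis g_ge0 : forall (x : R) k, 0 <= x -> 0 <= g x k.
Hypothesis f0_lip : forall (x x' : R) k, 0 <= x -> 0 <= x' -> `|f0 x k - f0 x' k| <= r * `|x - x'|.
Hypothesis g_lip : forall (x x' : R) k, 0 <= x -> 0 <= x' -> `|g x k - g x' k| <= r * `|x - x'|.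
Hypothesis g_dist : forall (x : R) k, 0 <= x -> `|g x k - f0 x k| <= b * (x + k%:R + 1).
Hypothesis l_ge0 : forall k, 0 <= l k.
Hypothesis lS : forall k, l k.+1 = f0 (l k) (y k).

Lemma plug_ge0 (h : R -> nat -> R) x (z : nat -> nat) k : (forall (x : R) k, 0 <= x -> 0 <= h x k) ->
  0 <= x -> 0 <= plug h x z k.
Proof. by move=> h0 x0; elim: k => //= k ih; exact: h0. Qed.

Lemma plug_lip (h : R -> nat -> R) x x' (z : nat -> nat) k :
  (forall (x : R) k, 0 <= x -> 0 <= h x k) ->
  (forall (x x' : R) k, 0 <= x -> 0 <= x' -> `|h x k - h x' k| <= r * `|x - x'|) ->
  0 <= x -> 0 <= x' -> `|plug h x z k - plug h x' z k| <= r ^+ k * `|x - x'|.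
Proof.
move=> h0 hl x0 x'0; elim: k => [|k ih]; first by rewrite expr0 mul1r.
rewrite /= exprS -mulrA; apply: (le_trans (hl _ _ _ _ _)); [exact: plug_ge0..|].
by rewrite ler_wpM2l.
Qed.

Let q k := l k + (y k)%:R + 1.
Let q0 k : 0 <= q k. Proof. by rewrite !addr_ge0. Qed.
Local Notation Q := (discount_sum r q).
Let Q0 k : 0 <= Q k. Proof. exact: discount_sum_ge0. Qed.

Lemma plug_path j k : plug f0 (l j) (fun i => y (j + i)%N) k = l (j + k)%N.
Proof. by elim: k => [|k ih]; rewrite ?addn0//= ih addnS lS. Qed.

(** Each step contracts the current error by the Lipschitz bound on [g] and adds [g - f0], evaluated
    on the true path, where it is at most [b] times [q]. *)
Lemma plug_dist x j k : 0 <= x ->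
  `|plug g x (fun i => y (j + i)%N) k - l (j + k)%N| <=
  r ^+ k * `|x - l j| + b * discount_sum r (fun i => q (j + i)%N) k.
Proof.
move=> x0; elim: k => [|k ih]; first by rewrite expr0 mul1r mulr0 addr0 addn0.
rewrite addnS lS /=; set p := plug _ _ _ _.
have p0 : 0 <= p by exact: plug_ge0.
rewrite (_ : g p _ - _ = (g p (y (j + k)%N) - g (l (j + k)%N) (y (j + k)%N)) +
   (g (l (j + k)%N) (y (j + k)%N) - f0 (l (j + k)%N) (y (j + k)%N))); last by ring.
apply: (le_trans (ler_normD _ _)).
apply: (le_trans (lerD (g_lip _ p0 (l_ge0 _)) (g_dist _ (l_ge0 _)))).
have := ler_wpM2l r0 ih; rewrite -/p exprS /q; lra.
Qed.

Variables (x K : R).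
Hypotheses (x_ge0 : 0 <= x) (xK : `|x - l 0%N| <= K).

Let D k := plug g x y k - l k.
Let K0 : 0 <= K. Proof. exact: le_trans xK. Qed.

Let D_le k : `|D k| <= r ^+ k * K + b * Q k.
Proof.
have := @plug_dist x 0 k x_ge0; rewrite add0n => h; apply: (le_trans h).
by rewrite lerD2r ler_wpM2l// exprn_ge0.
Qed.

Variables (m p : nat) (e : nat -> R).

(** The plug-in recursion restarted from the true intensity [m] steps earlier. It stands for the
    deviation at index [m + j] and, for given [g], depends only on [l j] and the [m] counts from [j]
    on. *)
Definition truncated_dev j := plug g (l j) (fun i => y (j + i)%N) m - l (j + m)%N.

Lemma truncated_dev_le j : `|truncated_dev j| <= b * Q (m + j).
Proof.
have := @plug_dist (l j) j m (l_ge0 _); rewrite subrr normr0 mulr0 add0r => h.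
by apply: (le_trans h); rewrite ler_wpM2l// addnC discount_sum_shift_le.
Qed.

Let dev_truncated j : `|D (m + j) - truncated_dev j| <= r ^+ m * (r ^+ j * K + b * Q j).
Proof.
rewrite /D /truncated_dev addnC plugD opprB addrA subrK.
apply: (le_trans (plug_lip _ _ g_ge0 g_lip _ _)) => //; first exact: plug_ge0.
by rewrite ler_wpM2l ?exprn_ge0//; exact: D_le.
Qed.

(** The squares are bounded by [(x + y)^2 <= 2 x^2 + 2 y^2]. In the cross term the first [m] indices
    leave no room for a restart and are bounded directly; at the others the deviation is replaced by
    [truncated_dev] at a cost carrying the factor [r^m]. The last sum is the one that needs
    cancellation. *)
Lemma remainder_le :
  `|\sum_(k < m + p) (D k ^+ 2 - 2 * (D k * e k))| <=
  \sum_(k < m + p) (2 * K ^+ 2 * r ^+ k + 2 * b ^+ 2 * Q k ^+ 2) +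
  2 * (\sum_(k < m) (K + b * Q k) * `|e k|) +
  2 * (\sum_(j < p) r ^+ m * (r ^+ j * K + b * Q j) * `|e (m + j)%N|) +
  2 * `|\sum_(j < p) truncated_dev j * e (m + j)%N|.
Proof.
have rk1 k : r ^+ k <= 1 by rewrite exprn_ile1// ltW.
rewrite sumrB -mulr_sumr [X in _ - 2 * X]big_split_ord/=.
set A := \sum_(k < m + p) D k ^+ 2; set A1 := \sum_(i < m) _; set A2 := \sum_(i < p) _.
rewrite -!addrA; apply: (le_trans (ler_normB _ _)); apply: lerD.
  rewrite ger0_norm ?sumr_ge0// => [|k _]; last exact: sqr_ge0.
  apply: ler_sum => k _.
  have d := D_le k; have rk : r ^+ k * r ^+ k <= r ^+ k by rewrite ler_piMr ?exprn_ge0.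
  have d2 : D k ^+ 2 <= (r ^+ k * K + b * Q k) ^+ 2.
    rewrite -real_normK ?num_real// lerXn2r ?nnegrE//.
    by rewrite addr_ge0// mulr_ge0// exprn_ge0.
  apply: (le_trans d2).
  have := ler_wpM2l (sqr_ge0 K) rk; have := sqr_ge0 (r ^+ k * K - b * Q k).
  by rewrite !expr2; lra.
rewrite normrM ger0_norm// -!mulrDr ler_wpM2l//.
apply: (le_trans (ler_normD _ _)); apply: lerD.
  apply: (le_trans (ler_norm_sum _ _ _)); apply: ler_sum => k _.
  rewrite normrM ler_wpM2r//; apply: (le_trans (D_le k)).
  by rewrite lerD2r ler_piMl.
rewrite (_ : A2 = (\sum_(j < p) (D (m + j) - truncated_dev j) * e (m + j)%N) +
    \sum_(j < p) truncated_dev j * e (m + j)%N); last first.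
  by rewrite -big_split/=; apply: eq_bigr => j _; rewrite -mulrDl subrK.
apply: (le_trans (ler_normD _ _)); rewrite lerD2r.
apply: (le_trans (ler_norm_sum _ _ _)); apply: ler_sum => j _.
by rewrite normrM ler_wpM2r.
Qed.

Variables (J L : nat) (h : R).
Hypotheses (h0 : 0 < h) (L0 : (0 < L)%N) (LJ : L%:R <= J%:R * h).

(* The estimator depends on the whole sample, so [truncated_dev j] is not adapted.
   On a cell it is constant up to [2 * h], whatever [g]; the cells depend on the past
   only, and there are only [O(1 / h)] of them. *)
Definition in_cell (z : 'I_J * {ffun 'I_m -> 'I_L}) (j : nat) : bool :=
  [&& Num.truncn (l j / h) == z.1, [forall i : 'I_m, y (j + i)%N == z.2 i] & Q (m + j) <= L%:R].

Lemma in_cell_uniq z z' j : in_cell z j -> in_cell z' j -> z = z'.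
Proof.
case: z z' => [a u] [a' u'] /and3P[/eqP/= E1 /forallP E2 _] /and3P[/eqP/= E1' /forallP E2' _].
congr pair; first by apply: val_inj; rewrite /= -E1 -E1'.
apply/ffunP => i; apply: val_inj; rewrite /=.
by have /eqP <- := E2 i; have /eqP <- := E2' i.
Qed.

Lemma sum_in_cell (F : 'I_J * {ffun 'I_m -> 'I_L} -> R) j :
  \sum_z (in_cell z j)%:R * F z =
  if [pick z | in_cell z j] is Some z then F z else 0.
Proof.
case: pickP => [z hz|hz]; last by rewrite big1// => z _; rewrite hz mul0r.
rewrite (bigD1 z)//= hz mul1r big1 ?addr0// => z' zz'.
case: (boolP (in_cell z' j)) => [/(in_cell_uniq hz) E|_]; last by rewrite mul0r.
by rewrite E eqxx in zz'.
Qed.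

(** In no cell, either the intensity, or one of the counts, or the accumulated load reaches [L]. The
    indicator of this event is thus at most the displayed sum divided by [L], a Markov bound before
    integration. *)
Lemma outside_cells j : (forall z, ~~ in_cell z j) ->
  L%:R <= l j + (\sum_(i < m) y (j + i)%N)%:R + Q (m + j).
Proof.
move=> nz; rewrite leNgt; apply/negP => lt_L.
have Q0' := Q0 (m + j); have l0 := l_ge0 j.
have s0 : 0 <= (\sum_(i < m) y (j + i)%N)%:R :> R by [].
have aJ : (Num.truncn (l j / h) < J)%N.
  rewrite truncn_lt_nat ?divr_ge0 ?(ltW h0)// ltr_pdivrMr//.
  by apply: lt_le_trans LJ; lra.
have yL (i : 'I_m) : (y (j + i)%N < L)%N.
  rewrite -(ltr_nat R); apply: le_lt_trans lt_L.
  apply: (@le_trans _ _ (\sum_(i < m) y (j + i)%N)%:R); last lra.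
  by rewrite ler_nat (bigD1 i)//= leq_addr.
have /negP := nz (Ordinal aJ, [ffun i => Ordinal (yL i)]); apply.
apply/and3P; split => //=; last by lra.
by apply/forallP => i; rewrite ffunE.
Qed.

(** The deviation computed from the left end of the cell and its block of counts: for given [g] it
    depends on the cell alone. *)
Let cell_dev (z : 'I_J * {ffun 'I_m -> 'I_L}) : R :=
  let w := fun i => if insub i is Some i' then z.2 i' : nat else 0%N in
  plug g (z.1%:R * h) w m - plug f0 (z.1%:R * h) w m.

Let plug_ext (k : R -> nat -> R) a (w w' : nat -> nat) n : (forall i, (i < n)%N -> w i = w' i) ->
  plug k a w n = plug k a w' n.
Proof.
elim: n => //= n ih ww'; rewrite ih ?ww'// => i ni; apply: ww'; exact: ltnW.
Qed.

(** Inside a cell the counts agree, and the starting points differ by at most [h]; the recursions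
    under [g] and under [f0] each keep that difference below [h]. *)
Let cell_devP z j : in_cell z j -> `|truncated_dev j - cell_dev z| <= 2 * h.
Proof.
move=> /and3P[/eqP E1 /forallP E2 _].
have rm1 : r ^+ m <= 1 by rewrite exprn_ile1// ltW.
rewrite /cell_dev; set w := fun i : nat => _.
have wE i : (i < m)%N -> w i = y (j + i)%N.
  by move=> im; rewrite /w insubT/=; have /eqP/= -> := E2 (Ordinal im).
rewrite !(@plug_ext _ _ _ _ _ wE) /truncated_dev -plug_path.
have c0 : 0 <= z.1%:R * h by rewrite mulr_ge0// ltW.
have lh : `|l j - z.1%:R * h| <= h.
  have lj0 : 0 <= l j / h by rewrite divr_ge0// ltW.
  have /andP[] := truncn_itv lj0; rewrite E1 ler_pdivlMr// ltr_pdivrMr// -[_.+1%:R]natr1.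
  by move=> *; rewrite ler_norml; apply/andP; split; lra.
have rh : r ^+ m * `|l j - z.1%:R * h| <= h.
  by apply: le_trans lh; rewrite ler_piMl.
set P1 := plug _ _ _ _; set P2 := plug _ _ _ _; set P3 := plug _ _ _ _; set P4 := plug _ _ _ _.
rewrite (_ : P1 - P2 - _ = (P1 - P3) - (P2 - P4)); last by ring.
have e1 : `|P1 - P3| <= h by apply: le_trans rh; exact: plug_lip.
have e2 : `|P2 - P4| <= h by apply: le_trans rh; exact: plug_lip.
by have := ler_normB (P1 - P3) (P2 - P4); lra.
Qed.

(** The three terms come from indices outside all cells, from the variation inside a cell, and from
    the cell values. A cell value does not depend on [j], so it leaves the inner sum together with
    all the influence of [g]; what remains weights the [e] by cell indicators only. *)
Lemma truncated_sum_le :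
  `|\sum_(j < p) truncated_dev j * e (m + j)%N| <=
  b / L%:R * (\sum_(j < p) Q (m + j) * `|e (m + j)%N| *
    (l j + (\sum_(i < m) y (j + i)%N)%:R + Q (m + j))) +
  2 * h * (\sum_(j < p) `|e (m + j)%N|) +
  (b * L%:R + 2 * h) * \sum_z `|\sum_(j < p) (in_cell z j)%:R * e (m + j)%N|.
Proof.
have LR : 0 < L%:R :> R by rewrite ltr0n.
pose c j : R := \sum_z (in_cell z j)%:R * cell_dev z.
rewrite (_ : \sum_(j < p) truncated_dev j * e (m + j)%N =
   \sum_(j < p) (truncated_dev j - c j) * e (m + j)%N + \sum_(j < p) c j * e (m + j)%N); last first.
  by rewrite -big_split/=; apply: eq_bigr => j _; rewrite -mulrDl subrK.
apply: (le_trans (ler_normD _ _)); apply: lerD.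
  rewrite !mulr_sumr -big_split/=; apply: (le_trans (ler_norm_sum _ _ _)).
  apply: ler_sum => j _; rewrite normrM /c sum_in_cell.
  have s0 : 0 <= l j + (\sum_(i < m) y (j + i)%N)%:R + Q (m + j) by rewrite !addr_ge0.
  case: pickP => [z hz|hz].
    apply: (@le_trans _ _ (2 * h * `|e (m + j)%N|)); first by rewrite ler_wpM2r// cell_devP.
    by rewrite lerDr !mulr_ge0// invr_ge0 ltW.
  apply: (@le_trans _ _ (b * Q (m + j) * `|e (m + j)%N|)).
    by rewrite subr0 ler_wpM2r// truncated_dev_le.
  rewrite -[leLHS]addr0; apply: lerD; last by rewrite !mulr_ge0// ltW.
  rewrite (_ : b / L%:R * _ = b * Q (m + j) * `|e (m + j)%N| *
    ((l j + (\sum_(i < m) y (j + i)%N)%:R + Q (m + j)) / L%:R)); last by ring.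
  rewrite ler_peMr ?mulr_ge0// ler_pdivlMr// mul1r.
  by apply: outside_cells => z; rewrite hz.
under eq_bigr => j _ do rewrite /c mulr_suml.
rewrite exchange_big/= mulr_sumr; apply: (le_trans (ler_norm_sum _ _ _)).
apply: ler_sum => z _.
(* A cell that is never visited contributes nothing; a visit bounds the cell value by [b L + 2 h]
   through the load condition. *)
have [[j hz]|nz] := pselect (exists j, in_cell z j); last first.
  rewrite !big1 ?normr0 ?mulr0// => j _; have /negP/negbTE -> : ~ in_cell z j by move=> ?; apply: nz; exists j.
    by rewrite mul0r.
  by rewrite !mul0r.
under eq_bigr => i _ do rewrite mulrAC [_ * cell_dev z]mulrC.
rewrite -mulr_sumr normrM ler_wpM2r//.
have d := cell_devP hz; have t := truncated_dev_le j.
have /and3P[_ _ QL] := hz.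
rewrite (_ : cell_dev z = truncated_dev j - (truncated_dev j - cell_dev z)); last by ring.
apply: (le_trans (ler_normB _ _)); apply: lerD => //; apply: (le_trans t).
by rewrite ler_wpM2l.
Qed.

End plug_in_recursion.

(** * The estimation error *)

Lemma expr_convex (R : realDomainType) (r x y : R) p : 0 <= r <= 1 -> 0 <= x -> 0 <= y ->
  (r * x + (1 - r) * y) ^+ p <= r * x ^+ p + (1 - r) * y ^+ p.
Proof.
move=> /andP[r0 r1] x0 y0; have r'0 : 0 <= 1 - r by rewrite subr_ge0.
elim: p => [|p ih]; first by rewrite !expr0 !mulr1 addrC subrK.
have s0 : 0 <= r * x + (1 - r) * y by rewrite addr_ge0 ?mulr_ge0.
rewrite exprS; apply: (le_trans (ler_wpM2l s0 ih)).
have : 0 <= (x - y) * (x ^+ p - y ^+ p).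
  have [xy|/ltW yx] := leP x y.
    by rewrite mulr_le0// subr_le0// lerXn2r ?nnegrE.
  by rewrite mulr_ge0// subr_ge0// lerXn2r ?nnegrE.
move=> h; have := mulr_ge0 (mulr_ge0 r0 r'0) h.
rewrite !exprS; move: (x ^+ p) (y ^+ p) => a b; lra.
Qed.

Section discounted.
Context {R : realType} {d : measure_display} {T : measurableType d}
  {P : probability T R}.

(** The step [r Q + X] is the convex combination of [Q] and [X / (1 - r)] with weights [r] and
    [1 - r]. By convexity of the [p]-th power, a common bound on the moments of both is
    preserved. *)
Lemma bounded_moments_discount_sum (r : R) (X : nat -> T -> R) : 0 <= r -> r < 1 ->
  (forall k w, 0 <= X k w) -> bounded_moments (P := P) X ->
  bounded_moments (P := P) (fun k w => discount_sum r (X ^~ w) k).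
Proof.
move=> r0 r1 X0 [mX bX].
have r1' : 0 < 1 - r by rewrite subr_gt0.
have mQ k : measurable_fun setT (fun w => discount_sum r (X ^~ w) k).
  elim: k => [|k ih] /=; first exact: measurable_cst.
  by apply: measurable_funD => //; exact: measurable_funM.
have Q0 k w : 0 <= discount_sum r (X ^~ w) k by exact: discount_sum_ge0.
split=> // p; have [K hK] := bX p.
have [c c0 cK] : exists2 c : R, 0 <= c & forall k,
    (\int[P]_w ((X k w / (1 - r)) ^+ p)%:E <= c%:E)%E.
  exists ((1 - r) ^- p * `|K|); first by rewrite mulr_ge0// invr_ge0 exprn_ge0// ltW.
  move=> k; under eq_integral do rewrite exprMn mulrC exprVn EFinM.
  rewrite ge0_integralZl//; last 3 first.
  - by apply/measurable_EFinP; exact: measurable_funX.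
  - by move=> w _; rewrite lee_fin exprn_ge0.
  - by rewrite lee_fin invr_ge0 exprn_ge0// ltW.
  rewrite EFinM lee_wpmul2l ?lee_fin ?invr_ge0 ?exprn_ge0// ?(ltW r1')//.
  apply: (@le_trans _ _ K%:E); last by rewrite lee_fin ler_norm.
  by apply: le_trans (hK k); under eq_integral do rewrite -[X k _](ger0_norm (X0 k _)).
(* The [+ 1] covers the start, where [0 ^+ p] is [1] for [p = 0]. *)
exists (c + 1); elim => [|k ih].
  rewrite /= normr0 integral_prob_cst lee_fin; apply: (@le_trans _ _ 1); last by rewrite lerDr.
  by rewrite exprn_ile1.
have mQp : measurable_fun setT (fun w => discount_sum r (X ^~ w) k ^+ p) by exact: measurable_funX.
have mXp : measurable_fun setT (fun w => (X k w / (1 - r)) ^+ p).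
  by apply: measurable_funX; exact: measurable_funM.
have X0' w : 0 <= X k w / (1 - r) by rewrite divr_ge0// ltW.
apply: (@le_trans _ _ (\int[P]_w ((r * discount_sum r (X ^~ w) k ^+ p)%:E +
    ((1 - r) * (X k w / (1 - r)) ^+ p)%:E))%E).
  apply: ge0_le_integral => //.
  - by apply/measurable_EFinP; apply: measurable_funX; apply: measurableT_comp => //; exact: (mQ k.+1).
  - by apply: emeasurable_funD; apply/measurable_EFinP; exact: measurable_funM.
  - move=> w _; rewrite -EFinD lee_fin ger0_norm; last exact: (Q0 k.+1 w).
    have := @expr_convex R r (discount_sum r (X ^~ w) k) (X k w / (1 - r)) p.
    rewrite r0 (ltW r1) => /(_ isT (Q0 _ _) (X0' w)); apply: le_trans.
    by rewrite /= mulrCA divff ?mulr1// gt_eqF.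
rewrite ge0_integralD//; last 4 first.
- by move=> w _; rewrite lee_fin mulr_ge0// exprn_ge0.
- by apply/measurable_EFinP; exact: measurable_funM.
- by move=> w _; rewrite lee_fin mulr_ge0// ?exprn_ge0// ltW.
- by apply/measurable_EFinP; exact: measurable_funM.
under eq_integral do rewrite EFinM.
rewrite ge0_integralZl//; last 2 first.
- exact/measurable_EFinP.
- by move=> w _; rewrite lee_fin exprn_ge0.
under [in X in (_ + X)%E]eq_integral do rewrite EFinM.
rewrite ge0_integralZl//; last 3 first.
- exact/measurable_EFinP.
- by move=> w _; rewrite lee_fin exprn_ge0.
- by rewrite lee_fin ltW.
apply: (@le_trans _ _ (r%:E * (c + 1)%:E + (1 - r)%:E * (c + 1)%:E)%E).
  apply: leeD; first rewrite lee_wpmul2l//.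
    by apply: le_trans ih; under [leRHS]eq_integral do rewrite ger0_norm//.
  rewrite lee_wpmul2l ?lee_fin ?(ltW r1')//; apply: (le_trans (cK k)).
  by rewrite lee_fin lerDl.
by rewrite -!EFinM -EFinD lee_fin -mulrDl addrC subrK mul1r.
Qed.

End discounted.

Lemma measurable_fun_forall d (T : measurableType d) m (b : 'I_m -> T -> bool) :
  (forall i, measurable_fun setT (b i)) ->
  measurable_fun setT (fun w => [forall i, b i w]).
Proof.
move=> mb; rewrite (_ : (fun _ => _) = fun w => \big[andb/true]_i b i w); last first.
  by apply/funext => w; rewrite big_andE; apply: eq_forallb.
elim: (index_enum _) => [|i s ih].
  by under eq_fun do rewrite big_nil; exact: measurable_cst.
by under eq_fun do rewrite big_cons; exact: measurable_and.
Qed.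

Lemma measurable_fun_natr d (T : measurableType d) (R : realType) (b : T -> bool) :
  measurable_fun setT b -> measurable_fun setT (fun w => (b w)%:R : R).
Proof.
move=> mb; rewrite (_ : (fun _ => _) = fun w => if b w then 1 else 0); last first.
  by apply/funext => w; case: (b w).
by apply: measurable_fun_ifT.
Qed.

(** * Sums of innovations over the cells *)

Section weighted_innovations.
Context {R : realType} {d : measure_display} {T : measurableType d}
  {P : probability T R} {f0 : R -> nat -> R} {k1 k2 : R}
  {N : int -> T -> nat} {lam : int -> T -> R}.
Hypothesis H : poisson_autoregression P f0 k1 k2 N lam.
Local Notation all_moments := (all_moments (P := P)).
Local Notation innov := (innov (N := N) (lam := lam)).

Lemma all_moments_innov t : all_moments (innov t).
Proof. exact: (bounded_moments_at t (bounded_moments_innov H)). Qed.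

Lemma Rintegral_weighted_innov_sqr (c : nat -> T -> R) (s : nat) p :
  (forall j, adapted N lam (s + j)%N%:Z (c j)) -> (forall j, all_moments (c j)) ->
  \int[P]_w (\sum_(j < p) c j w * innov (s + j).+1%:Z w) ^+ 2 =
  \sum_(j < p) \int[P]_w (c j w ^+ 2 * lam (s + j).+1%:Z w).
Proof.
move=> ac mc.
have mi := all_moments_innov.
have mci j : all_moments (fun w => c j w * innov (s + j).+1%:Z w) by exact: all_momentsM.
have mS q : all_moments (fun w => \sum_(j < q) c j w * innov (s + j).+1%:Z w).
  exact: (@all_moments_sum _ _ _ P 'I_q _ (fun j w => c j w * innov (s + j).+1%:Z w)).
have aS q : adapted N lam (s + q)%N%:Z (fun w => \sum_(j < q) c j w * innov (s + j).+1%:Z w).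
  apply: measurable_sum => j; apply: measurable_funM.
    by apply: adapted_le (ac j); rewrite lez_nat leq_add2l ltnW.
  by apply: adapted_innov; rewrite lez_nat ltn_add2l.
elim: p => [|p ih].
  under eq_Rintegral do rewrite big_ord0 expr0n.
  by rewrite big_ord0 Rintegral_prob_cst.
rewrite big_ord_recr/= -ih.
set S := fun w => \sum_(j < p) c j w * innov (s + j).+1%:Z w.
have sE : (s + p).+1%:Z = (s + p)%N%:Z + 1 by lia.
have aSc : adapted N lam (s + p)%N%:Z (fun w => S w * c p w).
  by apply: measurable_funM; [exact: aS|exact: ac].
have mSc : all_moments (fun w => S w * c p w) by apply: all_momentsM; [exact: mS|exact: mc].
have E1 : \int[P]_w (S w * c p w * innov (s + p).+1%:Z w) = 0.
  by rewrite sE; exact: (Rintegral_innov H aSc mSc).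
have ac2 : adapted N lam (s + p)%N%:Z (fun w => c p w ^+ 2) by apply: measurable_funX; exact: ac.
have mc2 : all_moments (fun w => c p w ^+ 2) by exact: all_momentsX.
have E2 : \int[P]_w (c p w ^+ 2 * innov (s + p).+1%:Z w ^+ 2) =
   \int[P]_w (c p w ^+ 2 * lam (s + p).+1%:Z w).
  by rewrite sE; exact: (Rintegral_innov2 H ac2 mc2).
transitivity (\int[P]_w (S w ^+ 2 + (2 * (S w * c p w * innov (s + p).+1%:Z w) +
   c p w ^+ 2 * innov (s + p).+1%:Z w ^+ 2))).
  by apply: eq_Rintegral => w _; rewrite big_ord_recr/= -/(S w); ring.
have M1 : all_moments (fun w => S w ^+ 2) by apply: all_momentsX; exact: mS.
have M2 : all_moments (fun w => S w * c p w * innov (s + p).+1%:Z w) by exact: all_momentsM.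
have M3 := all_momentsM mc2 (all_momentsX 2 (mi (s + p).+1%:Z)).
rewrite (RintegralD_moments M1 (all_momentsD (all_momentsZ 2 M2) M3)).
rewrite (RintegralD_moments (all_momentsZ 2 M2) M3) (RintegralZ_moments 2 M2).
by rewrite E1 E2 mulr0 add0r.
Qed.

Definition past_load (k : nat) (w : T) : R :=
  discount_sum k1 (fun i => lam i.+1%:Z w + (N i.+1%:Z w)%:R + 1) k.
Local Notation Q := past_load.

Let k1_lt1 : k1 < 1. Proof. by have := k12_lt1 H; have := k2_ge0 H; lra. Qed.

Lemma bounded_moments_past_load : bounded_moments (P := P) past_load.
Proof.
apply: (@bounded_moments_discount_sum _ _ _ _ k1
  (fun i w => lam i.+1%:Z w + (N i.+1%:Z w)%:R + 1)).
- exact: (k1_ge0 H).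
- exact: k1_lt1.
- by move=> k w; rewrite !addr_ge0// (lam_ge0 H).
- apply: bounded_momentsD; last exact: bounded_moments_cst.
  apply: bounded_momentsD.
    exact: (bounded_moments_comp (fun k : nat => k.+1%:Z) (bounded_moments_lam H)).
  exact: (bounded_moments_comp (fun k : nat => k.+1%:Z) (bounded_moments_N H)).
Qed.

Lemma past_load_ge0 k w : 0 <= Q k w.
Proof.
apply: discount_sum_ge0; first exact: (k1_ge0 H).
by move=> i; rewrite !addr_ge0// (lam_ge0 H).
Qed.

Lemma adapted_past_load k : adapted N lam k%:Z (Q k).
Proof.
rewrite /past_load; elim: k => [|k ih] /=; first exact: measurable_cst.
have kk : k%:Z <= k.+1%:Z by rewrite lez_nat.
apply: measurable_funD.
  by apply: measurable_funM; [exact: measurable_cst|exact: adapted_le ih].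
apply: measurable_funD; last exact: measurable_cst.
by apply: measurable_funD; [exact: adapted_lam|exact: adapted_N].
Qed.

Section cells.
Variables (m J L : nat) (h : R).
Hypothesis h0 : 0 < h.

Definition cell_mark (z : 'I_J * {ffun 'I_m -> 'I_L}) j w : R :=
  (in_cell k1 (fun i => lam i.+1%:Z w) (fun i => N i.+1%:Z w) h z j)%:R.

(** Index [i] stands for time [i + 1]: the cell uses the intensity at time [j + 1] and counts up to
    time [m + j], all known just before the innovation at [m + j + 1] that it multiplies. *)
Lemma adapted_cell_mark z j : adapted N lam (m + j)%N%:Z (cell_mark z j).
Proof.
apply: measurable_fun_natr.
have al : adapted N lam (m + j)%N%:Z (fun w => lam j.+1%:Z w / h).
  apply: measurable_funM; last exact: measurable_cst.
  by apply: (adapted_lamS H); lia.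
have mcst (a : R) : adapted N lam (m + j)%N%:Z (fun=> a) by exact: measurable_cst.
apply: measurable_and; last apply: measurable_and.
- under eq_fun do rewrite truncn_eq ?divr_ge0 ?(ltW h0) ?(lam_ge0 H)//.
  by apply: measurable_and; [exact: measurable_fun_ler|exact: measurable_fun_ltr].
- apply: measurable_fun_forall => i.
  under eq_fun do rewrite -(eqr_nat R) eq_le.
  have aN : adapted N lam (m + j)%N%:Z (fun w => (N (j + i).+1%:Z w)%:R).
    by apply: adapted_N; have := ltn_ord i; lia.
  by apply: measurable_and; exact: measurable_fun_ler.
- apply: (@measurable_fun_ler _ (g_sigma_algebraType (past_gen N lam (m + j)%N%:Z)) R setT
    (past_load (m + j)) (fun=> L%:R)); [exact: adapted_past_load|exact: mcst].
Qed.

Lemma moments_cell_mark z j : all_moments (cell_mark z j).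
Proof.
apply: (@bounded_moments_bounded _ _ _ _ _ _ 1) => [_|_ w].
  exact: (adapted_measurable H (@adapted_cell_mark z j)).
by rewrite /cell_mark; case: in_cell; rewrite ?normr1 ?normr0.
Qed.

(** Each cell costs [al] plus its second moment over [al]. The first part is paid once per cell. The
    second moments add up to at most [p K], since the innovations are orthogonal and at most one
    cell is occupied at each index. *)
Lemma Rintegral_cells_le p (K al : R) : 0 < al ->
  (forall j, \int[P]_w lam j w <= K) ->
  \int[P]_w (\sum_z `|\sum_(j < p) cell_mark z j w * innov (m + j).+1%:Z w|) <=
  (J * L ^ m)%:R * al + p%:R * K / al.
Proof.
move=> al0 hK.
have mi := all_moments_innov.
have mci z j : all_moments (fun w => cell_mark z j w * innov (m + j).+1%:Z w).
  by apply: all_momentsM; [exact: moments_cell_mark|exact: mi].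
have mS z : all_moments (fun w => \sum_(j < p) cell_mark z j w * innov (m + j).+1%:Z w).
  exact: (@all_moments_sum _ _ _ P 'I_p _ (fun j w => cell_mark z j w * innov (m + j).+1%:Z w)).
have ml j : all_moments (lam j) by exact: (all_moments_lam H).
have mcl z j : all_moments (fun w => cell_mark z j w * lam (m + j).+1%:Z w).
  by apply: all_momentsM; [exact: moments_cell_mark|exact: ml].
have Z_cells : #|{: 'I_J * {ffun 'I_m -> 'I_L}}| = (J * L ^ m)%N.
  by rewrite card_prod card_ffun !card_ord.
have sum_int (F : 'I_J * {ffun 'I_m -> 'I_L} -> T -> R) : (forall z, all_moments (F z)) ->
    \int[P]_w (\sum_z F z w) = \sum_z \int[P]_w F z w.
  move=> mF; elim: (index_enum _) => [|z s ih].
    by under eq_Rintegral do rewrite big_nil; rewrite big_nil Rintegral_prob_cst.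
  under eq_Rintegral do rewrite big_cons.
  rewrite big_cons RintegralD_moments ?ih//.
  exact: (@all_moments_sum _ _ _ P _ s F).
rewrite sum_int; last by move=> z; exact: all_moments_norm.
apply: (@le_trans _ _ (\sum_(z : 'I_J * {ffun 'I_m -> 'I_L})
    (al + (\sum_(j < p) \int[P]_w (cell_mark z j w * lam (m + j).+1%:Z w)) / al))).
  apply: ler_sum => z _; apply: (le_trans (Rintegral_norm_le_sqr (mS z) al0)).
  rewrite lerD2l ler_wpM2r ?invr_ge0 ?(ltW al0)//.
  rewrite (@Rintegral_weighted_innov_sqr (cell_mark z) m p (@adapted_cell_mark z) (moments_cell_mark z)).
  rewrite le_eqVlt; apply/orP; left; apply/eqP; apply: eq_bigr => j _.
  apply: eq_Rintegral => w _; congr (_ * _); rewrite /cell_mark.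
  by case: in_cell; rewrite ?expr1n ?expr0n.
rewrite big_split/= sumr_const Z_cells -[al *+ _]mulr_natl lerD2l.
rewrite -mulr_suml ler_wpM2r ?invr_ge0 ?(ltW al0)// exchange_big/=.
apply: (@le_trans _ _ (\sum_(j < p) K)); last by rewrite sumr_const card_ord mulr_natl.
apply: ler_sum => j _; apply: le_trans (hK (m + j).+1%:Z).
rewrite -sum_int//; apply: le_Rintegral_moments => //.
  exact: (@all_moments_sum _ _ _ P _ _ (fun z w => cell_mark z j w * lam (m + j).+1%:Z w)).
move=> w; rewrite /cell_mark sum_in_cell; case: pickP => // _.
exact: (lam_ge0 H).
Qed.

End cells.
End weighted_innovations.

Lemma sum_expr_le (R : realFieldType) (r : R) n : 0 <= r -> r < 1 ->
  \sum_(k < n) r ^+ k <= (1 - r)^-1.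
Proof.
move=> r0 r1; have r1' : 0 < 1 - r by rewrite subr_gt0.
elim: n => [|n ih]; first by rewrite big_ord0 invr_ge0 ltW.
rewrite big_ord_recl/= expr0; under eq_bigr => k _ do rewrite /bump/= add1n exprS.
rewrite -mulr_sumr; apply: (@le_trans _ _ (1 + r * (1 - r)^-1)).
  by rewrite lerD2l ler_wpM2l.
by rewrite le_eqVlt; apply/orP; left; apply/eqP; field; rewrite gt_eqF.
Qed.

Section sum_bound.
Context {R : realType} {d : measure_display} {T : measurableType d}
  {P : probability T R}.

Lemma Rintegral_sum_le n (X : nat -> T -> R) (c : nat -> R) :
  (forall k, all_moments (P := P) (X k)) -> (forall k, \int[P]_w X k w <= c k) ->
  \int[P]_w (\sum_(k < n) X k w) <= \sum_(k < n) c k.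
Proof. by move=> mX hc; rewrite Rintegral_sum_moments//; apply: ler_sum. Qed.

End sum_bound.

(** * A dominating variable for the remainder *)

Section remainder.
Context {R : realType} {d : measure_display} {T : measurableType d}
  {P : probability T R} {f0 : R -> nat -> R} {k1 k2 : R}
  {N : int -> T -> nat} {lam : int -> T -> R}.
Hypothesis H : poisson_autoregression P f0 k1 k2 N lam.
Local Notation all_moments := (all_moments (P := P)).
Local Notation innov := (innov (N := N) (lam := lam)).
Local Notation Q := (past_load (k1 := k1) (N := N) (lam := lam)).

Let r0 : 0 <= k1 := k1_ge0 H.
Let r1 : k1 < 1. Proof. by have := k12_lt1 H; have := k2_ge0 H; lra. Qed.

(** [Rb] is chosen before [g] and [x0], and the inequality is pathwise. It therefore applies with
    [g] built from the estimator, which may depend on the whole sample and be far from measurable,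
    while [Rb] has moments and a small mean. *)
Lemma remainder_dominated (B K0 eta : R) : 0 <= B -> 0 <= K0 -> 0 < eta ->
  exists n0, forall n, (n0 <= n)%N -> exists Rb : T -> R,
    [/\ all_moments Rb, forall w, 0 <= Rb w, \int[P]_w Rb w <= eta &
     forall w (g : R -> nat -> R) (x0 : R),
     (forall (x : R) k, 0 <= x -> 0 <= g x k) ->
     (forall (x x' : R) k, 0 <= x -> 0 <= x' -> `|g x k - g x' k| <= k1 * `|x - x'|) ->
     (forall (x : R) k, 0 <= x -> `|g x k - f0 x k| <= B * (Num.sqrt n%:R)^-1 * (x + k%:R + 1)) ->
     0 <= x0 -> `|x0 - lam 1 w| <= K0 ->
     `|(Num.sqrt n%:R)^-1 * \sum_(k < n) ((plug g x0 (fun i => N i.+1%:Z w) k - lam k.+1%:Z w) ^+ 2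
       - 2 * ((plug g x0 (fun i => N i.+1%:Z w) k - lam k.+1%:Z w) * innov k.+1%:Z w))| <= Rb w].
Proof.
move=> B0 K00 eta0.
have bQ := bounded_moments_past_load H; have be := bounded_moments_innov H.
have bQe : bounded_moments (P := P) (fun (i : nat * nat) w => Q i.1 w * `|innov i.2.+1%:Z w|).
  apply: bounded_momentsM; first exact: (bounded_moments_comp (fun i : nat * nat => i.1) bQ).
  apply: bounded_moments_norm.
  exact: (bounded_moments_comp (fun i : nat * nat => i.2.+1%:Z) be).
have bound (I : Type) (X : I -> T -> R) : bounded_moments (P := P) X ->
    exists2 c : R, 0 <= c & forall i, \int[P]_w X i w <= c.
  move=> bX; have [c c0 hc] := bounded_moments_Rintegral bX; exists c => // i.
  apply: le_trans (hc i); apply: le_trans (norm_Rintegral_moments (bounded_moments_at i bX)).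
  exact: ler_norm.
have [cQ cQ0 hQ] := bound _ _ (bounded_momentsX 2 bQ).
have [ce ce0 he] := bound _ _ (bounded_moments_norm be).
have [cQe cQe0 hQe] := bound _ _ bQe.
have [cl cl0 hl] := bound _ _ (bounded_moments_lam H).
(* [m] makes the cost of forgetting the remote past at most [eta / 3]. *)
have [m hm] : exists m, 2 * B * cQe * k1 ^+ m <= eta / 3.
  have /cvgrPdist_le cv : k1 ^+ n @[n --> \oo] --> (0 : R).
    by apply: cvg_expr; rewrite ger0_norm.
  have c0 : 0 <= 2 * B * cQe by rewrite !mulr_ge0.
  have e0 : 0 < eta / 3 / (2 * B * cQe + 1) by rewrite !divr_gt0// ltr_wpDl.
  have [m _ /(_ m (leqnn m))/=] := cv _ e0.
  rewrite sub0r normrN ger0_norm ?exprn_ge0// => hm; exists m.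
  rewrite mulrC; move: hm; rewrite ler_pdivlMr ?ltr_wpDl// => hm.
  by apply: le_trans hm; rewrite ler_wpM2l ?exprn_ge0// lerDl.
pose Y j w := Q (m + j) w * `|innov (m + j).+1%:Z w| *
  (lam j.+1%:Z w + (\sum_(i < m) N (j + i).+1%:Z w)%:R + Q (m + j) w).
have bY : bounded_moments (P := P) Y.
  have bQm := bounded_moments_comp (fun j => m + j)%N bQ.
  apply: bounded_momentsM.
    exact: (bounded_moments_comp (fun j => ((m + j)%N, (m + j)%N)) bQe).
  apply: bounded_momentsD => //; apply: bounded_momentsD.
    exact: (bounded_moments_comp (fun j : nat => j.+1%:Z) (bounded_moments_lam H)).
  under eq_fun do under eq_fun do rewrite natr_sum.
  apply: (@bounded_moments_sum _ _ _ P nat 'I_m _ (fun i j w => (N (j + i).+1%:Z w)%:R)) => i.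
  exact: (bounded_moments_comp (fun j : nat => (j + i).+1%:Z) (bounded_moments_N H)).
have [cm cm0 hY] := bound _ _ bY.
(* [A / L] collects the terms that only [L] makes small: indices outside the cells, the variation
   inside a cell, and the second moments over the cells. *)
pose A := 2 * B * cm + 4 * ce + 2 * (B + 2) * cl.
have [L L0 hL] : exists2 L, (0 < L)%N & A / L%:R <= eta / 3.
  exists (Num.truncn (A / (eta / 3))).+1 => //.
  rewrite ler_pdivrMr ?ltr0n// mulrC -ler_pdivrMr ?divr_gt0//.
  exact: ltW (truncnS_gt _).
have LR : 1 <= L%:R :> R by rewrite ler1n.
have LR0 : 0 < L%:R :> R by rewrite ltr0n.
(* [BIG] depends on [m] and [L] but not on [n]; it collects the terms that still carry a factor
   [u = 1 / sqrt n]. *)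
pose BIG := 2 * K0 ^+ 2 / (1 - k1) + 2 * B ^+ 2 * cQ + 2 * m%:R * (K0 * ce + B * cQe) +
  2 * K0 * ce / (1 - k1) + 2 * (B * L%:R + 2) * ((L ^ 2 + 1) * L ^ (m + 2))%:R.
have /cvgrPdist_le cu := @cvg_inv_sqrt R.
have r1' : 0 < 1 - k1 by rewrite subr_gt0.
have rV : 0 <= (1 - k1)^-1 by rewrite invr_ge0 ltW.
have BIG0 : 0 <= BIG.
  by rewrite /BIG !addr_ge0// !mulr_ge0// ?addr_ge0// ?mulr_ge0// exprn_ge0.
have e0 : 0 < eta / 3 / (BIG + 1) by rewrite !divr_gt0// ltr_wpDl.
have [n1 _ hn1] := cu _ e0.
exists (maxn n1 (maxn m 1)) => n; rewrite !geq_max => /and3P[nn1 mn n_gt0].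
have {hn1 nn1} := hn1 n nn1; rewrite /= sub0r normrN.
set u : R := (Num.sqrt n%:R)^-1.
have u0 : 0 < u by rewrite invr_gt0 sqrtr_gt0 ltr0n.
have u0' := ltW u0.
have u2 : u ^+ 2 * n%:R = 1.
  by rewrite exprVn sqr_sqrtr// mulVf// pnatr_eq0 -lt0n.
have u1 : u <= 1 by rewrite -(@ler_pXn2r _ 2)// ?nnegrE// expr1n -[leRHS]u2 ler_peMr ?sqr_ge0// ler1n.
rewrite (ger0_norm u0') ler_pdivlMr ?ltr_wpDl// => huBIG.
pose p := (n - m)%N; have nE : n = (m + p)%N by rewrite subnKC.
have u2p : u ^+ 2 * p%:R <= 1 by rewrite -[leRHS]u2 ler_wpM2l ?sqr_ge0// ler_nat leq_subr.
pose b := B * u; have b0 : 0 <= b by rewrite mulr_ge0.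
have bB : b <= B by rewrite /b ler_piMr.
(* The mesh is smaller than the deviations by the factor [1 / L], and about [L^2 / u] cells then
   cover [[0, L]]: with the factor [u^2] in front, their number is still of order [u]. *)
pose h := u / L%:R; have h0 : 0 < h by rewrite divr_gt0.
pose J := (Num.truncn (L%:R ^+ 2 / u)).+1.
have LJ : L%:R <= J%:R * h.
  rewrite /h mulrA ler_pdivlMr// -expr2 -ler_pdivrMr//.
  exact: ltW (truncnS_gt _).
have uJ : u ^+ 2 * J%:R <= u * (L ^ 2 + 1)%:R.
  have : J%:R <= L%:R ^+ 2 / u + 1.
    rewrite /J -natr1 lerD2r truncn_le divr_ge0// exprn_ge0//.
  move=> /(ler_wpM2l (sqr_ge0 u)) hJ; apply: (le_trans hJ).
  rewrite natrD natrX mulrDr (_ : u ^+ 2 * (_ / u) = u * L%:R ^+ 2); last first.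
    by field; rewrite gt_eqF.
  by rewrite [leRHS]mulrDr lerD2l mulr1 mulr1 expr2 ler_piMr.
pose e k w := innov k.+1%:Z w.
pose R1 w : R := \sum_(k < n) (2 * K0 ^+ 2 * k1 ^+ k + 2 * b ^+ 2 * Q k w ^+ 2).
pose R2 w : R := \sum_(k < m) (K0 + b * Q k w) * `|e k w|.
pose R3 w : R := \sum_(j < p) k1 ^+ m * (k1 ^+ j * K0 + b * Q j w) * `|e (m + j)%N w|.
pose R4 w : R := \sum_(j < p) Y j w.
pose R5 w : R := \sum_(j < p) `|e (m + j)%N w|.
pose R6 w : R := \sum_(z : 'I_J * {ffun 'I_m -> 'I_L})
  `|\sum_(j < p) cell_mark (k1 := k1) (N := N) (lam := lam) h z j w * e (m + j)%N w|.
have mc (c : R) : all_moments (fun=> c) by exact: all_moments_cst.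
have mQ k : all_moments (Q k) by exact: (bounded_moments_at k bQ).
have mQ2 k : all_moments (fun w => Q k w ^+ 2) by exact: all_momentsX.
have me k : all_moments (e k) by exact: (all_moments_innov H).
have men k : all_moments (fun w => `|e k w|) by exact: all_moments_norm.
have mQen j k : all_moments (fun w => Q j w * `|e k w|) by exact: all_momentsM.
have mY j : all_moments (Y j) by exact: (bounded_moments_at j bY).
pose X1 k w : R := 2 * K0 ^+ 2 * k1 ^+ k + 2 * b ^+ 2 * Q k w ^+ 2.
have mX1 k : all_moments (X1 k) by apply: all_momentsD => //; exact: all_momentsZ.
have mR1 : all_moments R1 by exact: (@all_moments_sum _ _ _ P 'I_n _ (fun k => X1 k)).
pose X2 k w : R := (K0 + b * Q k w) * `|e k w|.
have mX2 k : all_moments (X2 k).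
  by apply: all_momentsM => //; apply: all_momentsD => //; exact: all_momentsZ.
have mR2 : all_moments R2 by exact: (@all_moments_sum _ _ _ P 'I_m _ (fun k => X2 k)).
pose X3 j w : R := k1 ^+ m * (k1 ^+ j * K0 + b * Q j w) * `|e (m + j)%N w|.
have mX3 k : all_moments (X3 k).
  apply: all_momentsM => //; apply: all_momentsZ; apply: all_momentsD => //.
  exact: all_momentsZ.
have mR3 : all_moments R3 by exact: (@all_moments_sum _ _ _ P 'I_p _ (fun k => X3 k)).
have mR4 : all_moments R4 by exact: (@all_moments_sum _ _ _ P 'I_p _ (fun k => Y k)).
have mR5 : all_moments R5 by exact: (@all_moments_sum _ _ _ P 'I_p _ (fun j w => `|e (m + j)%N w|)).
have mR6 : all_moments R6.
  apply: all_moments_sum => z; apply: all_moments_norm.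
  apply: (@all_moments_sum _ _ _ P 'I_p _
    (fun j w => cell_mark (k1 := k1) (N := N) (lam := lam) h z j w * e (m + j)%N w)) => j.
  by apply: all_momentsM => //; exact: (moments_cell_mark H).
have hek k : \int[P]_w `|e k w| <= ce by exact: he.
have E1 : \int[P]_w R1 w <= 2 * K0 ^+ 2 / (1 - k1) + 2 * b ^+ 2 * (n%:R * cQ).
  apply: (le_trans (@Rintegral_sum_le _ _ _ P n X1
    (fun k => 2 * K0 ^+ 2 * k1 ^+ k + 2 * b ^+ 2 * cQ) mX1 _)) => [k|].
    rewrite /X1 RintegralD_moments//; last exact: all_momentsZ.
    rewrite Rintegral_prob_cst RintegralZ_moments// lerD2l ler_wpM2l//.
    by rewrite mulr_ge0// exprn_ge0.
  rewrite big_split/= sumr_const card_ord -mulr_sumr -[_ *+ n]mulr_natl.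
  apply: lerD; last by rewrite mulrCA.
  by rewrite ler_wpM2l ?mulr_ge0 ?exprn_ge0// sum_expr_le.
have E2 : \int[P]_w R2 w <= m%:R * (K0 * ce + B * cQe).
  apply: (le_trans (@Rintegral_sum_le _ _ _ P m X2 (fun=> K0 * ce + B * cQe) mX2 _)) => [k|].
    rewrite /X2; under eq_Rintegral do rewrite mulrDl -[b * _ * _]mulrA.
    rewrite RintegralD_moments; [|exact: all_momentsZ..].
    rewrite !RintegralZ_moments//; apply: lerD; first by rewrite ler_wpM2l//; exact: hek.
    by apply: ler_pM => //; [apply: Rintegral_ge0 => w _; rewrite mulr_ge0// (past_load_ge0 H)|exact: (hQe (k, k))].
  by rewrite sumr_const card_ord mulr_natl.
have E3 : \int[P]_w R3 w <= K0 * ce / (1 - k1) + k1 ^+ m * (p%:R * (b * cQe)).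
  apply: (le_trans (@Rintegral_sum_le _ _ _ P p X3
    (fun j => K0 * ce * k1 ^+ j + k1 ^+ m * (b * cQe)) mX3 _)) => [j|].
    rewrite /X3; under eq_Rintegral do rewrite -mulrA mulrDl -[b * _ * _]mulrA.
    rewrite RintegralZ_moments; last by apply: all_momentsD; exact: all_momentsZ.
    rewrite RintegralD_moments; [|exact: all_momentsZ..].
    rewrite !RintegralZ_moments// mulrDr; apply: lerD.
      apply: (@le_trans _ _ (k1 ^+ j * K0 * ce)); last first.
        by rewrite le_eqVlt; apply/orP; left; apply/eqP; ring.
      have a0 : 0 <= k1 ^+ j * K0 by rewrite mulr_ge0 ?exprn_ge0.
      apply: (@le_trans _ _ (k1 ^+ m * (k1 ^+ j * K0 * ce))).
        by rewrite ler_wpM2l ?exprn_ge0// ler_wpM2l//; exact: hek.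
      apply: ler_piMl; first exact: (mulr_ge0 a0).
      by rewrite exprn_ile1// ltW.
    rewrite ler_wpM2l ?exprn_ge0// ler_wpM2l//; exact: (hQe (j, (m + j)%N)).
  rewrite big_split/= sumr_const card_ord -mulr_sumr -[_ *+ p]mulr_natl mulrCA lerD2r.
  by rewrite ler_wpM2l ?mulr_ge0// sum_expr_le.
have E4 : \int[P]_w R4 w <= p%:R * cm.
  apply: (le_trans (@Rintegral_sum_le _ _ _ P p Y (fun=> cm) mY hY)).
  by rewrite sumr_const card_ord mulr_natl.
have E5 : \int[P]_w R5 w <= p%:R * ce.
  apply: (le_trans (@Rintegral_sum_le _ _ _ P p (fun j w => `|e (m + j)%N w|) (fun=> ce) _ _)) => //.
  by rewrite sumr_const card_ord mulr_natl.
have L20 : 0 < L%:R ^+ 2 :> R by rewrite exprn_gt0.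
(* [al = L^2], fixed in [n] rather than balanced against it: the second part is then [p / L^2] up to
   a constant, which remains small after the factor [L] from the cell values. *)
have E6 : \int[P]_w R6 w <= (J * L ^ m)%:R * L%:R ^+ 2 + p%:R * cl / L%:R ^+ 2.
  exact: (Rintegral_cells_le H m J L h0 p L20 hl).
exists (fun w => u * (R1 w + 2 * R2 w + 2 * R3 w +
  2 * (b / L%:R * R4 w + 2 * h * R5 w + (b * L%:R + 2 * h) * R6 w))).
have mZ (c : R) X : all_moments X -> all_moments (fun w => c * X w) by exact: all_momentsZ.
have mD X Z : all_moments X -> all_moments Z -> all_moments (fun w => X w + Z w) by exact: all_momentsD.
have mR4' : all_moments (fun w => b / L%:R * R4 w) by exact: mZ.
have mR5' : all_moments (fun w => 2 * h * R5 w) by exact: mZ.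
have mR6' : all_moments (fun w => (b * L%:R + 2 * h) * R6 w) by exact: mZ.
have mR45 := mD _ _ mR4' mR5'.
have mR456 := mD _ _ mR45 mR6'.
have mR12 := mD _ _ mR1 (mZ 2 _ mR2).
have mR123 := mD _ _ mR12 (mZ 2 _ mR3).
split.
- exact: (mZ u _ (mD _ _ mR123 (mZ 2 _ mR456))).
- move=> w; have Q0 k : 0 <= Q k w by exact: (past_load_ge0 H).
  have l0 k : 0 <= lam k w by exact: (lam_ge0 H).
  have R10 : 0 <= R1 w.
    by apply: sumr_ge0 => k _; rewrite addr_ge0// !mulr_ge0 ?exprn_ge0.
  have R20 : 0 <= R2 w.
    by apply: sumr_ge0 => k _; rewrite mulr_ge0// addr_ge0// mulr_ge0.
  have R30 : 0 <= R3 w.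
    by apply: sumr_ge0 => k _; rewrite !mulr_ge0 ?exprn_ge0// addr_ge0// mulr_ge0 ?exprn_ge0.
  have R40 : 0 <= R4 w.
    by apply: sumr_ge0 => k _; rewrite mulr_ge0 ?mulr_ge0// !addr_ge0.
  have R50 : 0 <= R5 w by exact: sumr_ge0.
  have R60 : 0 <= R6 w by exact: sumr_ge0.
  have bL : 0 <= b * L%:R by rewrite mulr_ge0.
  have bLV : 0 <= b / L%:R by rewrite divr_ge0.
  have h0' := ltW h0.
  apply: mulr_ge0 => //; apply: addr_ge0.
    by apply: addr_ge0; [apply: addr_ge0 => //|]; apply: mulr_ge0.
  apply: mulr_ge0 => //; apply: addr_ge0; first apply: addr_ge0.
  + exact: mulr_ge0.
  + by apply: mulr_ge0 => //; apply: mulr_ge0.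
  + by apply: mulr_ge0 => //; apply: addr_ge0 => //; apply: mulr_ge0.
- rewrite RintegralZ_moments; last exact: (mD _ _ mR123 (mZ 2 _ mR456)).
  rewrite RintegralD_moments//; last exact: mZ.
  rewrite RintegralD_moments//; last exact: mZ.
  rewrite RintegralD_moments//; last exact: mZ.
  rewrite !(@RintegralZ_moments _ _ _ _ _ 2)//.
  rewrite RintegralD_moments// RintegralD_moments// !RintegralZ_moments//.
  move: E1 E2 E3 E4 E5 E6; move: (\int[P]_w R1 w) (\int[P]_w R2 w) (\int[P]_w R3 w)
    (\int[P]_w R4 w) (\int[P]_w R5 w) (\int[P]_w R6 w) => I1 I2 I3 I4 I5 I6 E1 E2 E3 E4 E5 E6.
  have F1 : u * I1 <= u * (2 * K0 ^+ 2 / (1 - k1) + 2 * B ^+ 2 * cQ).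
    rewrite ler_wpM2l//; apply: (le_trans E1).
    rewrite lerD2l (_ : 2 * b ^+ 2 * (n%:R * cQ) = 2 * B ^+ 2 * cQ * (u ^+ 2 * n%:R)); last first.
      by rewrite /b; ring.
    by rewrite u2 mulr1.
  have F2 : u * (2 * I2) <= u * (2 * m%:R * (K0 * ce + B * cQe)).
    by rewrite ler_wpM2l// -mulrA ler_wpM2l.
  have F3 : u * (2 * I3) <= u * (2 * K0 * ce / (1 - k1)) + 2 * B * cQe * k1 ^+ m.
    apply: (@le_trans _ _ (u * (2 * (K0 * ce / (1 - k1) + k1 ^+ m * (p%:R * (b * cQe)))))).
      by rewrite ler_wpM2l// ler_wpM2l.
    rewrite (_ : u * (2 * _) = u * (2 * K0 * ce / (1 - k1)) +
      2 * B * cQe * k1 ^+ m * (u ^+ 2 * p%:R)); last by rewrite /b; ring.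
    by rewrite lerD2l ler_piMr// mulr_ge0 ?exprn_ge0// !mulr_ge0.
  have LV : 0 <= L%:R^-1 :> R by rewrite invr_ge0.
  have F4 : u * (2 * (b / L%:R * I4)) <= 2 * B * cm / L%:R.
    apply: (@le_trans _ _ (u * (2 * (b / L%:R * (p%:R * cm))))).
      by rewrite ler_wpM2l// ler_wpM2l// ler_wpM2l// mulr_ge0.
    rewrite (_ : u * (2 * _) = 2 * B * cm / L%:R * (u ^+ 2 * p%:R)); last by rewrite /b; ring.
    by rewrite ler_piMr// !mulr_ge0.
  have F5 : u * (2 * (2 * h * I5)) <= 4 * ce / L%:R.
    apply: (@le_trans _ _ (u * (2 * (2 * h * (p%:R * ce))))).
      by rewrite ler_wpM2l// ler_wpM2l// ler_wpM2l// mulr_ge0// ltW.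
    rewrite (_ : u * (2 * _) = 4 * ce / L%:R * (u ^+ 2 * p%:R)); last by rewrite /h; ring.
    by rewrite ler_piMr// !mulr_ge0.
  have F6 : u * (2 * ((b * L%:R + 2 * h) * I6)) <=
      u * (2 * (B * L%:R + 2) * ((L ^ 2 + 1) * L ^ (m + 2))%:R) + 2 * (B + 2) * cl / L%:R.
    have BL0 : 0 <= B * L%:R + 2 by rewrite addr_ge0// mulr_ge0.
    have hu : h <= u by rewrite /h ler_pdivrMr// ler_peMr.
    have LVm : 0 <= (J * L ^ m)%:R * L%:R ^+ 2 + p%:R * cl / L%:R ^+ 2 :> R.
      by rewrite addr_ge0// ?mulr_ge0// invr_ge0 ltW.
    apply: (@le_trans _ _ (u * (2 * (u * (B * L%:R + 2) *
      ((J * L ^ m)%:R * L%:R ^+ 2 + p%:R * cl / L%:R ^+ 2))))).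
      rewrite ler_wpM2l// ler_wpM2l//.
      apply: (@le_trans _ _ ((b * L%:R + 2 * h) * ((J * L ^ m)%:R * L%:R ^+ 2 + p%:R * cl / L%:R ^+ 2))).
        rewrite ler_wpM2l// addr_ge0// mulr_ge0//; exact: ltW.
      rewrite ler_wpM2r// /b mulrDr mulrA [u * B]mulrC lerD2l [u * 2]mulrC.
      by rewrite ler_wpM2l.
    rewrite (_ : u * (2 * _) = 2 * (B * L%:R + 2) * (u ^+ 2 * J%:R * (L ^ (m + 2))%:R) +
      2 * (B * L%:R + 2) * cl / L%:R ^+ 2 * (u ^+ 2 * p%:R)); last first.
      by rewrite natrM expnD natrM [(L ^ 2)%:R]natrX; ring.
    apply: lerD.
      rewrite [leRHS]mulrCA ler_wpM2l//; first by rewrite mulr_ge0.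
      by rewrite natrM mulrA ler_wpM2r.
    have LV2 : 0 <= L%:R ^- 2 :> R by rewrite invr_ge0 ltW.
    apply: (@le_trans _ _ (2 * (B * L%:R + 2) * cl / L%:R ^+ 2)).
      by rewrite ler_piMr// !mulr_ge0.
    rewrite ler_pdivrMr// (_ : _ / L%:R * L%:R ^+ 2 = 2 * ((B + 2) * L%:R) * cl); last first.
      by field; rewrite gt_eqF.
    by rewrite ler_wpM2r// ler_wpM2l// mulrDl lerD2l ler_peMr.
  have -> : u * (I1 + 2 * I2 + 2 * I3 + 2 * (b / L%:R * I4 + 2 * h * I5 + (b * L%:R + 2 * h) * I6)) =
    u * I1 + u * (2 * I2) + u * (2 * I3) + u * (2 * (b / L%:R * I4)) + u * (2 * (2 * h * I5)) +
    u * (2 * ((b * L%:R + 2 * h) * I6)) by ring.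
  have uB : u * BIG <= eta / 3.
    by apply: le_trans huBIG; rewrite ler_wpM2l// lerDl.
  apply: (le_trans (lerD (lerD (lerD (lerD (lerD F1 F2) F3) F4) F5) F6)).
  rewrite [leLHS](_ : _ = u * BIG + 2 * B * cQe * k1 ^+ m + A / L%:R); last by rewrite /BIG /A; ring.
  rewrite [leRHS](_ : _ = eta / 3 + eta / 3 + eta / 3); last by field.
  by rewrite lerD// lerD.
- move=> w g x0 g0 g_lip g_dist x00 x0K.
  rewrite normrM (ger0_norm u0') ler_wpM2l//.
  have fl (x x' : R) k : 0 <= x -> 0 <= x' -> `|f0 x k - f0 x' k| <= k1 * `|x - x'|.
    by move=> xx xx'; have := f0_lipschitz H k k xx xx'; rewrite subrr normr0 mulr0 addr0.
  have l0 k : 0 <= lam k.+1%:Z w by exact: (lam_ge0 H).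
  have lS' k : lam k.+2%:Z w = f0 (lam k.+1%:Z w) (N k.+1%:Z w).
    by rewrite -(lamS H) -PoszD addn1.
  have := @remainder_le R f0 g k1 b (fun k => lam k.+1%:Z w) (fun k => N k.+1%:Z w)
    r0 r1 b0 g0 g_lip g_dist l0 lS' x0 K0 x00 x0K m p (fun k => e k w).
  rewrite -nE => hr; apply: (le_trans hr); rewrite lerD2l ler_wpM2l//.
  exact: (@truncated_sum_le R f0 g k1 b (fun k => lam k.+1%:Z w) (fun k => N k.+1%:Z w)
    r0 r1 b0 (f0_ge0 H) g0 fl g_lip g_dist l0 lS' m p (fun k => e k w) J L h h0 L0 LJ).
Qed.

End remainder.

(** * Perturbations in probability *)

Section perturbation.
Context {R : realType} {d : measure_display} {T : measurableType d}
  {P : probability T R}.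

(* [g] need not be measurable: its integral is defined as a supremum over simple
   functions, which is monotone in any case. *)
Lemma ge0_le_integral_sup (f g : T -> \bar R) : (forall w, 0 <= f w)%E ->
  (forall w, f w <= g w)%E -> (\int[P]_w f w <= \int[P]_w g w)%E.
Proof.
move=> f0 fg; have g0 w : (0 <= g w)%E by apply: le_trans (f0 w) (fg w).
rewrite !ge0_integralTE//; apply: le_ereal_sup => _ [h hf <-]; exists h => // w.
exact: le_trans (hf w) (fg w).
Qed.

(** The envelopes are [v + h] and [max(v - h, 0)], the latter cut at [0] because monotonicity of the
    integral is available for nonnegative functions. *)
Lemma ge0_integral_near (u v h : T -> R) (e : R) :
  (forall w, 0 <= u w) -> all_moments (P := P) v -> (forall w, 0 <= v w) ->
  all_moments (P := P) h -> (forall w, 0 <= h w) ->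
  \int[P]_w h w <= e -> (forall w, `|u w - v w| <= h w) ->
  exists2 r : R, (\int[P]_w (u w)%:E)%E = r%:E & `|r - \int[P]_w v w| <= e.
Proof.
move=> u0 mv v0 mh h0 he uv.
have EE (X : T -> R) : all_moments (P := P) X -> (\int[P]_w (X w)%:E = (\int[P]_w X w)%:E)%E.
  by move=> mX; rewrite /Rintegral fineK//; exact: integrable_fin_num (all_moments_integrable mX).
have mvh := all_momentsD mv mh.
have up : (\int[P]_w (u w)%:E <= (\int[P]_w v w + e)%:E)%E.
  apply: (@le_trans _ _ (\int[P]_w (v w + h w)%:E)%E).
    apply: ge0_le_integral_sup => w; first by rewrite lee_fin.
    by rewrite lee_fin; have := uv w; rewrite ler_norml => /andP[_]; lra.
  by rewrite EE// lee_fin RintegralD_moments// lerD2l.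
have ufin : (\int[P]_w (u w)%:E)%E \is a fin_num.
  rewrite ge0_fin_numE; first exact: le_lt_trans up (ltry _).
  by apply: integral_ge0 => w _; rewrite lee_fin.
exists (fine (\int[P]_w (u w)%:E)%E); first by rewrite fineK.
have up' : fine (\int[P]_w (u w)%:E)%E <= \int[P]_w v w + e by rewrite -lee_fin fineK.
have mvmh : all_moments (P := P) (fun w => Num.max (v w - h w) 0).
  have mB := all_momentsB mv mh.
  apply: bounded_moments_le mB => [_|_ w].
    by apply: measurable_maxr => //; exact: (all_momentsB mv mh).1 tt.
  by rewrite ger0_norm ?le_max ?lexx ?orbT// ge_max ler_norm normr_ge0.
have lo : \int[P]_w v w - e <= fine (\int[P]_w (u w)%:E)%E.
  apply: (@le_trans _ _ (\int[P]_w v w - \int[P]_w h w)); first by rewrite lerD2l lerN2.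
  rewrite -RintegralB_moments//.
  apply: (@le_trans _ _ (\int[P]_w Num.max (v w - h w) 0)).
    apply: le_Rintegral_moments => //; first exact: all_momentsB.
    by move=> w; rewrite le_max lexx.
  rewrite -lee_fin [leRHS]fineK//.
  apply: (@le_trans _ _ (\int[P]_w (Num.max (v w - h w) 0)%:E)%E); first by rewrite EE.
  apply: ge0_le_integral_sup => w.
    by rewrite lee_fin le_max lexx orbT.
  rewrite lee_fin ge_max u0 andbT.
  by have := uv w; rewrite ler_norml => /andP[]; lra.
by rewrite ler_norml; apply/andP; split; lra.
Qed.

(** Positive and negative parts are treated separately, hence the factor [2]. *)
Lemma integral_near (u v h : T -> R) (e : R) :
  all_moments (P := P) v -> all_moments (P := P) h -> (forall w, 0 <= h w) ->
  \int[P]_w h w <= e -> (forall w, `|u w - v w| <= h w) ->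
  exists2 r : R, (\int[P]_w (u w)%:E)%E = r%:E & `|r - \int[P]_w v w| <= 2 * e.
Proof.
move=> mv mh h0 he uv.
have mp (X : T -> R) : all_moments (P := P) X -> all_moments (P := P) (fun w => Num.max (X w) 0).
  move=> mX; have mX1 := mX.1 tt; apply: bounded_moments_le mX => [_|_ w].
    exact: measurable_maxr.
  by rewrite ger0_norm ?le_max ?lexx ?orbT// ge_max ler_norm normr_ge0.
have p0 (x : R) : 0 <= Num.max x 0 by rewrite le_max lexx orbT.
have uvN w : `|- u w - - v w| <= h w by rewrite -opprD normrN.
have [a aE ha] := @ge0_integral_near (fun w => Num.max (u w) 0) (fun w => Num.max (v w) 0) h e
  (fun w => p0 _) (mp _ mv) (fun w => p0 _) mh h0 he
  (fun w => le_trans (max0_lipschitz _ _) (uv w)).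
have [b bE hb] := @ge0_integral_near (fun w => Num.max (- u w) 0) (fun w => Num.max (- v w) 0) h e
  (fun w => p0 _) (mp _ (all_momentsN mv)) (fun w => p0 _) mh h0 he
  (fun w => le_trans (max0_lipschitz _ _) (uvN w)).
exists (a - b).
  rewrite integralE EFinB -aE -bE; congr (_ - _)%E; apply: eq_integral => w _.
  - by rewrite funepos.unlock EFin_max.
  - by rewrite funeneg.unlock EFin_max.
have vE : \int[P]_w v w = \int[P]_w Num.max (v w) 0 - \int[P]_w Num.max (- v w) 0.
  rewrite -RintegralB_moments; [|exact: mp|by apply: mp; exact: all_momentsN].
  apply: eq_Rintegral => w _; rewrite /Num.max; case: ltP => ?; case: ltP => ?; lra.
rewrite vE (_ : a - b - _ = (a - \int[P]_w Num.max (v w) 0) - (b - \int[P]_w Num.max (- v w) 0));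
  last by ring.
by apply: (le_trans (ler_normB _ _)); lra.
Qed.

Variables (X Y : nat -> T -> R) (s K : R).
Hypothesis mX : forall n, all_moments (P := P) (X n).
Hypothesis X2 : forall n, \int[P]_w X n w ^+ 2 <= K.
Hypothesis XY : forall eta : R, 0 < eta -> exists n0, forall n, (n0 <= n)%N ->
  exists Bad : set T, [/\ measurable Bad, (P Bad <= eta%:E)%E &
    forall w, ~ Bad w -> `|Y n w - X n w| <= eta].

(** The difference of the test values is dominated by [h], with one term for each case: uniform
    continuity where [|X n| <= A], the bound [2 M] on the bad set, and Chebyshev's inequality where
    [|X n| > A]. The three means add up to [e / 2], which the possible nonmeasurability of [Y]
    doubles. *)
Lemma cvg_dist_normal_close : cvg_dist_normal P X s -> cvg_dist_normal P Y s.
Proof.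
move=> cX g cg [M0 gM0]; have {cX} := cX g cg (ex_intro _ M0 gM0).
pose M : R := `|M0| + 1.
have M_gt0 : 0 < M by rewrite ltr_wpDl.
have gM y : `|g y| <= M by apply: (le_trans (gM0 y)); rewrite (le_trans (ler_norm _))// lerDl.
have mg : measurable_fun setT g by exact: continuous_measurable_fun.
have mgX n : all_moments (P := P) (fun w => g (X n w)).
  apply: (@bounded_moments_bounded _ _ _ _ _ _ M) => // _.
  exact: measurableT_comp (mg) ((mX n).1 tt).
have EX n : (\int[P]_w (g (X n w))%:E = (\int[P]_w g (X n w))%:E)%E.
  by rewrite /Rintegral fineK//; exact: integrable_fin_num (all_moments_integrable (mgX n)).
have close (e : R) : 0 < e -> exists n0, forall n, (n0 <= n)%N ->
    exists2 r : R, (\int[P]_w (g (Y n w))%:E)%E = r%:E & `|r - \int[P]_w g (X n w)| <= e.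
  move=> e0; pose e1 := e / 4; have e10 : 0 < e1 by rewrite divr_gt0.
  (* Chosen so that [2 M |K| / A <= e1 / 2]. *)
  pose A : R := `|K| * (2 * M / (e1 / 2)) + 1.
  have A1 : 1 <= A by rewrite lerDr mulr_ge0// divr_ge0// ?mulr_ge0 ?ltW// divr_gt0.
  have [eta0 eta00 hc] := @heine_cantor R g A e1 cg e10.
  have [n0 hn0] := XY (eta := Num.min eta0 (e1 / 2 / (2 * M)))
    (ltac:(rewrite lt_min eta00/= !divr_gt0// mulr_gt0//)).
  exists n0 => n /hn0[Bad [mBad PBad hBad]].
  have mIB : measurable_fun setT (\1_Bad : T -> R) by exact: measurable_indic.
  pose h w := e1 + (2 * M * (\1_Bad w : R) + 2 * M / A * X n w ^+ 2).
  have m1B : all_moments (P := P) (\1_Bad : T -> R).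
    apply: (@bounded_moments_bounded _ _ _ _ _ _ 1) => // _ w.
    by rewrite ger0_norm//= indicE; case: (_ \in _).
  have mX2 : all_moments (P := P) (fun w => X n w ^+ 2) by exact: all_momentsX.
  have mh1 : all_moments (P := P) (fun w => 2 * M * (\1_Bad w : R)) by exact: all_momentsZ.
  have mh2 : all_moments (P := P) (fun w => 2 * M / A * X n w ^+ 2) by exact: all_momentsZ.
  have mc : all_moments (P := P) (fun=> e1) by exact: all_moments_cst.
  have mh12 := all_momentsD mh1 mh2.
  have mh : all_moments (P := P) h by exact: all_momentsD.
  have M20 : 0 <= 2 * M by rewrite mulr_ge0// ltW.
  have A0 : 0 < A by apply: lt_le_trans A1.
  have MA0 : 0 <= 2 * M / A by rewrite divr_ge0// ltW.
  have EB : \int[P]_w (\1_Bad w : R) = fine (P Bad).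
    by rewrite /Rintegral integral_indic// setIT.
  have hE : \int[P]_w h w <= e / 2.
    rewrite /h RintegralD_moments// RintegralD_moments// Rintegral_prob_cst.
    rewrite !RintegralZ_moments// EB.
    have fP : fine (P Bad) <= e1 / 2 / (2 * M).
      rewrite -lee_fin fineK ?fin_num_measure//; apply: (le_trans PBad).
      by rewrite lee_fin ge_min lexx orbT.
    have t1 : 2 * M * fine (P Bad) <= e1 / 2.
      by rewrite mulrC -ler_pdivlMr// mulr_gt0.
    have t2 : 2 * M / A * \int[P]_w X n w ^+ 2 <= e1 / 2.
      apply: (@le_trans _ _ (2 * M / A * `|K|)).
        by rewrite ler_wpM2l// (le_trans (X2 n))// ler_norm.
      rewrite mulrAC ler_pdivrMr// mulrC -ler_pdivrMl ?divr_gt0//.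
      rewrite (_ : (e1 / 2)^-1 * _ = `|K| * (2 * M / (e1 / 2))); last by ring.
      by rewrite /A lerDl.
    by rewrite /e1 in t1 t2 *; lra.
  have h0 w : 0 <= h w.
    by rewrite /h !addr_ge0 ?(ltW e10)// mulr_ge0// ?sqr_ge0// indicE.
  have gYX w : `|g (Y n w) - g (X n w)| <= h w.
    have dM : `|g (Y n w) - g (X n w)| <= 2 * M.
      by apply: (le_trans (ler_normB _ _)); have := gM (Y n w); have := gM (X n w); lra.
    have X20 : 0 <= 2 * M / A * X n w ^+ 2 by rewrite mulr_ge0// sqr_ge0.
    rewrite /h indicE; have [/set_mem Bw|Bw] := boolP (w \in Bad).
      by apply: (le_trans dM); rewrite mulr1; lra.
    rewrite mulr0 add0r; have [XA|AX] := leP `|X n w| A.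
      apply: (@le_trans _ _ e1); last by rewrite lerDl.
      apply: hc => //; apply: (le_trans (hBad w _)); last by rewrite ge_min lexx.
      by move: Bw; rewrite notin_setE.
    apply: (le_trans dM); apply: (@le_trans _ _ (2 * M / A * X n w ^+ 2)); last by rewrite lerDr ltW.
    rewrite mulrAC ler_pdivlMr// ler_wpM2l// -[X n w ^+ 2]real_normK ?num_real//.
    by rewrite expr2; apply: (le_trans (ltW AX)); rewrite ler_peMr// (le_trans A1 (ltW AX)).
  have [r rE hr] := integral_near (mgX n) mh h0 hE gYX.
  by exists r => //; apply: (le_trans hr); lra.
under eq_fun do rewrite EX.
have limE : exists l : R, normal_expect s g = l%:E.
  rewrite /normal_expect; case: ifP => _; first by exists (g 0).
  apply: (ex_intro _ (fine _)); rewrite fineK//; apply: integrable_fin_num => //.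
  exact: (@integrable_bounded_density _ (measurableTypeR R) R lebesgue_measure _ _ _ mg gM
    (@integrable_normal_pdf R 0 s)).
move: limE => [l ->] /fine_cvgP[_ hcv].
apply/fine_cvgP; split.
  have [n0 hn] := close 1 ltr01; exists n0 => // n /hn[r -> _] //.
apply/cvgrPdist_le => e e0; have e2 : 0 < e / 2 by rewrite divr_gt0.
have [n0 hn0] := close _ e2.
move/cvgrPdist_le: hcv => /(_ _ e2) hcv.
near=> n; have nn0 : (n0 <= n)%N by near: n; exact: nbhs_infty_ge.
have [r rE hr] := hn0 n nn0.
rewrite /= rE/=.
have h1 : `|l - fine (\int[P]_w g (X n w))%:E| <= e / 2 by near: n; exact: hcv.
rewrite (_ : l - r = (l - \int[P]_w g (X n w)) - (r - \int[P]_w g (X n w))); last by ring.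
by apply: (le_trans (ler_normB _ _)); move: h1 => /= h1; lra.
Unshelve. all: by end_near. Qed.

End perturbation.

Lemma lamhat_seq_plug (R : realType) dim (f : 'rV[R]_dim -> R -> nat -> R) th x y k :
  lamhat_seq f th x y k = plug (f th) x y k.
Proof. by elim: k => //= k ->. Qed.

Lemma measurable_row_norm (R : realType) dim d (T : measurableType d) (X : T -> 'rV[R]_dim) :
  (forall i, measurable_fun setT (fun w => X w ord0 i)) ->
  measurable_fun setT (fun w => `|X w|).
Proof.
move=> mX; rewrite (_ : (fun _ => _) = fun w => \big[Num.max/0]_i `|X w i.1 i.2|); last first.
  by apply/funext => w; rewrite /Num.norm/= mx_normrE.
elim: (index_enum _) => [|i s ih].
  by under eq_fun do rewrite big_nil; exact: measurable_cst.
under eq_fun do rewrite big_cons.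
apply: measurable_maxr => //; apply: measurableT_comp => //.
by case: i => i j /=; rewrite (ord1 i).
Qed.

(** * The plug-in statistic compared with the martingale *)

Section good_model.
Context {R : realType} {d : measure_display} {T : measurableType d}
  {P : probability T R} {k1 k2 : R}
  {N : int -> T -> nat} {lam : int -> T -> R}.
Variables (dim : nat) (Theta : set 'rV[R]_dim)
  (f : 'rV[R]_dim -> R -> nat -> R) (theta0 : 'rV[R]_dim) (delta C : R)
  (thetahat : nat -> T -> 'rV[R]_dim) (lam1hat : T -> R) (Y : nat -> T -> R) (A : set T).
Hypothesis H : poisson_autoregression P (f theta0) k1 k2 N lam.
Hypothesis f_ge0 : forall th l y, th \in Theta -> 0 <= l -> 0 <= f th l y.
Hypothesis delta0 : 0 < delta.
Hypothesis f_dist : forall th, th \in Theta -> `|th - theta0| <= delta ->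
  forall l y, 0 <= l -> `|f th l y - f theta0 l y| <= C * `|th - theta0| * (l + y%:R + 1).
Hypothesis f_lip : forall th, th \in Theta -> `|th - theta0| <= delta ->
  forall l l' y y', 0 <= l -> 0 <= l' ->
    `|f th l y - f th l' y'| <= k1 * `|l - l'| + k2 * `|y%:R - y'%:R :> R|.
Hypothesis thetahatT : forall n w, thetahat n w \in Theta.
Hypothesis mtheta : forall n (i : 'I_dim), measurable_fun setT (fun w => thetahat n w ord0 i).
Hypothesis theta_rate : OP_rate P (fun n w => `|thetahat n w - theta0|)
  (fun n => (Num.sqrt n%:R)^-1).
Hypothesis mlam1hat : measurable_fun setT lam1hat.
Hypotheses (mA : measurable A) (PA : P A = 0).
Hypothesis lam1hat_ge0 : forall w, ~ A w -> 0 <= lam1hat w.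
Hypothesis YE : forall n w, ~ A w ->
  Y n w = T_stat f (thetahat n w) (lam1hat w) (fun k => N k.+1%:Z w) n.

Local Notation M := (fun n => scaled_sum (N := N) (lam := lam) (Num.sqrt n%:R)^-1 n).

Let markov (X : T -> R) (eta e : R) : all_moments (P := P) X -> (forall w, 0 <= X w) ->
  0 < eta -> \int[P]_w X w <= eta * e ->
  measurable [set w | (eta < X w)%R] /\ (P [set w | (eta < X w)%R] <= e%:E)%E.
Proof.
move=> mX X0 eta0 EX.
have mS : measurable [set w | (eta < X w)%R].
  rewrite (_ : [set _ | _] = X @^-1` `]eta, +oo[%classic); last first.
    by apply/seteqP; split=> w /=; rewrite in_itv/= andbT.
  by rewrite -[Z in measurable Z]setTI; exact: mX.1 tt _ _ _.
split=> //; set S := [set w | _] in mS *.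
have m1 : all_moments (P := P) (\1_S : T -> R).
  apply: (@bounded_moments_bounded _ _ _ _ _ _ 1) => [_|_ w]; first exact: measurable_indic.
  by rewrite ger0_norm//= indicE; case: (_ \in _).
rewrite -(fineK (fin_num_measure P _ mS)) lee_fin.
have -> : fine (P S) = \int[P]_w (\1_S w : R) by rewrite /Rintegral integral_indic// setIT.
apply: (@le_trans _ _ (\int[P]_w (eta^-1 * X w))).
  apply: le_Rintegral_moments => //; first exact: all_momentsZ.
  move=> w; rewrite indicE mulrC; have [/set_mem/= Sw|_] := boolP (w \in S).
    by rewrite ler_pdivlMr// mul1r ltW.
  by rewrite divr_ge0// ltW.
by rewrite RintegralZ_moments// mulrC ler_pdivrMr// mulrC.
Qed.

(** The bad set joins the null set [A], off which [Y] is the statistic with a nonnegative start, to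
    three events of probability at most [eta / 3]: the estimator is too far off, the starting value
    is too far from [lam 1], or [Rb] exceeds [eta]. *)
Let close (eta : R) : 0 < eta -> exists n0, forall n, (n0 <= n)%N ->
  exists Bad : set T, [/\ measurable Bad, (P Bad <= eta%:E)%E &
    forall w, ~ Bad w -> `|Y n w - M n w| <= eta].
Proof.
move=> eta0; have e3 : 0 < eta / 3 by rewrite divr_gt0.
have [m [n1 hn1]] := theta_rate e3.
have mdev : measurable_fun setT (fun w => `|lam1hat w - lam 1 w|).
  by apply: measurableT_comp => //; apply: measurable_funB => //; exact: (lam_measurable H).
have [K0 hK0] := tail_probability_small P mdev e3.
(* The bound supplied by [OP_rate] may be negative. *)
pose m' := Num.max m 0; have m'0 : 0 <= m' by rewrite le_max lexx orbT.
have B0 : 0 <= `|C| * m' by rewrite mulr_ge0.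
(* Mean at most [eta (eta / 3)], so that Markov's inequality at level [eta] leaves probability
   [eta / 3]. *)
have [n2 hn2] := remainder_dominated H B0 (ler0n R K0) (mulr_gt0 eta0 e3).
have /cvgrPdist_le cu := @cvg_inv_sqrt R.
have dm : 0 < delta / (m' + 1) by rewrite divr_gt0// ltr_wpDl.
have [n3 _ hn3] := cu _ dm.
exists (maxn (maxn n1 n2) (maxn n3 1)) => n; rewrite !geq_max => /andP[/andP[nn1 nn2] /andP[nn3 n0]].
have [Rb [mRb Rb0 ERb hRb]] := hn2 n nn2.
have PA1 := hn1 n nn1; have := hn3 n nn3; rewrite /= sub0r normrN.
set u : R := (Num.sqrt n%:R)^-1 in hRb PA1 *.
have u0 : 0 < u by rewrite invr_gt0 sqrtr_gt0 ltr0n.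
rewrite (ger0_norm (ltW u0)) ler_pdivlMr ?ltr_wpDl// => hu.
set A1 := [set w | _] in PA1; set A2 := [set w | _] in hK0.
have [mA3 PA3] := markov mRb Rb0 eta0 ERb; set A3 := [set w | _] in mA3 PA3.
have nn w : `| `|thetahat n w - theta0| | = `|thetahat n w - theta0| by exact: normr_id.
have A1E : A1 = [set w | (m < `|thetahat n w - theta0| / u)%R].
  by apply/funext => w; rewrite /A1/= nn.
have mA1 : measurable A1.
  rewrite A1E.
  rewrite (_ : [set w | _] = (fun w => `|thetahat n w - theta0| / u) @^-1` `]m, +oo[%classic); last first.
    by apply/seteqP; split=> w /=; rewrite in_itv/= andbT.
  rewrite -[Z in measurable Z]setTI; have : measurable_fun setT (fun w => `|thetahat n w - theta0| / u).
    apply: measurable_funM => //; apply: measurable_row_norm => i.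
    by under eq_fun do rewrite !mxE; exact: measurable_funB.
  exact.
have mA2 : measurable A2.
  rewrite (_ : A2 = (fun w => `|lam1hat w - lam 1 w|) @^-1` `]K0%:R, +oo[%classic); last first.
    by apply/seteqP; split=> w /=; rewrite in_itv/= andbT.
  by rewrite -[Z in measurable Z]setTI; exact: mdev.
exists (A `|` (A1 `|` (A2 `|` A3))); split.
- by do 3 (apply: measurableU => //).
- have hA : (P A <= 0%:E)%E by rewrite PA.
  apply: (le_trans (measureU2 _ _ _)) => //; first by do 2 (apply: measurableU => //).
  apply: (@le_trans _ _ (0%:E + ((eta / 3)%:E + ((eta / 3)%:E + (eta / 3)%:E)))%E); last first.
    by rewrite -!EFinD lee_fin; lra.
  apply: leeD => //; apply: (le_trans (measureU2 _ _ _)) => //; first exact: measurableU.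
  apply: leeD => //; apply: (le_trans (measureU2 _ _ _)) => //.
  exact: leeD.
- move=> w nBad.
  have nA : ~ A w by move=> ?; apply: nBad; left.
  have a1 : `|thetahat n w - theta0| / u <= m.
    by rewrite leNgt; apply/negP => ?; apply: nBad; right; left; rewrite A1E.
  have a2 : `|lam1hat w - lam 1 w| <= K0%:R.
    by rewrite leNgt; apply/negP => ?; apply: nBad; right; right; left.
  have a3 : Rb w <= eta.
    by rewrite leNgt; apply/negP => ?; apply: nBad; right; right; right.
  have th_le : `|thetahat n w - theta0| <= m' * u.
    rewrite -ler_pdivrMr//; apply: (le_trans a1); by rewrite le_max lexx.
  have th_delta : `|thetahat n w - theta0| <= delta.
    apply: (le_trans th_le); apply: le_trans hu; rewrite mulrC ler_wpM2l ?(ltW u0)//.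
    by rewrite lerDl.
  have thT := thetahatT n w.
  apply: le_trans a3; rewrite YE//.
  have := hRb w (f (thetahat n w)) (lam1hat w) (fun x k => @f_ge0 _ x k thT) _ _ (lam1hat_ge0 nA) a2.
  set S := (X in u * X) => hS.
  rewrite (_ : T_stat _ _ _ _ _ - _ = u * S).
    apply: hS => [x x' k x0 x'0|x k x0].
      by have := f_lip thT th_delta k k x0 x'0; rewrite subrr normr0 mulr0 addr0.
    apply: (le_trans (f_dist thT th_delta k x0)); rewrite ler_wpM2r ?addr_ge0//.
    rewrite -mulrA; apply: (@le_trans _ _ (`|C| * `|thetahat n w - theta0|)).
      by rewrite ler_wpM2r// ler_norm.
    by rewrite ler_wpM2l.
  rewrite /T_stat /scaled_sum -/u -mulrBr -sumrB; congr (_ * _).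
  apply: eq_bigr => k _; rewrite lamhat_seq_plug /xi /innov; ring.
Qed.

Lemma cvg_dist_normal_good :
  cvg_dist_normal P Y (Num.sqrt (2 * \int[P]_w (lam 1 w ^+ 2))).
Proof.
set v := \int[P]_w (lam 1 w ^+ 2).
have v0 : 0 <= v by apply: Rintegral_ge0 => w _; exact: sqr_ge0.
apply: (@cvg_dist_normal_close _ _ _ _ M Y _ (2 * v)).
- by move=> n; exact: (all_moments_scaled_sum H).
- move=> n; rewrite (Rintegral_scaled_sum_sqr H) -/v.
  have [->|n0] := eqVneq n 0%N; first by rewrite mulr0 mul0r mulr_ge0.
  by rewrite exprVn sqr_sqrtr// mulVf ?mul1r// pnatr_eq0.
- exact: close.
- exact: (cvg_dist_normal_scaled_sum H).
Qed.

End good_model.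

(** * Discarding null sets *)

(* [phi] sends a null set to one good point, so that the almost sure properties of
   the process hold everywhere after composition with [phi]. *)
Section pullback.
Context {R : realType} {d : measure_display} {T : measurableType d}
  {P : probability T R}.
Variables (A : set T) (phi : T -> T).
Hypotheses (mA : measurable A) (PA : P A = 0).
Hypothesis phi_id : forall w, ~ A w -> phi w = w.
Hypothesis phi_cst : forall w w', A w -> A w' -> phi w = phi w'.

(** [phi] has a single value on [A], so the preimage is [A] united with [B] when that value lies in
    [B], and [B] minus [A] otherwise. *)
Lemma measurable_preimage_pullback (B : set T) : measurable B -> measurable (phi @^-1` B).
Proof.
move=> mB; have [[w0 [Aw0 Bw0]]|nAB] := pselect (exists w, A w /\ B (phi w)).
  rewrite (_ : _ @^-1` _ = A `|` B); first exact: measurableU.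
  apply/seteqP; split=> w /=.
    by have [Aw|nAw] := pselect (A w); [left|rewrite phi_id//; right].
  have [Aw _|nAw [//|Bw]] := pselect (A w); first by rewrite (phi_cst Aw Aw0).
  by rewrite phi_id.
rewrite (_ : _ @^-1` _ = B `\` A); first exact: measurableD.
apply/seteqP; split=> w /=.
  have [Aw Bw|nAw] := pselect (A w); first by exfalso; apply: nAB; exists w.
  by rewrite phi_id.
by move=> [Bw nAw]; rewrite phi_id.
Qed.

Lemma probability_pullback (B : set T) : measurable B -> P (phi @^-1` B) = P B.
Proof.
move=> mB; have mpB := measurable_preimage_pullback mB.
have sub (E F : set T) : measurable E -> measurable F -> E `<=` F `|` A -> (P E <= P F)%E.
  move=> mE mF EF; apply: (@le_trans _ _ (P (F `|` A))).
    by apply: le_measure => //; rewrite inE//; exact: measurableU.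
  apply: (le_trans (measureU2 _ _ _)) => //.
  have hA : (P A <= 0%:E)%E by rewrite PA.
  by apply: (@le_trans _ _ (P F + 0%:E)%E); [exact: leeD|rewrite adde0].
apply/eqP; rewrite eq_le; apply/andP; split; apply: sub => // w /=.
  by have [|nAw] := pselect (A w); [right|rewrite phi_id//; left].
by have [|nAw Bw] := pselect (A w); [right|left; rewrite phi_id].
Qed.

Lemma measurable_fun_pullback (X : T -> R) : measurable_fun setT X ->
  measurable_fun setT (fun w => X (phi w)).
Proof.
move=> mX _ B mB; rewrite setTI.
apply: (measurable_preimage_pullback (B := X @^-1` B)).
by rewrite -[Z in measurable Z]setTI; exact: mX.
Qed.

Lemma integral_pullback (B : set T) (X : T -> R) : measurable B -> measurable_fun setT X ->
  (\int[P]_(w in phi @^-1` B) (X (phi w))%:E = \int[P]_(w in B) (X w)%:E)%E.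
Proof.
move=> mB mX; have mpB := measurable_preimage_pullback mB.
rewrite integral_mkcond [RHS]integral_mkcond.
apply: ae_eq_integral => //.
- apply/(measurable_restrictT _ _).1 => //; apply/measurable_EFinP.
  exact: measurable_funTS (measurable_fun_pullback mX).
- apply/(measurable_restrictT _ _).1 => //; apply/measurable_EFinP.
  exact: measurable_funTS mX.
- exists A; split => // w /= nE; apply: contrapT => nAw; apply: nE => _.
  rewrite /patch/= phi_id//; congr (if _ then _ else _).
  by apply/idP/idP; rewrite !inE/= phi_id.
Qed.

Lemma ge0_integral_pullback (X : T -> R) : measurable_fun setT X ->
  (\int[P]_w (X (phi w))%:E = \int[P]_w (X w)%:E)%E.
Proof. by move=> mX; have := integral_pullback measurableT mX; rewrite preimage_setT. Qed.

Variables (N : int -> T -> nat) (lam : int -> T -> R).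
Hypothesis mN : forall t k, measurable (N t @^-1` [set k]).
Hypothesis mlam : forall t, measurable_fun setT (lam t).
Local Notation N' := (fun t w => N t (phi w)).
Local Notation lam' := (fun t w => lam t (phi w)).

Let mNB t (B : set nat) : measurable (N t @^-1` B).
Proof.
rewrite (_ : _ @^-1` _ = \bigcup_(k in B) (N t @^-1` [set k])); last first.
  by apply/seteqP; split=> [w Bw|w [k Bk /= ->]//]; exists (N t w).
exact: bigcup_measurable.
Qed.

Let mlamB t (B : set R) : measurable B -> measurable (lam t @^-1` B).
Proof. by move=> mB; rewrite -[Z in measurable Z]setTI; exact: mlam. Qed.

Lemma strictly_stationary_pullback : strictly_stationary P N lam ->
  strictly_stationary P N' lam'.
Proof.
move=> st m B D mD t h.
have E s : P (\bigcap_(i < m) (N' (s + i%:Z) @^-1` B i `&` lam' (s + i%:Z) @^-1` D i)) =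
    P (\bigcap_(i < m) (N (s + i%:Z) @^-1` B i `&` lam (s + i%:Z) @^-1` D i)).
  rewrite -[RHS]probability_pullback//.
  rewrite bigcap_mkord; apply: bigsetI_measurable => i _.
  by apply: measurableI; [exact: mNB|exact: mlamB].
by rewrite !E; exact: st.
Qed.

(** The preimages of past events form a sigma-algebra which contains the generators of the past of
    the composed process. *)
Lemma past_sigma_pullback t F : past_sigma N' lam' t F ->
  exists2 F0, past_sigma N lam t F0 & F = phi @^-1` F0.
Proof.
have sa := @sigma_algebra_preimage T T _ setT phi
  (smallest_sigma_algebra setT (past_gen N lam t)).
have sub : past_gen N' lam' t `<=` preimage_set_system setT phi (past_sigma N lam t).
  move=> B [s [st [[D ->]|[D [mD ->]]]]].
    exists (N s @^-1` D); last by rewrite setTI.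
    by apply: sub_gen_smallest; exists s; split => //; left; exists D.
  exists (lam s @^-1` D); last by rewrite setTI.
  by apply: sub_gen_smallest; exists s; split => //; right; exists D.
move=> /(smallest_sub sa sub)[F0 sF0 <-].
by exists F0 => //; rewrite setTI.
Qed.

Lemma cond_poisson_pullback : cond_poisson P N lam -> cond_poisson P N' lam'.
Proof.
move=> cp t k F /past_sigma_pullback[F0 sF0 ->].
have mF0 : measurable F0.
  move: F0 sF0; apply: smallest_sub; first exact: sigma_algebra_measurable.
  by move=> B [s [_ [[D ->]|[D [mD ->]]]]]; [exact: mNB|exact: mlamB].
have mp : measurable_fun setT (fun w => pois_pmf (lam t w) k).
  exact: measurableT_comp (measurable_pois_pmf k) (mlam t).
rewrite (integral_pullback mF0 mp) -(cp t k F0 sF0).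
rewrite -[RHS]probability_pullback//.
by apply: measurableI => //; exact: mN.
Qed.

End pullback.

Theorem theorem4p4 (R : realType) (dim : nat) (Theta : set 'rV[R]_dim)
  (f : 'rV[R]_dim -> R -> nat -> R) (theta0 : 'rV[R]_dim)
  (delta C kappa1 kappa2 : R)
  (d : measure_display) (T : measurableType d) (P : probability T R)
  (N : int -> T -> nat) (lam : int -> T -> R)
  (thetahat : nat -> T -> 'rV[R]_dim) (lam1hat : T -> R) :
  (* f_theta : [0,oo) x N0 -> [0,oo) for theta in Theta *)
  (forall th l y, th \in Theta -> 0 <= l -> 0 <= f th l y) ->
  theta0 \in Theta ->
  0 < delta -> 0 <= kappa1 -> 0 <= kappa2 -> kappa1 + kappa2 < 1 ->
  (forall th, th \in Theta -> `|th - theta0| <= delta ->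
     forall l y, 0 <= l ->
       `|f th l y - f theta0 l y| <= C * `|th - theta0| * (l + y%:R + 1)) ->
  (forall th, th \in Theta -> `|th - theta0| <= delta ->
     forall l l' y y', 0 <= l -> 0 <= l' ->
       `|f th l y - f th l' y'| <= kappa1 * `|l - l'| + kappa2 * `|y%:R - y'%:R :> R|) ->
  (* the stationary Poisson autoregression *)
  (forall t k, measurable (N t @^-1` [set k])) ->
  (forall t, measurable_fun setT (lam t)) ->
  (forall t, {ae P, forall w, 0 <= lam t w}) ->
  strictly_stationary P N lam ->
  cond_poisson P N lam ->
  (forall t : int, {ae P, forall w, lam t w = f theta0 (lam (t - 1) w) (N (t - 1) w)}) ->
  (* estimators with  thetahat_n - theta0 = O_P(n^{-1/2}) *)
  (forall n w, thetahat n w \in Theta) ->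
  (forall n (i : 'I_dim), measurable_fun setT (fun w => thetahat n w ord0 i)) ->
  OP_rate P (fun n w => `|thetahat n w - theta0|) (fun n => (Num.sqrt n%:R)^-1) ->
  (* arbitrary finite nonnegative starting value *)
  measurable_fun setT lam1hat -> {ae P, forall w, 0 <= lam1hat w} ->
  (\int[P]_w ((lam 1 w) ^+ 2)%:E < +oo)%E /\
  cvg_dist_normal P
    (fun n w => T_stat f (thetahat n w) (lam1hat w) (fun k => N (k.+1)%:Z w) n)
    (Num.sqrt (2 * fine (\int[P]_w ((lam 1 w) ^+ 2)%:E)%E)).
Proof.
move=> f_ge0 th0T delta0 k10 k20 k12 f_dist f_lip mN mlam lam_ge0 st cp lamE thT mth rate m1 l1.
(* The integers are two copies of the naturals, so countably many almost sure statements hold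
   together. *)
have aeZ (Q : int -> T -> Prop) : (forall t, {ae P, forall w, Q t w}) ->
    {ae P, forall w, forall t, Q t w}.
  move=> hQ; have hp : {ae P, forall w, forall n : nat, Q (Posz n) w}.
    by apply: ae_foralln => n; exact: hQ.
  have hn : {ae P, forall w, forall n : nat, Q (Negz n) w}.
    by apply: ae_foralln => n; exact: hQ.
  by apply: filterS2 hp hn => w a b [n|n].
have [A [mA PA good]] : {ae P, forall w, (forall t, 0 <= lam t w) /\
    (forall t, lam t w = f theta0 (lam (t - 1) w) (N (t - 1) w)) /\ 0 <= lam1hat w}.
  by apply: filterS3 (aeZ _ lam_ge0) (aeZ _ lamE) l1.
have {}good w : ~ A w -> (forall t, 0 <= lam t w) /\
    (forall t, lam t w = f theta0 (lam (t - 1) w) (N (t - 1) w)) /\ 0 <= lam1hat w.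
  by move=> nAw; apply: contrapT => h; apply: nAw; exact: good.
have [w0 nAw0] : exists w, ~ A w.
  apply: contrapT => h; have AT : A = setT.
    by apply/seteqP; split=> // w _; apply: contrapT => nAw; apply: h; exists w.
  have : P setT = 1%E by exact: probability_setT.
  by rewrite -AT; move=> h1; move: PA; rewrite h1 => /eqP; rewrite onee_eq0.
pose phi w := if w \in A then w0 else w.
have phi_id w : ~ A w -> phi w = w by move=> nAw; rewrite /phi memNset.
have phi_cst w w' : A w -> A w' -> phi w = phi w' by move=> Aw Aw'; rewrite /phi !mem_set.
have phi_good w : ~ A (phi w).
  by rewrite /phi; have [//|] := boolP (w \in A); rewrite notin_setE.
have th00 : `|theta0 - theta0| <= delta by rewrite subrr normr0 ltW.
have H : poisson_autoregression P (f theta0) kappa1 kappa2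
    (fun t w => N t (phi w)) (fun t w => lam t (phi w)).
  split=> //.
  - by move=> l y l0; exact: f_ge0.
  - by move=> l l' y y'; exact: f_lip.
  - move=> t k; exact: (measurable_preimage_pullback mA phi_id phi_cst (mN t k)).
  - move=> t; exact: (measurable_fun_pullback mA phi_id phi_cst (mlam t)).
  - by move=> t w; have [+ _] := good _ (phi_good w); exact.
  - by move=> t w; have [_ [+ _]] := good _ (phi_good w); move=> ->; rewrite addrK.
  - exact: (strictly_stationary_pullback mA PA phi_id phi_cst mN mlam st).
  - exact: (cond_poisson_pullback mA PA phi_id phi_cst mN mlam cp).
have ml2 : measurable_fun setT (fun w => lam 1 w ^+ 2) by exact: measurable_funX.
have IE := ge0_integral_pullback mA PA phi_id phi_cst ml2.
have Ml := all_momentsX 2 (all_moments_lam H 1).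
(* The second moment is computed on the modified process, where all moments are finite. *)
rewrite -IE; split.
  have /integrableP[_] := all_moments_integrable Ml.
  apply: le_lt_trans; apply: ge0_le_integral_sup => w; first by rewrite lee_fin sqr_ge0.
  by rewrite /= lee_fin ler_norm.
apply: (cvg_dist_normal_good H f_ge0 delta0 f_dist f_lip thT mth rate m1 mA PA).
- by move=> w nAw; have [_ [_ ]] := good _ nAw.
- by move=> n w nAw; rewrite phi_id.
Qed.
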